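(* Let $n\ge 1$. (i) Flat para-Kähler space forms are the only toric Ricci-flat para-Kähler manifolds that can be analytically para-Kähler immersed into a (finite-dimensional) para-Kähler space form. That is: if a toric para-Kähler manifold $(U,\omega)$ of para-complex dimension $n$ is Ricci-flat and admits an analytic para-Kähler immersion into some para-Kähler space form $(\mathcal S_c^N,\omega_c)$ with $N\in\mathbb Z^+$, $c\in\mathbb R$, then $(U,\omega)$ is flat (it is a para-Kähler manifold of constant para-holomorphic sectional curvature $0$); and the flat para-Kähler space form $\mathcal S_0^n$ is itself toric and Ricci-flat and admits such an immersion. (ii) In particular, these manifolds can be para-Kähler immersed only into another flat para-Kähler space form: they can be para-Kähler immersed into a flat one, and if $c\neq 0$ they cannot be para-Kähler immersed into $(\mathcal S_c^N,\omega_c)$ for any $N$. (iii) Moreover, toric Ricci-flat para-Kähler manifolds are the only toric para-Kähler-Einstein manifolds that can be analytically para-Kähler immersed into a flat para-Kähler space form: if a toric para-Kähler-Einstein manifold admits an analytic para-Kähler immersion into $(\mathcal S_0^N,\omega_0)$ for some $N$, then its Einstein constant is $0$.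
   Context: Para-complex numbers: $\mathbb D=\{x+\tau y: x,y\in\mathbb R\}$ with $\tau^2=1$; for $z=x+\tau y$ put $\bar z=x-\tau y$ and $|z|^2=z\bar z=x^2-y^2$; for $z\in\mathbb D^n$ put $\|z\|^2=\sum_i|z_i|^2$. With $e=\frac12(1-\tau)$, $\bar e=\frac12(1+\tau)$, the null coordinates $(\xi_i,\eta_i)\in\mathbb R^{2}$ of $z_i$ are defined by $z_i=\xi_ie+\eta_i\bar e$ (so $|z_i|^2=\xi_i\eta_i$). A smooth map $F$ from an open subset of $\mathbb D^n$ to $\mathbb D^m$ is para-holomorphic if each component satisfies $\partial F/\partial\bar z_i=0$ for all $i$; equivalently, each component has the form $u(\xi)e+v(\eta)\bar e$ locally, with $u,v$ smooth and real-valued. A para-complex manifold of para-complex dimension $n$ is a smooth manifold with an atlas of charts into $\mathbb D^n$ with para-holomorphic transition maps. A para-Kähler manifold is a para-complex manifold with a symplectic form $\omega$ that is locally of the form $\omega=\frac{\tau}{2}\partial\bar\partial\phi$, $\partial\bar\partial\phi=\sum_{i,j}\frac{\partial^2\phi}{\partial z_i\partial\bar z_j}dz_i\wedge d\bar z_j$, with $\phi$ a smooth real function (a para-Kähler potential). The associated pseudo-Riemannian metric $g$ is, in null coordinates, $\sum_{i,j}\frac{\partial^2\phi}{\partial\xi_i\partial\eta_j}d\xi_i\otimes d\eta_j$ (understood as a symmetric product). It is para-Kähler-Einstein if $\mathrm{Ric}(g)=\lambda g$ for a constant $\lambda\in\mathbb R$ (the Einstein constant), and Ricci-flat if $\lambda=0$.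 A toric para-Kähler manifold of para-complex dimension $n$ is a para-Kähler manifold $(U,\frac\tau2\partial\bar\partial\phi)$, where $U\subseteq\mathbb D^n$ is a connected open neighbourhood of $0$ and the potential is of the form $\phi=\phi(|z_1|^2,\dots,|z_n|^2)=\phi(\xi_1\eta_1,\dots,\xi_n\eta_n)$, with $\phi$ a smooth function of these variables. A para-Kähler space form is a para-Kähler manifold of constant para-holomorphic sectional curvature $c$; it is called flat if $c=0$ and non-flat otherwise. Models: $(\mathcal S_0^N,\omega_0)=(\mathbb D^N,\tau\partial\bar\partial\|z\|^2)$ for $c=0$ and $(\mathcal S_c^N,\omega_c)=(\mathbb{DP}^N,\frac{4\tau}{c}\partial\bar\partial\log\|Z\|^2)$ for $c\ne0$, where $\mathbb{DP}^N$ is the quotient of $\{Z\in\mathbb D^{N+1}:\|Z\|^2>0\}$ by $Z\sim\alpha Z$, $\alpha\in\mathbb D$, $|\alpha|^2>0$. Statements about immersions are local in nature, and space forms are identified with (open subsets of) these models. A para-Kähler immersion is a para-holomorphic isometric immersion; it is analytic if it is real-analytic in the coordinates of $U$ and the standard coordinates of the model. *)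

(* Defs.v *)
From HB Require Import structures.
From mathcomp Require Import all_boot all_order all_algebra.
From mathcomp Require Import ring lra.
From mathcomp Require Import generic_quotient.
From mathcomp Require Import all_classical all_reals all_analysis.
Import Order.TTheory GRing.Theory Num.Theory numFieldNormedType.Exports.

Set Implicit Arguments.
Unset Strict Implicit.
Unset Printing Implicit Defensive.

Local Open Scope classical_set_scope.
Local Open Scope ring_scope.
Local Open Scope quotient_scope.

(* [(x, y) : pc R] stands for [x + tau y]. The alias keeps the componentwise
   R-normed module structure of [R * R], but carries the para-complex product
   instead of the componentwise one. *)
Definition pc (R : realType) : Type := (R * R)%type.

HB.instance Definition _ (R : realType) :=
  NormedModule.copy (pc R) (R * R)%type.

Definition pc_one (R : realType) : pc R := (1, 0).
Definition pc_mul (R : realType) (z w : pc R) : pc R :=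
  (z.1 * w.1 + z.2 * w.2, z.1 * w.2 + z.2 * w.1).

Fact pc_mulA (R : realType) : associative (@pc_mul R).
Proof. by move=> [a b] [c d] [e f]; congr pair => /=; ring. Qed.
Fact pc_mulC (R : realType) : commutative (@pc_mul R).
Proof. by move=> [a b] [c d]; congr pair => /=; ring. Qed.
Fact pc_mul1 (R : realType) : left_id (@pc_one R) (@pc_mul R).
Proof. by move=> [a b]; congr pair => /=; ring. Qed.
Fact pc_mulD (R : realType) : left_distributive (@pc_mul R) +%R.
Proof. by move=> [a b] [c d] [e f]; congr pair => /=; ring. Qed.
Fact pc_one_neq0 (R : realType) : pc_one R != 0.
Proof. by apply/eqP => -[] /eqP; rewrite oner_eq0. Qed.

HB.instance Definition _ (R : realType) :=
  GRing.Zmodule_isComNzRing.Build (pc R)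
    (@pc_mulA R) (@pc_mulC R) (@pc_mul1 R) (@pc_mulD R) (@pc_one_neq0 R).

Definition pc_of_real (R : realType) (x : R) : pc R := (x, 0).
Definition tau (R : realType) : pc R := (0, 1).
Definition conj_pc (R : realType) (z : pc R) : pc R := (z.1, - z.2).
Definition abs2 (R : realType) (z : pc R) : R := z.1 ^+ 2 - z.2 ^+ 2.
Definition inv_pc (R : realType) (z : pc R) : pc R :=
  (abs2 z)^-1 *: conj_pc z.

(* The idempotents [e = (1 - tau) / 2] and [ebar = (1 + tau) / 2]. *)
Definition pce (R : realType) : pc R := (2^-1, - 2^-1).
Definition pcebar (R : realType) : pc R := (2^-1, 2^-1).

Fact tau_sq (R : realType) : tau R * tau R = 1.
Proof. by congr pair => /=; ring. Qed.

Fact abs2E (R : realType) (z : pc R) : z * conj_pc z = pc_of_real (abs2 z).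
Proof. by case: z => x y; congr pair => /=; rewrite /abs2 /=; ring. Qed.

Fact abs2M (R : realType) (z w : pc R) : abs2 (z * w) = abs2 z * abs2 w.
Proof. by case: z w => [a b] [c d]; rewrite /abs2 /=; ring. Qed.

(* A point of D^n is the pair (x, y) of its vectors of real and tau-parts. *)
Notation Dn R n := ('rV[R]_n * 'rV[R]_n)%type.

Definition pcomp (R : realType) (n : nat) (z : Dn R n) (i : 'I_n) : pc R :=
  (z.1 0 i, z.2 0 i).

Definition mkDn (R : realType) (n : nat) (f : 'I_n -> pc R) : Dn R n :=
  (\row_i (f i).1, \row_i (f i).2).

Definition norm2 (R : realType) (n : nat) (z : Dn R n) : R :=
  \sum_(i < n) abs2 (pcomp z i).

Definition scaleDn (R : realType) (n : nat) (a : pc R) (z : Dn R n) : Dn R n :=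
  mkDn (fun i => a * pcomp z i).

(* The para-complex structure: multiplication by [tau]. *)
Definition Jmul (R : realType) (n : nat) (z : Dn R n) : Dn R n :=
  scaleDn (tau R) z.

Definition slot (R : realType) (n : nat) (i : 'I_n) (d : pc R) : Dn R n :=
  mkDn (fun j => if j == i then d else 0).

(* Null coordinates: [z_i = xi_i e + eta_i ebar]. *)
Definition xi (R : realType) (n : nat) (z : Dn R n) (i : 'I_n) : R :=
  z.1 0 i - z.2 0 i.
Definition eta (R : realType) (n : nat) (z : Dn R n) (i : 'I_n) : R :=
  z.1 0 i + z.2 0 i.

Fact null_coordE (R : realType) (n : nat) (z : Dn R n) (i : 'I_n) :
  pcomp z i = xi z i *: pce R + eta z i *: pcebar R.
Proof.
by rewrite /pcomp /xi /eta; congr pair;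
  rewrite /= /GRing.scale /=; field.
Qed.

Fact abs2_null (R : realType) (n : nat) (z : Dn R n) (i : 'I_n) :
  abs2 (pcomp z i) = xi z i * eta z i.
Proof. by rewrite /abs2 /pcomp /xi /eta /=; ring. Qed.

(* All null coordinates together, the xi's first, and the coordinate vector
   fields [d/dxi_i], [d/deta_i] in the same order. *)
Definition ncoord (R : realType) (n : nat) (z : Dn R n) (a : 'I_(n + n)) : R :=
  match fintype.split a with inl i => xi z i | inr i => eta z i end.
Definition nframe (R : realType) (n : nat) (a : 'I_(n + n)) : Dn R n :=
  match fintype.split a with inl i => slot i (pce R) | inr i => slot i (pcebar R) end.

Definition iter_derive (R : realType) (V W : normedModType R)
    (f : V -> W) (vs : seq V) : V -> W :=
  foldr (fun v (g : V -> W) p => 'D_v g p) f vs.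

(* [C^oo] on the open set [U]; the values of [f] outside [U] are irrelevant. *)
Definition smooth_on (R : realType) (V W : normedModType R)
    (U : set V) (f : V -> W) : Prop :=
  forall (vs : seq V) (p : V), U p -> differentiable (iter_derive f vs) p.

(* Near [p], [f] is the sum of an absolutely convergent power series in the
   null coordinates of [z - p]; the series is summed over the boxes of
   multi-indices bounded by [K], as [K] tends to infinity. *)
Definition real_analytic_at (R : realType) (n : nat)
    (f : Dn R n -> R) (p : Dn R n) : Prop :=
  exists (a : ('I_(n + n) -> nat) -> R) (r : R), 0 < r /\
  forall h : Dn R n, (forall b, `|ncoord h b| < r) ->
    let term (K : nat) (al : {ffun 'I_(n + n) -> 'I_K}) : R :=
      a (fun b => al b : nat) * \prod_b ncoord h b ^+ al b in
    (exists M : R, forall K : nat,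
      \sum_(al : {ffun 'I_(n + n) -> 'I_K}) `|term K al| <= M) /\
    (fun K : nat => \sum_(al : {ffun 'I_(n + n) -> 'I_K}) term K al) @ \oo
      --> f (p + h).

(* [d/dz_i = (d/dx_i + tau d/dy_i) / 2] and
   [d/dzbar_i = (d/dx_i - tau d/dy_i) / 2] on D-valued functions. *)
Definition dz (R : realType) (n : nat) (i : 'I_n)
    (f : Dn R n -> pc R) (p : Dn R n) : pc R :=
  2^-1 *: ('D_(slot i 1) f p + tau R * 'D_(slot i (tau R)) f p).
Definition dzbar (R : realType) (n : nat) (i : 'I_n)
    (f : Dn R n -> pc R) (p : Dn R n) : pc R :=
  2^-1 *: ('D_(slot i 1) f p - tau R * 'D_(slot i (tau R)) f p).

Definition para_holomorphic_on (R : realType) (n m : nat)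
    (U : set (Dn R n)) (F : Dn R n -> Dn R m) : Prop :=
  smooth_on U F /\
  forall (k : 'I_m) (i : 'I_n) (p : Dn R n), U p ->
    dzbar i (fun z => pcomp (F z) k) p = 0.

(* [omega = tau/2 ddbar phi]. Its values lie in the real line of [pc R], since
   the matrix [d^2 phi / dz_i dzbar_j] is hermitian. *)
Definition omega (R : realType) (n : nat) (phi : Dn R n -> R)
    (p v w : Dn R n) : pc R :=
  2^-1 *: (tau R * \sum_(i < n) \sum_(j < n)
    dz i (dzbar j (fun z => pc_of_real (phi z))) p *
    (pcomp v i * conj_pc (pcomp w j) - pcomp w i * conj_pc (pcomp v j))).

Definition symplectic_on (R : realType) (n : nat) (U : set (Dn R n))
    (om : Dn R n -> Dn R n -> Dn R n -> pc R) : Prop :=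
  (forall p u v w : Dn R n, U p ->
     'D_u (fun q => om q v w) p + 'D_v (fun q => om q w u) p
       + 'D_w (fun q => om q u v) p = 0) /\
  (forall p v : Dn R n, U p -> (forall w, om p v w = 0) -> v = 0).

Definition para_Kahler (R : realType) (n : nat)
    (U : set (Dn R n)) (phi : Dn R n -> R) : Prop :=
  [/\ open U, smooth_on U phi & symplectic_on U (omega phi)].

Definition toric_para_Kahler (R : realType) (n : nat)
    (U : set (Dn R n)) (phi : Dn R n -> R) : Prop :=
  [/\ para_Kahler U phi, connected U, U 0 &
    exists (Omega : set 'rV[R]_n) (Phi : 'rV[R]_n -> R),
      [/\ open Omega, smooth_on Omega Phi &
          forall z, U z ->
            Omega (\row_i abs2 (pcomp z i)) /\
            phi z = Phi (\row_i abs2 (pcomp z i))]].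

(* The metric [sum_ij phi_{xi_i eta_j} dxi_i . deta_j], where
   [a . b = (a (x) b + b (x) a) / 2]. *)
Definition metric (R : realType) (n : nat) (phi : Dn R n -> R)
    (p v w : Dn R n) : R :=
  \sum_(i < n) \sum_(j < n)
    'D_(slot i (pce R)) (fun q => 'D_(slot j (pcebar R)) phi q) p *
    ((xi v i * eta w j + xi w i * eta v j) / 2).

(* Components of connection and curvature are taken in the null frame. *)

Definition metric_field (R : realType) (n : nat) : Type :=
  Dn R n -> Dn R n -> Dn R n -> R.

Definition gram (R : realType) (n : nat) (g : metric_field R n)
    (p : Dn R n) : 'M[R]_(n + n) :=
  \matrix_(a, b) g p (nframe R a) (nframe R b).

(* [christoffel g c a b = Gamma^c_{ab}]. *)
Definition christoffel (R : realType) (n : nat) (g : metric_field R n)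
    (c a b : 'I_(n + n)) (p : Dn R n) : R :=
  2^-1 * \sum_d invmx (gram g p) c d *
    ('D_(nframe R a) (fun q => gram g q b d) p
     + 'D_(nframe R b) (fun q => gram g q a d) p
     - 'D_(nframe R d) (fun q => gram g q a b) p).

(* [R(d_a, d_b) d_c = sum_d riemann g d c a b * d_d], where
   [R(X, Y) = [nabla_X, nabla_Y] - nabla_[X, Y]]. *)
Definition riemann (R : realType) (n : nat) (g : metric_field R n)
    (d c a b : 'I_(n + n)) (p : Dn R n) : R :=
  'D_(nframe R a) (christoffel g d b c) p
  - 'D_(nframe R b) (christoffel g d a c) p
  + \sum_e (christoffel g d a e p * christoffel g e b c p
            - christoffel g d b e p * christoffel g e a c p).

Definition ricci (R : realType) (n : nat) (g : metric_field R n)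
    (b c : 'I_(n + n)) (p : Dn R n) : R :=
  \sum_a riemann g a c a b p.

Definition Einstein (R : realType) (n : nat)
    (U : set (Dn R n)) (phi : Dn R n -> R) (lambda : R) : Prop :=
  forall p, U p -> forall a b : 'I_(n + n),
    ricci (metric phi) a b p = lambda * gram (metric phi) p a b.

Definition Ricci_flat (R : realType) (n : nat)
    (U : set (Dn R n)) (phi : Dn R n -> R) : Prop := Einstein U phi 0.

(* [g(R(u, v) w, x)] *)
Definition curvature4 (R : realType) (n : nat) (g : metric_field R n)
    (p u v w x : Dn R n) : R :=
  \sum_a \sum_b \sum_c \sum_d \sum_f
    ncoord u a * ncoord v b * ncoord w c * ncoord x f *
    riemann g d c a b p * gram g p d f.

Definition sectional (R : realType) (n : nat) (g : metric_field R n)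
    (p u v : Dn R n) : R :=
  curvature4 g p u v v u / (g p u u * g p v v - g p u v ^+ 2).

(* The planes [span (v, J v)] on which the metric is nondegenerate are those
   with [g(v, v) != 0], because [g(Jv, Jv) = - g(v, v)] and [g(v, Jv) = 0]. *)
Definition constant_para_holomorphic_curvature (R : realType) (n : nat)
    (U : set (Dn R n)) (phi : Dn R n -> R) (c : R) : Prop :=
  forall p v : Dn R n, U p -> metric phi p v v != 0 ->
    sectional (metric phi) p v (Jmul v) = c.

Definition flat (R : realType) (n : nat)
    (U : set (Dn R n)) (phi : Dn R n -> R) : Prop :=
  constant_para_holomorphic_curvature U phi 0.

(* An atlas into D^N, together with a para-Kähler potential in each chart. *)
Record pk_model (R : realType) (N : nat) := PKModel {
  carrier :> Type;
  chart_index : Type;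
  chart_dom : chart_index -> set carrier;
  chart : chart_index -> carrier -> Dn R N;
  potential : chart_index -> Dn R N -> R }.

(* [tau ddbar |z|^2 = tau/2 ddbar (2 |z|^2)] *)
Definition flat_potential (R : realType) (N : nat) (z : Dn R N) : R :=
  2 * norm2 z.

Definition flat_model (R : realType) (N : nat) : pk_model R N :=
  @PKModel R N (Dn R N) unit (fun _ => setT) (fun _ z => z)
    (fun _ => @flat_potential R N).

Definition hpoint (R : realType) (N : nat) : Type :=
  {Z : Dn R N.+1 | 0 < norm2 Z}.
HB.instance Definition _ (R : realType) (N : nat) := Choice.on (hpoint R N).

Definition hequiv (R : realType) (N : nat) : rel (hpoint R N) :=
  fun Z W => `[< exists alpha : pc R,
    0 < abs2 alpha /\ sval Z = scaleDn alpha (sval W) >].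

Lemma pcomp_mkDn (R : realType) (n : nat) (f : 'I_n -> pc R) (i : 'I_n) :
  pcomp (mkDn f) i = f i.
Proof. by rewrite /pcomp /= !mxE; case: (f i). Qed.

Lemma eq_Dn (R : realType) (n : nat) (z w : Dn R n) : pcomp z =1 pcomp w -> z = w.
Proof.
case: z w => [x y] [x' y'] zw; congr pair; apply/rowP => i;
  by case: (zw i).
Qed.

Lemma pc_mulVx (R : realType) (a : pc R) : 0 < abs2 a -> inv_pc a * a = 1.
Proof.
move=> a0; rewrite /inv_pc; case: a a0 => x y; rewrite /abs2 /= => a0.
by congr pair; rewrite /= /GRing.scale /=; field; rewrite gt_eqF.
Qed.

Lemma abs2V_gt0 (R : realType) (a : pc R) : 0 < abs2 a -> 0 < abs2 (inv_pc a).
Proof.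
move=> a0; have : 0 < abs2 (inv_pc a) * abs2 a.
  by rewrite -abs2M pc_mulVx // /abs2 /= expr1n expr0n subr0.
by rewrite pmulr_lgt0.
Qed.

Fact hequiv_refl (R : realType) (N : nat) : reflexive (@hequiv R N).
Proof.
move=> Z; apply/asboolP; exists 1; split.
  by rewrite /abs2 /= expr1n expr0n subr0.
by apply: eq_Dn => i; rewrite pcomp_mkDn mul1r.
Qed.

Fact hequiv_sym (R : realType) (N : nat) : symmetric (@hequiv R N).
Proof.
suff hs (Z W : hpoint R N) : hequiv Z W -> hequiv W Z.
  by move=> Z W; apply/idP/idP; apply: hs.
move=> /asboolP[a [a0 ZW]]; apply/asboolP; exists (inv_pc a).
split; first exact: abs2V_gt0.
by apply: eq_Dn => i; rewrite ZW !pcomp_mkDn mulrA pc_mulVx// mul1r.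
Qed.

Fact hequiv_trans (R : realType) (N : nat) : transitive (@hequiv R N).
Proof.
move=> W Z T /asboolP[a [a0 ZW]] /asboolP[b [b0 WT]].
apply/asboolP; exists (a * b); split; first by rewrite abs2M mulr_gt0.
by apply: eq_Dn => i; rewrite ZW WT !pcomp_mkDn mulrA.
Qed.

Canonical hequiv_equiv (R : realType) (N : nat) :=
  EquivRel (@hequiv R N) (@hequiv_refl R N) (@hequiv_sym R N)
    (@hequiv_trans R N).

(* The para-complex projective space: [Z ~ alpha Z] with [|alpha|^2 > 0]. *)
Definition DP (R : realType) (N : nat) : Type := {eq_quot (@hequiv R N)}.

Definition hrep (R : realType) (N : nat) (P : DP R N) : Dn R N.+1 :=
  sval (repr (P : {eq_quot (@hequiv R N)})).

(* The affine charts: on [|Z_i|^2 > 0] the coordinates are the [Z_j / Z_i]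
   for [j != i]. These domains cover DP^N, because [|Z|^2 > 0]. *)
Definition affine_dom (R : realType) (N : nat) (i : 'I_N.+1) : set (DP R N) :=
  [set P | 0 < abs2 (pcomp (hrep P) i)].
Definition affine_chart (R : realType) (N : nat) (i : 'I_N.+1)
    (P : DP R N) : Dn R N :=
  mkDn (fun j => pcomp (hrep P) (lift i j) * inv_pc (pcomp (hrep P) i)).

(* The section of D^{N+1} -> DP^N with [Z_i = 1] over the i-th chart. *)
Definition affine_section (R : realType) (N : nat) (i : 'I_N.+1)
    (z : Dn R N) : Dn R N.+1 :=
  mkDn (fun k => if unlift i k is Some j then pcomp z j else 1).

(* [4 tau/c ddbar log |Z|^2 = tau/2 ddbar (8/c log |Z|^2)] *)
Definition projective_model (R : realType) (c : R) (N : nat) : pk_model R N :=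
  @PKModel R N (DP R N) 'I_N.+1 (@affine_dom R N) (@affine_chart R N)
    (fun i z => 8 / c * ln (norm2 (affine_section i z))).

Definition space_form (R : realType) (c : R) (N : nat) : pk_model R N :=
  if c == 0 then flat_model R N else projective_model c N.

(* A map into a quotient such as DP^N is tested in every chart of the target;
   the last clause is the pullback identity for the metrics. *)
Definition para_Kahler_immersion (R : realType) (n N : nat)
    (U : set (Dn R n)) (phi : Dn R n -> R) (S : pk_model R N)
    (F : Dn R n -> S) : Prop :=
  forall i : chart_index S,
    let W := U `&` F @^-1` chart_dom i in
    let f := fun z => chart i (F z) in
    [/\ open W,
        para_holomorphic_on W f,
        (forall p v, W p -> 'D_v f p = 0 -> v = 0) &
        (forall p v w, W p ->
           metric (potential i) (f p) ('D_v f p) ('D_w f p)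
             = metric phi p v w)].

Definition analytic_map (R : realType) (n N : nat)
    (U : set (Dn R n)) (S : pk_model R N) (F : Dn R n -> S) : Prop :=
  forall (i : chart_index S) (b : 'I_(N + N)) (p : Dn R n),
    U p -> chart_dom i (F p) ->
    real_analytic_at (fun z => ncoord (chart i (F z)) b) p.

Definition immersible (R : realType) (n N : nat)
    (U : set (Dn R n)) (phi : Dn R n -> R) (S : pk_model R N) : Prop :=
  exists F : Dn R n -> S, para_Kahler_immersion U phi F.

Definition analytically_immersible (R : realType) (n N : nat)
    (U : set (Dn R n)) (phi : Dn R n -> R) (S : pk_model R N) : Prop :=
  exists F : Dn R n -> S, para_Kahler_immersion U phi F /\ analytic_map U F.

(* Main.v *)
(* In null coordinates the metric is the matrix [h_ij = d^2 phi / dxi_i deta_j].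
   If the metric is flat, the Christoffel symbols [h^-1 d_xi h] depend on [xi]
   only; being homogeneous under the torus action they vanish, so [h] is a
   constant diagonal matrix. Conversely such an [h] is flat and rescaling the
   coordinates [eta_i] immerses it into the flat space form.

   An immersion is given by functions [zeta_k] of [xi] and [theta_k] of [eta].
   Hence the kernel [P(xi_1 eta_1, ..., xi_n eta_n)], where [P = Phi] for a flat
   target and [P = exp (c/8 (Phi - Phi 0))] for a target of curvature [c <> 0],
   has finite rank. The scalings [xi_i -> xi_i / 2] and smoothness at [0] then
   force [P] to be a polynomial near [0].

   The Einstein equation integrates near [0] to
   [det h = det h(0) exp (- lambda/2 (phi - phi 0))]. Restricted to the monomial
   curve [xi_k = eta_k = x ^ kap_k], with weights separating the exponents of [P],
   it becomes an identity between polynomials and exponentials of polynomials in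
   [x]. Comparing degrees excludes [lambda = 0] for [c <> 0] and [lambda <> 0] for
   [c = 0]; for [c = 0] and [lambda = 0] the term of highest weight in [det h]
   shows that [Phi] is affine near [0], so [h] is constant there. If the immersion
   is analytic, [h] is constant on all of [U]. *)

(* The obstacle is that neither positivity nor complexification is at hand. The matrix [h] need be
   neither symmetric nor definite, so a Calabi-type criterion on definite kernels gives nothing, and
   a smooth potential has no power series. What replaces both is that [xi] and [eta] are independent
   real variables: a function without mixed derivatives splits, and taking [xi] from one point and
   [eta] from another polarizes every identity. The surviving invariant is the rank of the kernel,
   which bounds the span of the dilates of [P]. A dilation recurrence alone would still allow
   fractional powers and log-periodic functions; these are excluded because [P] has derivatives of
   all orders at 0. The analysis near 0 is one of smooth maps, so the exclusion of projective
   targets in (ii), where immersions are arbitrary, is the same lemma as in (i): a flat toric metric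
   has constant [h] and is therefore Ricci-flat. Analyticity is what carries the constancy of [h]
   from a neighbourhood of 0 to [U]. *)
From HB Require Import structures.
Require Import Defs.
From mathcomp Require Import all_boot all_order all_algebra.
From mathcomp Require Import perm ring lra zify.
From mathcomp Require Import all_classical all_reals all_analysis.
Import Order.TTheory GRing.Theory Num.Theory numFieldNormedType.Exports.
Local Open Scope classical_set_scope.
Local Open Scope ring_scope.
Set Implicit Arguments.
Unset Strict Implicit.
Unset Printing Implicit Defensive.

(** * Directional derivatives *)

(* The directional derivative, sealed: unfolding it makes failing unification
   attempts very slow. *)
HB.lock Definition dd (R : realType) (V W : normedModType R) (f : V -> W)
  (v p : V) : W := derive f p v.
Notation "''DD_' v f" := (dd f v)
  (at level 10, v, f at next level, format "''DD_' v  f").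

Lemma ddE (R : realType) (V W : normedModType R) (v : V) (f : V -> W) p :
  'D_v f p = 'DD_v f p.
Proof. by rewrite dd.unlock. Qed.

Lemma dvl_lin (R : realType) (V W : normedModType R) (F : V -> W) v w (a : R) p :
  differentiable F p -> 'DD_(a *: v + w) F p = a *: 'DD_v F p + 'DD_w F p.
Proof. by move=> dF; rewrite -!ddE !deriveE// linearP. Qed.

Lemma dvl0 (R : realType) (V W : normedModType R) (F : V -> W) p :
  'DD_0 F p = 0.
Proof. by rewrite -ddE derive0. Qed.

Section ScalarRules.
Variables (R : realType) (V : normedModType R).
Implicit Types (f g : V -> R) (p v : V).

Lemma dfl_cst (c : R) p : differentiable (fun _ : V => c) p.
Proof. exact: differentiable_cst. Qed.
Lemma dflD f g p : differentiable f p -> differentiable g p ->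
  differentiable (fun z => f z + g z) p.
Proof. exact: differentiableD. Qed.
Lemma dflB f g p : differentiable f p -> differentiable g p ->
  differentiable (fun z => f z - g z) p.
Proof. exact: differentiableB. Qed.
Lemma dflM f g p : differentiable f p -> differentiable g p ->
  differentiable (fun z => f z * g z) p.
Proof. exact: differentiableM. Qed.
Lemma dflV f p : differentiable f p -> f p != 0 ->
  differentiable (fun z => (f z)^-1) p.
Proof. exact: differentiableV. Qed.
Lemma dfl_comp f (u : R -> R) du p : differentiable f p ->
  is_derive (f p) 1 u du -> differentiable (fun z => u (f z)) p.
Proof.
move=> df [du1 _]; apply: (@differentiable_comp _ _ _ _ f u) => //.
exact/derivable1_diffP.
Qed.
Lemma dfl_sum (I : Type) (r : seq I) (P : pred I) (F : I -> V -> R) p :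
  (forall i, P i -> differentiable (F i) p) ->
  differentiable (fun z => \sum_(i <- r | P i) F i z) p.
Proof.
move=> dF; elim: r => [|i r IH].
  by under eq_fun do rewrite big_nil; exact: dfl_cst.
case Pi: (P i); under eq_fun do rewrite big_cons Pi.
  by apply: dflD IH; apply: dF.
exact: IH.
Qed.

Lemma dvl_cst (c : R) v p : 'DD_v (fun _ : V => c) p = 0.
Proof. by rewrite -ddE derive_cst. Qed.
Lemma dvlD f g v p : differentiable f p -> differentiable g p ->
  'DD_v (fun z => f z + g z) p = 'DD_v f p + 'DD_v g p.
Proof. by move=> df dg; rewrite -!ddE; apply: deriveD; exact: diff_derivable. Qed.
Lemma dvlB f g v p : differentiable f p -> differentiable g p ->
  'DD_v (fun z => f z - g z) p = 'DD_v f p - 'DD_v g p.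
Proof. by move=> df dg; rewrite -!ddE; apply: deriveB; exact: diff_derivable. Qed.
Lemma dvlM f g v p : differentiable f p -> differentiable g p ->
  'DD_v (fun z => f z * g z) p = 'DD_v f p * g p + f p * 'DD_v g p.
Proof.
move=> df dg; rewrite -!ddE [LHS](deriveM (diff_derivable df) (diff_derivable dg)).
by rewrite addrC /GRing.scale/= [X in X + _]mulrC.
Qed.
Lemma dvlZ (c : R) f v p : differentiable f p ->
  'DD_v (fun z => c * f z) p = c * 'DD_v f p.
Proof. by move=> df; rewrite dvlM ?dvl_cst ?mul0r ?add0r//; exact: dfl_cst. Qed.
Lemma dvlV f v p : differentiable f p -> f p != 0 ->
  'DD_v (fun z => (f z)^-1) p = - ((f p)^-1 * (f p)^-1) * 'DD_v f p.
Proof.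
move=> df f0; rewrite -!ddE (deriveV f0 (diff_derivable df)).
by rewrite /GRing.scale /= expr2 invfM.
Qed.
Lemma dvl_comp f (u : R -> R) du v p : differentiable f p ->
  is_derive (f p) 1 u du -> 'DD_v (fun z => u (f z)) p = du * 'DD_v f p.
Proof.
move=> df [du1 duE]; have du2 := (derivable1_diffP _ _).1 du1.
rewrite -!ddE deriveE; last exact: (@differentiable_comp _ _ _ _ f u).
rewrite (@diff_comp _ _ _ _ f u) //= deriveE//; set a := 'd f p v.
rewrite -(deriveE a du2) -[X in derive u _ X]addr0.
have -> : a = a *: (1 : R) by rewrite /GRing.scale/= mulr1.
by rewrite ddE dvl_lin// -!ddE derive0 addr0 duE /GRing.scale/= mulr1 mulrC.
Qed.
Lemma dvl_sum (I : Type) (r : seq I) (P : pred I) (F : I -> V -> R) v p :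
  (forall i, P i -> differentiable (F i) p) ->
  'DD_v (fun z => \sum_(i <- r | P i) F i z) p = \sum_(i <- r | P i) 'DD_v (F i) p.
Proof.
move=> dF; elim: r => [|i r IH].
  by under eq_fun do rewrite big_nil; rewrite big_nil dvl_cst.
rewrite big_cons; case Pi: (P i); under eq_fun do rewrite big_cons Pi; last exact: IH.
by rewrite dvlD ?IH//; [exact: dF|exact: dfl_sum].
Qed.

Lemma dvl_sumv (W : normedModType R) (F : V -> W) (I : finType) (c : I -> R)
    (e : I -> V) p : differentiable F p ->
  'DD_(\sum_i c i *: e i) F p = \sum_i c i *: 'DD_(e i) F p.
Proof.
move=> dF; rewrite -ddE deriveE// linear_sum; apply: eq_bigr => i _.
by rewrite -ddE linearZ deriveE.
Qed.
End ScalarRules.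

Lemma eq_derive_open (R : realType) (V W : normedModType R) (U : set V)
    (f g : V -> W) v p : open U -> U p -> (forall z, U z -> f z = g z) ->
  'DD_v f p = 'DD_v g p.
Proof.
move=> oU Up fg; rewrite -!ddE; apply: near_eq_derive.
by near=> z; apply: fg; near: z; exact: open_nbhs_nbhs.
Unshelve. all: by end_near. Qed.

Lemma dfl_near0 (R : realType) (V W : normedModType R) (f : V -> W) p :
  (\near p, f p = 0) -> differentiable f p.
Proof.
move=> f0; have fp0 : f p = 0 by exact: nbhs_singleton f0.
have E : f \o shift p = cst (f p) + cst 0 +o_ 0 id.
  apply/eqaddoP => e e0; near=> h; rewrite /= !fctE fp0 addr0 subr0.
  have -> : f (h + p) = 0.
    by near: h; move: f0; rewrite (near_shift 0) /= subr0.
  by rewrite normr0 mulr_ge0// ltW.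
have c0 : continuous (\0 : V -> W) by move=> z; exact: cvg_cst.
have dE : 'd f p = \0 :> (V -> W) by exact: (@diff_unique _ _ _ f \0).
by apply/diff_locallyP; rewrite dE; split.
Unshelve. all: by end_near. Qed.

Lemma eq_dfl_open (R : realType) (V W : normedModType R) (U : set V)
    (f g : V -> W) p : open U -> U p -> (forall z, U z -> f z = g z) ->
  differentiable f p -> differentiable g p.
Proof.
move=> oU Up fg df.
have -> : g = f + (fun z => g z - f z).
  by apply/funext => z; rewrite fctE addrC subrK.
apply: differentiableD => //; apply: dfl_near0.
by near=> z; rewrite fg ?subrr//; near: z; exact: open_nbhs_nbhs.
Unshelve. all: by end_near. Qed.

Lemma dvl_chain (R : realType) (V' V W : normedModType R) (g : V' -> V)
    (f : V -> W) v p : differentiable g p -> differentiable f (g p) ->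
  'DD_v (fun z => f (g z)) p = 'DD_('DD_v g p) f (g p).
Proof.
move=> dg df; rewrite -!ddE !deriveE//; last exact: (@differentiable_comp _ _ _ _ g f).
by rewrite (@diff_comp _ _ _ _ g f).
Qed.

Lemma dfl_shift (R : realType) (V W : normedModType R) (f : V -> W) q u :
  differentiable f (q + u) -> differentiable (fun z => f (z + u)) q.
Proof.
by move=> df; apply: (@differentiable_comp _ _ _ _ (fun z => z + u) f).
Qed.

Lemma dvl_shift (R : realType) (V W : normedModType R) (f : V -> W) q u v :
  differentiable f (q + u) -> 'DD_v (fun z => f (z + u)) q = 'DD_v f (q + u).
Proof.
move=> df; rewrite (@dvl_chain _ _ _ _ (fun z => z + u) f)//.
have := @deriveD _ _ _ id (cst u) q v (@derivable_id _ _ _ _)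
  (@derivable_cst _ _ _ _ _ _).
by rewrite derive_cst addr0 derive_id ddE => ->.
Qed.

Lemma dvl_linear (R : realType) (V W : normedModType R) (L : V -> W) v p :
  linear L -> 'DD_v L p = L v.
Proof.
move=> lL; have L0 : L 0 = 0 by have := lL (-1) 0 0; rewrite scaler0 addr0 scaleN1r addNr.
have [->|v0] := eqVneq v 0; first by rewrite -ddE derive0 L0.
rewrite -ddE /derive; apply: cvg_lim => //; apply: cvg_near_cst.
near=> h; rewrite /= lL addrK scalerK//.
by near: h; exact: nbhs_dnbhs_neq.
Unshelve. all: by end_near. Qed.

Lemma line_derive (R : realType) (V : normedModType R) (f : V -> R) p v (s : R) :
  differentiable f (p + s *: v) ->
  is_derive s 1 (fun s : R => f (p + s *: v)) ('DD_v f (p + s *: v)).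
Proof.
move=> df; set g := fun s : R => p + s *: v.
have dg : differentiable g s.
  apply: differentiableD; first exact: differentiable_cst.
  by apply: differentiableZl.
have Dg : 'DD_1 g s = v.
  rewrite -ddE.
  rewrite /g (@deriveD _ _ _ (cst p) (fun s : R => s *: v)).
  - by rewrite derive_cst add0r deriveE// diff_val scale1r.
  - exact: derivable_cst.
  - by apply: diff_derivable; apply: differentiableZl.
apply: DeriveDef; rewrite ?ddE.
  by apply: diff_derivable; apply: (@differentiable_comp _ _ _ _ g f).
by rewrite (@dvl_chain _ _ _ _ g f) // Dg.
Qed.

Lemma mvt_line (R : realType) (V : normedModType R) (f : V -> R) p v :
  (forall s : R, 0 <= s <= 1 -> differentiable f (p + s *: v)) ->
  exists2 c : R, 0 < c < 1 & f (p + v) - f p = 'DD_v f (p + c *: v).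
Proof.
move=> df.
have [| |c c01] := @MVT _ (fun s => f (p + s *: v))
    (fun s => 'DD_v f (p + s *: v)) 0 1 ltr01.
- move=> x; rewrite in_itv /= => /andP[x0 x1]; apply: line_derive.
  by apply: df; rewrite !ltW.
- apply: derivable_within_continuous => x; rewrite in_itv /= => x01.
  by have [] := line_derive (df x x01).
rewrite scale1r scale0r addr0 subr0 mulr1 => ->.
by exists c => //; move: c01; rewrite in_itv.
Qed.

Lemma line_cst (R : realType) (V : normedModType R) (f : V -> R) p v :
  (forall s : R, 0 <= s <= 1 -> differentiable f (p + s *: v)) ->
  (forall s : R, 0 <= s <= 1 -> 'DD_v f (p + s *: v) = 0) -> f (p + v) = f p.
Proof.
move=> df f0; have [c /andP[c0 c1] E] := mvt_line df.
by apply/eqP; rewrite -subr_eq0 E f0// !ltW.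
Qed.

(** * Smooth functions on an open set *)

Section Smooth.
Variables (R : realType) (V : normedModType R) (U : set V).
Hypothesis oU : open U.

Lemma iter_derive_cons (W : normedModType R) (f : V -> W) v vs :
  iter_derive f (v :: vs) = 'DD_v (iter_derive f vs).
Proof. by apply/funext => p /=; rewrite ddE. Qed.

Lemma iter_derive_rcons (W : normedModType R) (f : V -> W) v vs :
  iter_derive f (rcons vs v) = iter_derive ('DD_v f) vs.
Proof.
elim: vs => [|w vs IH]; first exact: iter_derive_cons.
by rewrite rcons_cons !iter_derive_cons IH.
Qed.

(** Coinduction: every iterated derivative stays in the class [S], up to equality on [U]. This slack
    matters because [iter_derive] handles total functions, while the rules of calculus give a
    formula for a derivative only at the points of [U]. *)
Lemma smooth_coind (W : normedModType R) (S : (V -> W) -> Prop) f :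
  (forall f p, S f -> U p -> differentiable f p) ->
  (forall f v, S f -> exists2 g, S g & forall p, U p -> 'DD_v f p = g p) ->
  S f -> smooth_on U f.
Proof.
move=> Sd SD Sf vs p Up.
suff [g Sg gE] : exists2 g, S g & forall p, U p -> g p = iter_derive f vs p.
  by apply: (eq_dfl_open oU Up gE); exact: Sd.
elim: vs => [|v vs [g Sg gE]]; first by exists f.
have [g' Sg' g'E] := SD _ v Sg; exists g' => // q Uq.
by rewrite -g'E// iter_derive_cons; apply: (eq_derive_open _ oU Uq).
Qed.

Lemma smooth_dfl (W : normedModType R) (f : V -> W) p :
  smooth_on U f -> U p -> differentiable f p.
Proof. by move=> sf Up; exact: (sf [::]). Qed.

Lemma smooth_drv (W : normedModType R) (f : V -> W) v :
  smooth_on U f -> smooth_on U ('DD_v f).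
Proof.
move=> sf vs p Up; have := sf (rcons vs v) p Up.
by rewrite iter_derive_rcons.
Qed.

Lemma smooth_eq (W : normedModType R) (f g : V -> W) :
  (forall z, U z -> f z = g z) -> smooth_on U f -> smooth_on U g.
Proof.
move=> fg sf.
apply: (@smooth_coind _ (fun g => exists2 f, smooth_on U f &
  forall z, U z -> f z = g z)); last by exists f.
- move=> {}g p [{fg sf}f sf fg] Up; apply: (eq_dfl_open oU Up fg).
  exact: smooth_dfl.
- move=> {}g v [{fg sf}f sf fg]; exists ('DD_v f).
    by exists ('DD_v f) => //; exact: smooth_drv.
  by move=> p Up; rewrite (eq_derive_open _ oU Up fg).
Qed.

Lemma smooth_cst (W : normedModType R) (c : W) : smooth_on U (fun _ : V => c).
Proof.
apply: (@smooth_coind _ (fun f => exists c, f = fun _ => c)); last by exists c.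
- by move=> f p [k ->] _; exact: differentiable_cst.
- move=> f v [k ->]; exists (fun _ => 0); first by exists 0.
  by move=> p _; rewrite -ddE derive_cst.
Qed.

Lemma smooth_linear (W : normedModType R) (L : V -> W) :
  linear L -> (forall p, differentiable L p) -> smooth_on U L.
Proof.
move=> lL dL.
apply: (@smooth_coind _ (fun f => f = L \/ exists c, f = fun _ => c)); last by left.
- by move=> f p [-> _|[k ->] _]; [exact: dL|exact: differentiable_cst].
- move=> f v [->|[k ->]].
    by exists (fun _ => L v); [right; exists (L v)|move=> p _; exact: dvl_linear].
  exists (fun _ => 0); first by right; exists 0.
  by move=> p _; rewrite -ddE derive_cst.
Qed.

Lemma smooth_lincomp (W W' : normedModType R) (L : W -> W') (f : V -> W) :
  linear L -> (forall p, differentiable L p) -> smooth_on U f ->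
  smooth_on U (fun z => L (f z)).
Proof.
move=> lL dL sf.
apply: (@smooth_coind _ (fun g => exists2 f, smooth_on U f &
  g = fun z => L (f z))); last by exists f.
- move=> g p [{sf}f sf ->] Up; apply: (@differentiable_comp _ _ _ _ f L) => //.
  exact: smooth_dfl.
- move=> g v [{sf}f sf ->]; exists (fun z => L ('DD_v f z)).
    by exists ('DD_v f) => //; exact: smooth_drv.
  move=> p Up; rewrite (@dvl_chain _ _ _ _ f L)//; last exact: smooth_dfl.
  exact: dvl_linear.
Qed.

(* The closure of the smooth functions under the operations below; it is
   stable under differentiation by the rules of calculus. *)
Inductive smooth_closure : (V -> R) -> Prop :=
| sc_base f : smooth_on U f -> smooth_closure f
| sc_add f g : smooth_closure f -> smooth_closure g ->
    smooth_closure (fun z => f z + g z)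
| sc_mul f g : smooth_closure f -> smooth_closure g ->
    smooth_closure (fun z => f z * g z)
| sc_inv f : smooth_closure f -> (forall z, U z -> f z != 0) ->
    smooth_closure (fun z => (f z)^-1)
| sc_exp f : smooth_closure f -> smooth_closure (fun z => expR (f z)).

Lemma sc_dfl f p : smooth_closure f -> U p -> differentiable f p.
Proof.
move=> + Up; elim=> {f}[f sf|f g _ df _ dg|f g _ df _ dg|f _ df f0|f _ df].
- exact: smooth_dfl.
- exact: dflD.
- exact: dflM.
- by apply: dflV => //; exact: f0.
- exact: (dfl_comp df (is_derive_expR _)).
Qed.

Lemma sc_drv f v : smooth_closure f ->
  exists2 g, smooth_closure g & forall p, U p -> 'DD_v f p = g p.
Proof.
elim=> {f}[f sf|f g sf [f' sf' fE] sg [g' sg' gE]|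
  f g sf [f' sf' fE] sg [g' sg' gE]|f sf [f' sf' fE] f0|f sf [f' sf' fE]].
- by exists ('DD_v f) => //; apply: sc_base; exact: smooth_drv.
- exists (fun z => f' z + g' z); first exact: sc_add.
  by move=> p Up; rewrite dvlD ?fE ?gE//; exact: sc_dfl.
- exists (fun z => f' z * g z + f z * g' z).
    by apply: sc_add; exact: sc_mul.
  by move=> p Up; rewrite dvlM ?fE ?gE//; exact: sc_dfl.
- exists (fun z => (-1) * ((f z)^-1 * (f z)^-1) * f' z).
    apply: sc_mul => //; apply: sc_mul; first exact/sc_base/smooth_cst.
    by apply: sc_mul; exact: sc_inv.
  by move=> p Up; rewrite dvlV ?fE ?mulN1r//; [exact: sc_dfl|exact: f0].
- exists (fun z => expR (f z) * f' z).
    by apply: sc_mul => //; exact: sc_exp.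
  move=> p Up; rewrite (dvl_comp _ (sc_dfl sf Up) (is_derive_expR _)) fE//.
Qed.

Lemma sc_smooth f : smooth_closure f -> smooth_on U f.
Proof.
by apply: smooth_coind => [g p sg Up|g v]; [exact: sc_dfl|exact: sc_drv].
Qed.

Lemma smoothD (f g : V -> R) : smooth_on U f -> smooth_on U g ->
  smooth_on U (fun z => f z + g z).
Proof. by move=> sf sg; apply: sc_smooth; apply: sc_add; exact: sc_base. Qed.
Lemma smoothM (f g : V -> R) : smooth_on U f -> smooth_on U g ->
  smooth_on U (fun z => f z * g z).
Proof. by move=> sf sg; apply: sc_smooth; apply: sc_mul; exact: sc_base. Qed.
Lemma smoothN (f : V -> R) : smooth_on U f -> smooth_on U (fun z => - f z).
Proof.
move=> sf; apply: (@smooth_eq _ (fun z => (-1) * f z)).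
  by move=> z _; rewrite mulN1r.
by apply: smoothM => //; exact: smooth_cst.
Qed.
Lemma smoothB (f g : V -> R) : smooth_on U f -> smooth_on U g ->
  smooth_on U (fun z => f z - g z).
Proof. by move=> sf sg; apply: smoothD => //; exact: smoothN. Qed.
Lemma smoothV (f : V -> R) : smooth_on U f -> (forall z, U z -> f z != 0) ->
  smooth_on U (fun z => (f z)^-1).
Proof. by move=> sf f0; apply: sc_smooth; apply: sc_inv => //; exact: sc_base. Qed.
Lemma smooth_exp (f : V -> R) : smooth_on U f -> smooth_on U (fun z => expR (f z)).
Proof. by move=> sf; apply: sc_smooth; apply: sc_exp; exact: sc_base. Qed.
Lemma smooth_sum (I : Type) (r : seq I) (P : pred I) (F : I -> V -> R) :
  (forall i, P i -> smooth_on U (F i)) ->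
  smooth_on U (fun z => \sum_(i <- r | P i) F i z).
Proof.
move=> sF; elim: r => [|i r IH].
  by under eq_fun do rewrite big_nil; exact: smooth_cst.
case Pi: (P i); under eq_fun do rewrite big_cons Pi; last exact: IH.
by apply: smoothD IH; exact: sF.
Qed.
Lemma smooth_prod (I : Type) (r : seq I) (P : pred I) (F : I -> V -> R) :
  (forall i, P i -> smooth_on U (F i)) ->
  smooth_on U (fun z => \prod_(i <- r | P i) F i z).
Proof.
move=> sF; elim: r => [|i r IH].
  by under eq_fun do rewrite big_nil; exact: smooth_cst.
case Pi: (P i); under eq_fun do rewrite big_cons Pi; last exact: IH.
by apply: smoothM IH; exact: sF.
Qed.
End Smooth.

Lemma smooth_sub (R : realType) (V W : normedModType R) (U U' : set V) (f : V -> W) :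
  U' `<=` U -> smooth_on U f -> smooth_on U' f.
Proof. by move=> sU sf vs p Up; apply: sf; exact: sU. Qed.

(** The second difference of [f] over a small parallelogram is symmetric in the two directions, and
    divided by [s ^+ 2] it tends to either of the mixed derivatives; [key] is this limit for one
    order. *)
Lemma schwarz (R : realType) (V : normedModType R) (U : set V) (f : V -> R) v w p :
  open U -> smooth_on U f -> U p ->
  'DD_v ('DD_w f) p = 'DD_w ('DD_v f) p.
Proof.
move=> oU sf Up.
suff key (a b : V) : forall e : R, 0 < e -> \forall s \near (0 : R)^'+,
    `|(f (p + s *: a + s *: b) - f (p + s *: a) - f (p + s *: b) + f p) / s ^+ 2
       - 'DD_b ('DD_a f) p| <= e.
  apply/eqP; rewrite -subr_eq0 -normr_le0; apply/ler_addgt0Pr => e e0.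
  rewrite add0r (splitr e).
  have e2 : 0 < e / 2 by rewrite divr_gt0.
  have [s [A B]] := filter_ex (filterI (key v w _ e2) (key w v _ e2)).
  move: A B; rewrite [p + s *: w + _]addrAC [_ - f (p + s *: w) - _]addrAC.
  set X := (_ / _); move: X ('DD_w ('DD_v f) p) ('DD_v ('DD_w f) p) => X a b A B.
  by rewrite -(subrKA X) (le_trans (ler_normD _ _))// addrC lerD// distrC.
move=> e e0.
have cab : {for p, continuous ('DD_b ('DD_a f))}.
  apply: differentiable_continuous; apply: (smooth_dfl _ Up).
  by apply: smooth_drv; exact: smooth_drv.
have [d d0 dP] : exists2 d : R, 0 < d & forall z, `|z - p| < d ->
    U z /\ `|'DD_b ('DD_a f) z - 'DD_b ('DD_a f) p| <= e.
  have : \forall z \near p, U z /\ `|'DD_b ('DD_a f) z - 'DD_b ('DD_a f) p| <= e.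
    near=> z; split; first by near: z; exact: open_nbhs_nbhs.
    by rewrite distrC; near: z; exact: (cvgrPdist_le _ _).1 cab _ e0.
  move=> /nbhs_ballP[d /= d0 dP]; exists d => // z zp.
  by apply: dP; rewrite -ball_normE /= distrC.
near=> s.
have s0 : 0 < s by near: s; exact: nbhs_right_gt.
have sd : s * (`|a| + `|b|) < d.
  have S0 : 0 <= `|a| + `|b| by rewrite addr_ge0.
  have S1 : 0 < 1 + (`|a| + `|b|) by rewrite ltr_pwDl.
  have : s < d / (1 + (`|a| + `|b|)).
    by near: s; apply: nbhs_right_lt; rewrite divr_gt0.
  rewrite ltr_pdivlMr// => sd'; apply: le_lt_trans sd'.
  by rewrite ler_wpM2l ?lerDr ?ltW.
have in_d x y : 0 <= x <= s -> 0 <= y <= s -> `|p + x *: a + y *: b - p| < d.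
  move=> /andP[x0 xs] /andP[y0 ys]; rewrite -[p + _ + _]addrA [p + _]addrC addrK.
  apply: le_lt_trans sd; rewrite (le_trans (ler_normD _ _))// !normrZ mulrDr.
  by rewrite !ger0_norm// lerD// ler_wpM2r.
have U_d x y : 0 <= x <= s -> 0 <= y <= s -> U (p + x *: a + y *: b).
  by move=> xs ys; have [] := dP _ (in_d _ _ xs ys).
have s_in : 0 <= s <= s by rewrite lexx ltW.
have z_in : 0 <= (0 : R) <= s by rewrite lexx ltW.
have sc_in (x : R) : 0 <= x <= 1 -> 0 <= x * s <= s.
  by move=> /andP[x0 x1]; rewrite mulr_ge0 ?(ltW s0)//= ler_piMl// ltW.
(* Two applications of the mean value theorem to the second difference. *)
pose g z := f (z + s *: b) - f z.
have fE : (f (p + s *: a + s *: b) - f (p + s *: a) - f (p + s *: b) + f p)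
   = g (p + s *: a) - g p.
  by rewrite /g; ring.
have dg x : 0 <= x <= 1 -> differentiable g (p + x *: (s *: a)).
  move=> x01; apply: dflB; last first.
    by rewrite scalerA; apply: (smooth_dfl sf); have := U_d _ 0 (sc_in _ x01) z_in; rewrite scale0r addr0.
  by apply: dfl_shift; apply: (smooth_dfl sf); rewrite scalerA; exact: U_d (sc_in _ x01) s_in.
have [x x01 gE] := mvt_line dg.
have xs : 0 <= x * s <= s by apply: sc_in; case/andP: x01 => ? ?; rewrite !ltW.
have dDa y : 0 <= y <= 1 -> differentiable ('DD_a f) (p + (x * s) *: a + y *: (s *: b)).
  move=> y01; apply: (smooth_dfl (smooth_drv _ sf)); rewrite scalerA.
  exact: U_d (sc_in _ y01).
have Dg : 'DD_(s *: a) g (p + x *: (s *: a)) =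
    s * ('DD_a f (p + (x * s) *: a + s *: b) - 'DD_a f (p + (x * s) *: a)).
  have Ua : U (p + (x * s) *: a).
    by have := U_d _ 0 xs z_in; rewrite scale0r addr0.
  rewrite -[s *: a]addr0 dvl_lin; last first.
    by rewrite addr0; apply: dg; case/andP: x01 => ? ?; rewrite !ltW.
  rewrite addr0 dvl0 addr0 scalerA; congr (_ * _).
  rewrite dvlB; last exact: (smooth_dfl sf).
    by rewrite dvl_shift//; apply: (smooth_dfl sf); exact: U_d.
  by apply: dfl_shift; apply: (smooth_dfl sf); exact: U_d.
have [y y01 DgE] := mvt_line dDa.
have ys : 0 <= y * s <= s by apply: sc_in; case/andP: y01 => ? ?; rewrite !ltW.
rewrite fE gE Dg DgE -[s *: b]addr0 dvl_lin; last first.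
  by rewrite addr0; apply: dDa; case/andP: y01 => ? ?; rewrite !ltW.
rewrite dvl0 !addr0 scalerA [_ *: _]/(_ * _) mulrA -expr2 mulrAC divff ?mul1r; last first.
  by rewrite expf_neq0// gt_eqF.
by have [] := dP _ (in_d _ _ xs ys).
Unshelve. all: by end_near. Qed.

(** * Null coordinates *)

HB.lock Definition Xf (R : realType) (n : nat) (i : 'I_n) : Dn R n :=
  slot i (pce R).
HB.lock Definition Yf (R : realType) (n : nat) (i : 'I_n) : Dn R n :=
  slot i (pcebar R).

Section NullCoordinates.
Variables (R : realType) (n : nat).
Implicit Types (z p q v : Dn R n) (x y : 'rV[R]_n) (i j : 'I_n).

Definition xiv z : 'rV[R]_n := \row_i xi z i.
Definition etav z : 'rV[R]_n := \row_i eta z i.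

(** The point with null coordinates [xi = x] and [eta = y]. *)
Definition pt x y : Dn R n := (2^-1 *: (x + y), 2^-1 *: (y - x)).

Lemma xi_pt x y i : xi (pt x y) i = x 0 i.
Proof. by rewrite /xi /= !mxE; field. Qed.
Lemma eta_pt x y i : eta (pt x y) i = y 0 i.
Proof. by rewrite /eta /= !mxE; field. Qed.
Lemma pt_xi_eta z : pt (xiv z) (etav z) = z.
Proof.
by case: z => a b; congr pair; apply/rowP => i; rewrite !mxE /xi /eta /=; field.
Qed.
Lemma eq_null z z' : (forall i, xi z i = xi z' i) ->
  (forall i, eta z i = eta z' i) -> z = z'.
Proof.
move=> hx he; rewrite -(pt_xi_eta z) -(pt_xi_eta z').
by congr pt; apply/rowP => i; rewrite !mxE.
Qed.

Lemma xiL i : linear (fun z => xi z i).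
Proof. by move=> a u v; rewrite /xi /= !mxE /GRing.scale/=; ring. Qed.
Lemma etaL i : linear (fun z => eta z i).
Proof. by move=> a u v; rewrite /eta /= !mxE /GRing.scale/=; ring. Qed.

Lemma dfl_re i p : differentiable (fun z => z.1 0 i : R) p.
Proof.
apply: (@differentiable_comp _ _ _ _ (@fst _ _) (fun x : 'rV[R]_n => x 0 i)).
  by apply: linear_differentiable; move=> x; exact: cvg_fst.
exact: differentiable_coord.
Qed.
Lemma dfl_im i p : differentiable (fun z => z.2 0 i : R) p.
Proof.
apply: (@differentiable_comp _ _ _ _ (@snd _ _) (fun x : 'rV[R]_n => x 0 i)).
  by apply: linear_differentiable; move=> x; exact: cvg_snd.
exact: differentiable_coord.
Qed.
Lemma dfl_xi i p : differentiable (fun z => xi z i) p.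
Proof. by apply: dflB; [exact: dfl_re|exact: dfl_im]. Qed.
Lemma dfl_eta i p : differentiable (fun z => eta z i) p.
Proof. by apply: dflD; [exact: dfl_re|exact: dfl_im]. Qed.

Lemma dvl_xi i v p : 'DD_v (fun z => xi z i) p = xi v i.
Proof. exact/dvl_linear/xiL. Qed.
Lemma dvl_eta i v p : 'DD_v (fun z => eta z i) p = eta v i.
Proof. exact/dvl_linear/etaL. Qed.

Lemma xi_X i j : xi (Xf R i) j = (i == j)%:R.
Proof. by rewrite Xf.unlock /xi !mxE eq_sym; case: eqP => _ /=; [field|ring]. Qed.
Lemma eta_X i j : eta (Xf R i) j = 0.
Proof. by rewrite Xf.unlock /eta !mxE; case: eqP => _ /=; ring. Qed.
Lemma xi_Y i j : xi (Yf R i) j = 0.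
Proof. by rewrite Yf.unlock /xi !mxE; case: eqP => _ /=; ring. Qed.
Lemma eta_Y i j : eta (Yf R i) j = (i == j)%:R.
Proof. by rewrite Yf.unlock /eta !mxE eq_sym; case: eqP => _ /=; [field|ring]. Qed.

Lemma xiD z z' i : xi (z + z') i = xi z i + xi z' i.
Proof. by have := xiL i 1 z z'; rewrite scale1r /GRing.scale/= mul1r. Qed.
Lemma etaD z z' i : eta (z + z') i = eta z i + eta z' i.
Proof. by have := etaL i 1 z z'; rewrite scale1r /GRing.scale/= mul1r. Qed.
Lemma xi0 i : xi (0 : Dn R n) i = 0.
Proof. by rewrite /xi !mxE subr0. Qed.
Lemma eta0 i : eta (0 : Dn R n) i = 0.
Proof. by rewrite /eta !mxE addr0. Qed.
Lemma xiZ (a : R) z i : xi (a *: z) i = a * xi z i.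
Proof. by have := xiL i a z 0; rewrite !addr0 xi0 addr0. Qed.
Lemma etaZ (a : R) z i : eta (a *: z) i = a * eta z i.
Proof. by have := etaL i a z 0; rewrite !addr0 eta0 addr0. Qed.
Lemma xiN z i : xi (- z) i = - xi z i.
Proof. by rewrite -scaleN1r xiZ mulN1r. Qed.
Lemma etaN z i : eta (- z) i = - eta z i.
Proof. by rewrite -scaleN1r etaZ mulN1r. Qed.
Lemma xi_sum (I : Type) (r : seq I) (F : I -> Dn R n) i :
  xi (\sum_(k <- r) F k) i = \sum_(k <- r) xi (F k) i.
Proof. by elim/big_ind2: _ => [|a b c d <- <-|//]; rewrite ?xi0// xiD. Qed.
Lemma eta_sum (I : Type) (r : seq I) (F : I -> Dn R n) i :
  eta (\sum_(k <- r) F k) i = \sum_(k <- r) eta (F k) i.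
Proof. by elim/big_ind2: _ => [|a b c d <- <-|//]; rewrite ?eta0// etaD. Qed.

Lemma sum_delta (f : 'I_n -> R) i : \sum_j f j * (j == i)%:R = f i.
Proof.
rewrite (bigD1 i)//= eqxx mulr1 big1 ?addr0// => j ji.
by rewrite (negbTE ji) mulr0.
Qed.

Lemma null_decomp v : v = \sum_i xi v i *: Xf R i + \sum_i eta v i *: Yf R i.
Proof.
apply: eq_null => i.
  rewrite xiD !xi_sum (eq_bigr (fun j => xi v j * (j == i)%:R)); last first.
    by move=> j _; rewrite xiZ xi_X.
  by rewrite sum_delta big1 ?addr0// => j _; rewrite xiZ xi_Y mulr0.
rewrite etaD !eta_sum addrC (eq_bigr (fun j => eta v j * (j == i)%:R)); last first.
  by move=> j _; rewrite etaZ eta_Y.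
by rewrite sum_delta big1 ?addr0// => j _; rewrite etaZ eta_X mulr0.
Qed.

Lemma dvl_null (f : Dn R n -> R) v p : differentiable f p ->
  'DD_v f p = \sum_i xi v i * 'DD_(Xf R i) f p + \sum_i eta v i * 'DD_(Yf R i) f p.
Proof.
move=> df; rewrite {1}(null_decomp v) -[X in 'DD_(X + _) _ _]scale1r dvl_lin// scale1r.
by rewrite !dvl_sumv.
Qed.

Lemma dvl_null0 (f : Dn R n -> R) v p : differentiable f p ->
  (forall i, xi v i = 0 \/ 'DD_(Xf R i) f p = 0) ->
  (forall i, eta v i = 0 \/ 'DD_(Yf R i) f p = 0) -> 'DD_v f p = 0.
Proof.
move=> df hX hY; rewrite dvl_null//.
rewrite [X in X + _]big1 => [|i _]; last by case: (hX i) => ->; rewrite ?mul0r ?mulr0.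
by rewrite add0r big1 => [//|i _]; case: (hY i) => ->; rewrite ?mul0r ?mulr0.
Qed.

(** Boxes in null coordinates rather than balls: they are convex and, with two points, contain the
    point that combines [xi] of the one with [eta] of the other ([box_pt]), as polarization
    requires. *)
Definition box p (r : R) : set (Dn R n) := [set z |
  forall i, `|xi z i - xi p i| < r /\ `|eta z i - eta p i| < r].

Lemma box_center p r : 0 < r -> box p r p.
Proof. by move=> r0 i; rewrite !subrr normr0. Qed.

Lemma open_box p r : open (box p r).
Proof.
have cabs (f : Dn R n -> R) c q : {for q, continuous f} -> `|f q - c| < r ->
    \forall z \near q, `|f z - c| < r.
  move=> cf fq.
  have cg : (fun z => `|f z - c|) @ q --> `|f q - c|.
    by apply: cvg_norm; apply: cvgB => //; exact: cvg_cst.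
  exact: (cvgr_lt _ cg _ fq).
rewrite openE => q bq.
suff H i : nbhs q [set z | `|xi z i - xi p i| < r /\ `|eta z i - eta p i| < r].
  exact: (@filter_forall _ _ (fun i z =>
    `|xi z i - xi p i| < r /\ `|eta z i - eta p i| < r) (nbhs q) _ H).
have [hx he] := bq i; apply: filterI; apply: cabs => //;
  apply: differentiable_continuous; [exact: dfl_xi|exact: dfl_eta].
Qed.

Lemma sub_box p r r' : r' <= r -> box p r' `<=` box p r.
Proof. by move=> rr z bz i; have [a b] := bz i; split; apply: lt_le_trans rr. Qed.

Lemma nbhs_box p (A : set (Dn R n)) : nbhs p A ->
  exists2 r : R, 0 < r & box p r `<=` A.
Proof.
move=> /nbhs_ballP[r /= r0 rA]; exists r => // z bz; apply: rA.
have mxlt (x : 'rV[R]_n) : (forall i, `|x 0 i| < r) -> `|x| < r.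
  move=> xr; rewrite [ltLHS]/Num.Def.normr/= mx_normrE.
  by apply: bigmax_lt => // -[i j] _; rewrite (ord1 i).
rewrite -ball_normE /= [ltLHS]/Num.Def.normr /= gt_max.
apply/andP; split; apply: mxlt => i; have [hx he] := bz i.
  have -> : (p - z).1 0 i = - ((xi z i - xi p i) + (eta z i - eta p i)) / 2.
    by rewrite /xi /eta !mxE; field.
  rewrite normrM normrN gtr0_norm// ltr_pdivrMr// mulrDr mulr1.
  by rewrite (le_lt_trans (ler_normD _ _))// ltrD.
have -> : (p - z).2 0 i = - ((eta z i - eta p i) - (xi z i - xi p i)) / 2.
  by rewrite /xi /eta !mxE; field.
rewrite normrM normrN gtr0_norm// ltr_pdivrMr// mulrDr mulr1.
by rewrite (le_lt_trans (ler_normB _ _))// ltrD.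
Qed.

Lemma open_box_sub p (U : set (Dn R n)) : open U -> U p ->
  exists2 r : R, 0 < r & box p r `<=` U.
Proof. by move=> oU Up; apply: nbhs_box; exact: open_nbhs_nbhs. Qed.

Lemma box_convex p r z z' (s : R) : box p r z -> box p r z' -> 0 <= s <= 1 ->
  box p r (z + s *: (z' - z)).
Proof.
move=> bz bz' /andP[s0 s1] i; have [hx he] := bz i; have [hx' he'] := bz' i.
have cv a b : `|a| < r -> `|b| < r -> `|(1 - s) * a + s * b| < r.
  move=> ar br; rewrite (le_lt_trans (ler_normD _ _))// !normrM.
  rewrite (ger0_norm s0) ger0_norm ?subr_ge0//.
  have [->|sn] := eqVneq s 0; first by rewrite subr0 mul1r mul0r addr0.
  have -> : r = (1 - s) * r + s * r by ring.
  rewrite ler_ltD//; first by rewrite ler_wpM2l// ?subr_ge0// ltW.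
  by rewrite ltr_pM2l// lt_def sn.
split.
  have -> : xi (z + s *: (z' - z)) i - xi p i
    = (1 - s) * (xi z i - xi p i) + s * (xi z' i - xi p i).
    by rewrite xiD xiZ xiD xiN; ring.
  exact: cv.
have -> : eta (z + s *: (z' - z)) i - eta p i
  = (1 - s) * (eta z i - eta p i) + s * (eta z' i - eta p i).
  by rewrite etaD etaZ etaD etaN; ring.
exact: cv.
Qed.

Lemma box_cst (f : Dn R n -> R) p r z z' :
  (forall q, box p r q -> differentiable f q) ->
  box p r z -> box p r z' ->
  (forall q, box p r q -> 'DD_(z' - z) f q = 0) -> f z' = f z.
Proof.
move=> df bz bz' f0; rewrite -{1}(subrK z z') addrC.
by apply: line_cst => s s01; [apply: df|apply: f0]; exact: box_convex.
Qed.

Lemma box_cst_xi (f : Dn R n -> R) p r z z' :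
  (forall q, box p r q -> differentiable f q) ->
  (forall i q, box p r q -> 'DD_(Xf R i) f q = 0) ->
  box p r z -> box p r z' -> (forall i, eta z i = eta z' i) -> f z' = f z.
Proof.
move=> df f0 bz bz' ez; apply: (box_cst df bz bz') => q bq.
apply: dvl_null0 (df _ bq) _ _ => i; first by right; exact: f0.
by left; rewrite etaD etaN ez subrr.
Qed.

Lemma box_cst_eta (f : Dn R n -> R) p r z z' :
  (forall q, box p r q -> differentiable f q) ->
  (forall i q, box p r q -> 'DD_(Yf R i) f q = 0) ->
  box p r z -> box p r z' -> (forall i, xi z i = xi z' i) -> f z' = f z.
Proof.
move=> df f0 bz bz' ez; apply: (box_cst df bz bz') => q bq.
apply: dvl_null0 (df _ bq) _ _ => i; last by right; exact: f0.
by left; rewrite xiD xiN ez subrr.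
Qed.

Lemma box_pt p r z z' : box p r z -> box p r z' -> box p r (pt (xiv z) (etav z')).
Proof.
move=> bz bz' i; rewrite xi_pt eta_pt !mxE.
by have [? _] := bz i; have [_ ?] := bz' i.
Qed.

(** The shift by [w] moves [xi] only. Since the [eta]-derivatives of [f] do not depend on [xi], the
    increment [f q - f (q + w)] does not change when [q] moves by [v], which moves [eta] only. *)
Lemma box_separation (f : Dn R n -> R) p r z z0 :
  smooth_on (box p r) f ->
  (forall i j q, box p r q -> 'DD_(Xf R i) ('DD_(Yf R j) f) q = 0) ->
  box p r z -> box p r z0 ->
  f z = f (pt (xiv z) (etav z0)) + f (pt (xiv z0) (etav z)) - f z0.
Proof.
move=> sf f0 bz bz0; have oB := @open_box p r.
pose p1 := pt (xiv z) (etav z0); pose w := z0 - p1; pose v := z - p1.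
have bp1 : box p r p1 by exact: box_pt.
have xi_v i : xi v i = 0 by rewrite xiD xiN xi_pt mxE subrr.
have eta_w i : eta w i = 0 by rewrite etaD etaN eta_pt mxE subrr.
have bq s : 0 <= s <= 1 -> box p r (p1 + s *: v) by exact: box_convex.
have bqw s : 0 <= s <= 1 -> box p r (p1 + s *: v + w).
  move=> /(bq _) bs i; rewrite xiD etaD eta_w addr0 xiD xiZ xi_v mulr0 addr0.
  rewrite -xiD [p1 + w]addrC subrK; split; first by have [] := bz0 i.
  by have [] := bs i.
have E : f (p1 + v) - f (p1 + v + w) = f p1 - f (p1 + w).
  apply: (line_cst (f := fun q => f q - f (q + w))) => s s01.
    by apply: dflB; [|apply: dfl_shift]; apply: (smooth_dfl sf);
      [exact: bq|exact: bqw].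
  have d1 := smooth_dfl sf (bq s s01); have d2 := smooth_dfl sf (bqw s s01).
  rewrite (dvlB _ d1 (dfl_shift d2)) (dvl_shift _ d2) (dvl_null _ d1) (dvl_null _ d2).
  rewrite [X in X + _ - _]big1 ?add0r; last by move=> i _; rewrite xi_v mul0r.
  rewrite [X in _ - (X + _)]big1 ?add0r; last by move=> i _; rewrite xi_v mul0r.
  rewrite -sumrB big1// => j _; rewrite -mulrBr.
  have dY q : box p r q -> differentiable ('DD_(Yf R j) f) q.
    exact: (smooth_dfl (smooth_drv _ sf)).
  have eE i : eta (p1 + s *: v) i = eta (p1 + s *: v + w) i.
    by rewrite [RHS]etaD eta_w addr0.
  have -> := box_cst_xi dY (fun i => f0 i j) (bq s s01) (bqw s s01) eE.
  by rewrite subrr mulr0.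
have -> : f z = f (p1 + v) by rewrite addrC subrK.
have <- : p1 + v + w = pt (xiv z0) (etav z).
  apply: eq_null => i; rewrite ?xi_pt ?eta_pt.
    by rewrite [LHS]xiD [X in X + _]xiD xi_v addr0 xiD xiN addrC subrK mxE.
  by rewrite [LHS]etaD eta_w addr0 etaD etaD etaN addrC subrK mxE.
have -> : f z0 = f (p1 + w) by rewrite addrC subrK.
by move/eqP: E; rewrite subr_eq => /eqP ->; ring.
Qed.

(** The set where [P] holds is open and relatively closed in [U]: the box of each point of [U]
    satisfies [P] everywhere as soon as it does somewhere. *)
Lemma connected_box_ind (U : set (Dn R n)) (P : Dn R n -> Prop) p0 :
  connected U -> U p0 -> P p0 ->
  (forall p, U p -> exists r : R, [/\ 0 < r, box p r `<=` U &
     (exists2 q, box p r q & P q) -> forall q, box p r q -> P q]) ->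
  forall p, U p -> P p.
Proof.
move=> cU Up0 Pp0 PU.
have boxE p r : open (box p r) by exact: open_box.
have BE : [set p | U p /\ P p] = U.
  apply: cU; first by exists p0.
  - exists [set p | U p /\ P p]; last by apply/seteqP; split=> [p []|p []].
    rewrite openE => p [Up Pp]; have [r [r0 rU rP]] := PU p Up.
    apply: (filterS _ (open_nbhs_nbhs (conj (boxE p r) (box_center p r0)))).
    move=> q bq; split; first exact: rU.
    by apply: rP => //; exists p => //; exact: box_center.
  - exists (~` [set p | U p /\ ~ P p]).
      apply: open_closedC; rewrite openE => p [Up Pp]; have [r [r0 rU rP]] := PU p Up.
      apply: (filterS _ (open_nbhs_nbhs (conj (boxE p r) (box_center p r0)))).
      move=> q bq; split; first exact: rU.
      by move=> Pq; apply: Pp; apply: rP; [exists q|exact: box_center].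
    apply/seteqP; split=> p [Up Pp]; split=> //; first by case.
    by apply: contrapT => NP; exact: Pp.
by move=> p Up; have [] : [set p | U p /\ P p] p by rewrite BE.
Qed.

Lemma connected_cst (U : set (Dn R n)) (f : Dn R n -> R) p q :
  open U -> connected U -> (forall z, U z -> differentiable f z) ->
  (forall i z, U z -> 'DD_(Xf R i) f z = 0) ->
  (forall i z, U z -> 'DD_(Yf R i) f z = 0) -> U p -> U q -> f q = f p.
Proof.
move=> oU cU df fX fY Up; apply: (connected_box_ind cU Up (P := fun q => f q = f p)) => //.
move=> z Uz; have [r r0 rU] := open_box_sub oU Uz; exists r; split=> //.
move=> [w bw <-] w' bw'; apply: (box_cst (p := z) (r := r)) => //.
  by move=> u bu; apply: df; exact: rU.
move=> u bu; have Uu := rU _ bu; by apply: dvl_null0 (df _ Uu) _ _ => i; right; [exact: fX|exact: fY].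
Qed.

Lemma connected_Dn : connected [set: Dn R n].
Proof.
have -> : [set: Dn R n] = \bigcup_(z in setT)
    ((fun s : R => s *: (z : Dn R n)) @` `[0, 1]).
  apply/seteqP; split=> // z _; exists z => //; exists 1; last exact: scale1r.
  by rewrite /= in_itv /= ler01 lexx.
apply: bigcup_connected.
  exists 0 => z _; exists 0; last exact: scale0r.
  by rewrite /= in_itv /= ler01 lexx.
move=> z _; apply: connected_continuous_connected; first exact: segment_connected.
by apply: continuous_subspaceT; exact: scalel_continuous.
Qed.
End NullCoordinates.

(** * Metric and curvature *)

Section Determinant.
Variables (R : realType) (V : normedModType R).

(** The differentiated factor is kept inside the product by an [if], so that in [dvl_det] each
    summand is a Leibniz term of a matrix with one differentiated row. *)
Lemma dvl_prod (I : eqType) (r : seq I) (F : I -> V -> R) v p : uniq r ->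
  (forall i, differentiable (F i) p) ->
  'DD_v (fun z => \prod_(i <- r) F i z) p =
  \sum_(i <- r) \prod_(j <- r) (if j == i then 'DD_v (F j) p else F j p).
Proof.
move=> + dF; elim: r => [_|i r IH /= /andP[ir ur]].
  by under eq_fun do rewrite big_nil; rewrite big_nil dvl_cst.
have dP : differentiable (fun z => \prod_(i <- r) F i z) p.
  elim: (r) => [|j s IHs]; first by under eq_fun do rewrite big_nil; exact: dfl_cst.
  by under eq_fun do rewrite big_cons; exact: dflM (dF j) IHs.
under eq_fun do rewrite big_cons.
rewrite (dvlM _ (dF i) dP) (IH ur) big_cons big_cons eqxx; congr (_ + _).
  congr (_ * _); apply: eq_big_seq => j jr.
  by case: eqP => // ji; move: ir; rewrite -ji jr.
rewrite mulr_sumr; apply: eq_big_seq => j jr; rewrite big_cons.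
by case: eqP => // ij; move: ir; rewrite ij jr.
Qed.

Lemma dfl_prod (I : Type) (r : seq I) (F : I -> V -> R) p :
  (forall i, differentiable (F i) p) ->
  differentiable (fun z => \prod_(i <- r) F i z) p.
Proof.
move=> dF; elim: r => [|i r IH].
  by under eq_fun do rewrite big_nil; exact: dfl_cst.
by under eq_fun do rewrite big_cons; exact: dflM (dF i) IH.
Qed.

Lemma dfl_det n (A : V -> 'M[R]_n) p :
  (forall i j, differentiable (fun q => A q i j) p) ->
  differentiable (fun q => \det (A q)) p.
Proof.
move=> dA; rewrite /determinant; apply: dfl_sum => s _.
apply: dflM; first exact: dfl_cst.
by apply: dfl_prod => i; exact: dA.
Qed.

(** Jacobi's formula: [M i] is [A p] with row [i] differentiated, and expanding along that row
    leaves the cofactors of [A p]. *)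
Lemma dvl_det n (A : V -> 'M[R]_n) v p :
  (forall i j, differentiable (fun q => A q i j) p) ->
  'DD_v (fun q => \det (A q)) p =
  \sum_i \sum_j 'DD_v (fun q => A q i j) p * cofactor (A p) i j.
Proof.
move=> dA.
pose M i : 'M[R]_n :=
  \matrix_(k, l) if k == i then 'DD_v (fun q => A q k l) p else A p k l.
transitivity (\sum_i \det (M i)).
  rewrite /determinant dvl_sum => [|s _]; last first.
    by apply: dflM; [exact: dfl_cst|apply: dfl_prod => i; exact: dA].
  rewrite exchange_big; apply: eq_bigr => s _ /=.
  have dAs (i : 'I_n) : differentiable (fun q => A q i (s i)) p by exact: dA.
  rewrite (dvlZ _ _ (dfl_prod _ dAs)) (dvl_prod _ (index_enum_uniq _) dAs).
  rewrite mulr_sumr; apply: eq_bigr => i _; congr (_ * _).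
  by apply: eq_bigr => k _; rewrite mxE.
apply: eq_bigr => i _; rewrite (expand_det_row _ i); apply: eq_bigr => j _.
rewrite mxE eqxx /cofactor; congr (_ * (_ * \det _)).
by apply/matrixP => k l; rewrite !mxE eq_sym (negbTE (neq_lift _ _)).
Qed.

Lemma smooth_det (U : set V) n (A : V -> 'M[R]_n) : open U ->
  (forall i j, smooth_on U (fun q => A q i j)) ->
  smooth_on U (fun q => \det (A q)).
Proof.
move=> oU sA; rewrite /determinant; apply: smooth_sum => // s _.
apply: smoothM => //; first exact: smooth_cst.
by apply: smooth_prod => // i _; exact: sA.
Qed.

Lemma smooth_invmx (U : set V) n (A : V -> 'M[R]_n) i j : open U ->
  (forall i j, smooth_on U (fun q => A q i j)) ->
  (forall q, U q -> A q \in unitmx) ->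
  smooth_on U (fun q => invmx (A q) i j).
Proof.
move=> oU sA uA.
apply: (@smooth_eq _ _ _ oU _
    (fun q => (\det (A q))^-1 * ((-1) ^+ (j + i) * \det (row' j (col' i (A q)))))).
  by move=> q Uq; rewrite /invmx uA// !mxE.
apply: smoothM => //.
  apply: smoothV => //; first exact: smooth_det.
  by move=> q /uA; rewrite unitmxE unitfE.
apply: smoothM => //; first exact: smooth_cst.
apply: smooth_det => // k l; apply: (smooth_eq oU _ (sA (lift j k) (lift i l))).
by move=> q _; rewrite !mxE.
Qed.
End Determinant.

(** The matrix [h] of the metric, with the [xi]-index first. It plays the role of the hermitian
    matrix of a Kähler metric and is in general not symmetric. *)
HB.lock Definition hess (R : realType) (n : nat) (phi : Dn R n -> R)
  (i j : 'I_n) : Dn R n -> R := 'DD_(Xf R i) ('DD_(Yf R j) phi).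

Section Metric.
Variables (R : realType) (n : nat).
Implicit Types (phi : Dn R n -> R) (p q v w : Dn R n) (i j k : 'I_n).

Lemma nframe_l i : nframe R (lshift n i) = Xf R i.
Proof. by rewrite /nframe (unsplitK (inl i)) Xf.unlock. Qed.
Lemma nframe_r i : nframe R (rshift n i) = Yf R i.
Proof. by rewrite /nframe (unsplitK (inr i)) Yf.unlock. Qed.
Lemma ncoord_l v i : ncoord v (lshift n i) = xi v i.
Proof. by rewrite /ncoord (unsplitK (inl i)). Qed.
Lemma ncoord_r v i : ncoord v (rshift n i) = eta v i.
Proof. by rewrite /ncoord (unsplitK (inr i)). Qed.

Definition hessmx phi q : 'M[R]_n := \matrix_(i, j) hess phi i j q.

Lemma hessE phi i j : hess phi i j = 'DD_(Xf R i) ('DD_(Yf R j) phi).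
Proof. by rewrite hess.unlock. Qed.

Lemma metricE phi p v w : metric phi p v w = \sum_i \sum_j hess phi i j p *
  ((xi v i * eta w j + xi w i * eta v j) / 2).
Proof.
apply: eq_bigr => i _; apply: eq_bigr => j _; congr (_ * _).
rewrite hessE Xf.unlock Yf.unlock -ddE; congr derive.
by apply/funext => q; rewrite ddE.
Qed.

Lemma metric_XY phi p i j : metric phi p (Xf R i) (Yf R j) = hess phi i j p / 2.
Proof.
rewrite metricE (bigD1 i)//= [X in _ + X]big1 => [|k ki]; last first.
  apply: big1 => l _; rewrite xi_X eq_sym (negbTE ki) xi_Y.
  by rewrite !(mul0r, mulr0, addr0).
rewrite addr0 (bigD1 j)//= [X in _ + X]big1 => [|l lj]; last first.
  by rewrite eta_Y eq_sym (negbTE lj) xi_Y !(mul0r, mulr0, addr0).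
by rewrite xi_X eta_Y xi_Y !eqxx !(mul0r, mulr1, addr0) mul1r.
Qed.

Lemma metricC phi p v w : metric phi p v w = metric phi p w v.
Proof.
by rewrite !metricE; apply: eq_bigr => i _; apply: eq_bigr => j _; rewrite addrC.
Qed.

Lemma metric_XX phi p i j : metric phi p (Xf R i) (Xf R j) = 0.
Proof.
rewrite metricE big1// => k _; rewrite big1// => l _.
by rewrite !eta_X !(mul0r, mulr0, addr0).
Qed.

Lemma metric_YY phi p i j : metric phi p (Yf R i) (Yf R j) = 0.
Proof.
rewrite metricE big1// => k _; rewrite big1// => l _.
by rewrite !xi_Y !(mul0r, mulr0, addr0).
Qed.

(** Both null distributions are isotropic, so only the mixed blocks survive; [2^-1] is that of the
    symmetric product in [metric]. *)
Lemma gramE phi p : gram (metric phi) p =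
  block_mx 0 (2^-1 *: hessmx phi p) (2^-1 *: (hessmx phi p)^T) 0.
Proof.
apply/matrixP => a b; rewrite -(splitK a) -(splitK b).
case: (fintype.split a) => i; case: (fintype.split b) => j /=.
- by rewrite block_mxEul !mxE !nframe_l metric_XX.
- by rewrite block_mxEur !mxE nframe_l nframe_r metric_XY mulrC.
- by rewrite block_mxEdl !mxE nframe_l nframe_r metricC metric_XY mulrC.
- by rewrite block_mxEdr !mxE !nframe_r metric_YY.
Qed.

Lemma gram_ll phi p i j : gram (metric phi) p (lshift n i) (lshift n j) = 0.
Proof. by rewrite gramE block_mxEul mxE. Qed.
Lemma gram_rr phi p i j : gram (metric phi) p (rshift n i) (rshift n j) = 0.
Proof. by rewrite gramE block_mxEdr mxE. Qed.
Lemma gram_lr phi p i j :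
  gram (metric phi) p (lshift n i) (rshift n j) = 2^-1 * hess phi i j p.
Proof. by rewrite gramE block_mxEur !mxE. Qed.
Lemma gram_rl phi p i j :
  gram (metric phi) p (rshift n j) (lshift n i) = 2^-1 * hess phi i j p.
Proof. by rewrite gramE block_mxEdl !mxE. Qed.

Lemma invgramE phi p : hessmx phi p \in unitmx -> invmx (gram (metric phi) p) =
  block_mx 0 (2 *: (invmx (hessmx phi p))^T) (2 *: invmx (hessmx phi p)) 0.
Proof.
move=> uh; set B := block_mx _ _ _ _.
have GB : gram (metric phi) p *m B = 1%:M.
  rewrite gramE /B mulmx_block !mul0mx !mulmx0 !addr0 !add0r.
  rewrite -!scalemxAl -!scalemxAr !scalerA mulVf// !scale1r mulmxV// -trmx_mul.
  by rewrite mulVmx// trmx1 -scalar_mx_block.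
have uG : gram (metric phi) p \in unitmx by case/mulmx1_unit: GB.
by rewrite -[LHS]mulmx1 -GB mulmxA mulVmx// mul1mx.
Qed.

Section Curvature.
Variables (U : set (Dn R n)) (phi : Dn R n -> R).
Hypotheses (oU : open U) (sphi : smooth_on U phi).
Hypothesis uh : forall q, U q -> hessmx phi q \in unitmx.

Lemma smooth_hess i j : smooth_on U (hess phi i j).
Proof. by rewrite hessE; apply: smooth_drv; exact: smooth_drv. Qed.

Lemma DX_hessC a c f p : U p ->
  'DD_(Xf R a) (hess phi c f) p = 'DD_(Xf R c) (hess phi a f) p.
Proof.
move=> Up; rewrite !hessE.
exact: (@schwarz _ _ U ('DD_(Yf R f) phi) (Xf R a) (Xf R c) p oU (smooth_drv (Yf R f) sphi) Up).
Qed.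

Lemma hessC i j p : U p -> hess phi i j p = 'DD_(Yf R j) ('DD_(Xf R i) phi) p.
Proof.
by move=> Up; rewrite hessE; exact: (@schwarz _ _ U phi (Xf R i) (Yf R j) p oU sphi Up).
Qed.

Lemma DY_hessC b i j p : U p ->
  'DD_(Yf R b) (hess phi i j) p = 'DD_(Yf R j) (hess phi i b) p.
Proof.
move=> Up; have h1 := eq_derive_open (Yf R b) oU Up (fun q Uq => hessC i j Uq).
have h2 := eq_derive_open (Yf R j) oU Up (fun q Uq => hessC i b Uq).
rewrite h1 h2.
exact: (@schwarz _ _ U ('DD_(Xf R i) phi) (Yf R b) (Yf R j) p oU (smooth_drv (Xf R i) sphi) Up).
Qed.

(** The entries of [(d_xi_a h) h^-1], and below of [h^-1 (d_eta_b h)]. They are the only Christoffel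
    symbols that survive, see [christoffel_lll] and [christoffel_rrr]. *)
Definition Gam k a c q : R :=
  \sum_f 'DD_(Xf R a) (hess phi c f) q * invmx (hessmx phi q) f k.
Definition Gbar k b c q : R :=
  \sum_f invmx (hessmx phi q) k f * 'DD_(Yf R b) (hess phi f c) q.

Lemma smooth_invhess i j : smooth_on U (fun q => invmx (hessmx phi q) i j).
Proof.
apply: smooth_invmx => // k l; apply: (smooth_eq oU _ (smooth_hess k l)).
by move=> q _; rewrite mxE.
Qed.

Lemma smooth_Gam k a c : smooth_on U (Gam k a c).
Proof.
apply: smooth_sum => // f _; apply: smoothM => //; last exact: smooth_invhess.
exact/smooth_drv/smooth_hess.
Qed.

Lemma smooth_Gbar k b c : smooth_on U (Gbar k b c).
Proof.
apply: smooth_sum => // f _; apply: smoothM => //; first exact: smooth_invhess.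
exact/smooth_drv/smooth_hess.
Qed.

(** The relation [Gam h = d h], free of the inverse matrix: differentiating it yields the
    derivatives and the weights of [Gam] without a formula for the derivative of [invmx]. *)
Lemma Gam_hess a c f q : U q ->
  \sum_d Gam d a c q * hess phi d f q = 'DD_(Xf R a) (hess phi c f) q.
Proof.
move=> Uq; under eq_bigr do rewrite mulr_suml; rewrite exchange_big /=.
under eq_bigr => e _.
  under eq_bigr do rewrite -mulrA.
  rewrite -mulr_sumr.
  have -> : \sum_i invmx (hessmx phi q) e i * hess phi i f q = (e == f)%:R.
    have := congr1 (fun M : 'M[R]_n => M e f) (mulVmx (uh Uq)); rewrite !mxE => <-.
    by apply: eq_bigr => d _; rewrite mxE.
  over.
by rewrite sum_delta.
Qed.

Lemma hess_Gbar b c f q : U q ->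
  \sum_d hess phi f d q * Gbar d b c q = 'DD_(Yf R b) (hess phi f c) q.
Proof.
move=> Uq; under eq_bigr do rewrite mulr_sumr; rewrite exchange_big /=.
under eq_bigr => e _.
  under eq_bigr do rewrite mulrA.
  rewrite -mulr_suml.
  have -> : \sum_i hess phi f i q * invmx (hessmx phi q) i e = (e == f)%:R.
    have := congr1 (fun M : 'M[R]_n => M f e) (mulmxV (uh Uq)).
    rewrite !mxE eq_sym => <-.
    by apply: eq_bigr => d _; rewrite mxE.
  rewrite mulrC; over.
by rewrite sum_delta.
Qed.

Lemma Dgram_ll v i j p :
  'DD_v (fun q => gram (metric phi) q (lshift n i) (lshift n j)) p = 0.
Proof. by under eq_fun do rewrite gram_ll; exact: dvl_cst. Qed.
Lemma Dgram_rr v i j p :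
  'DD_v (fun q => gram (metric phi) q (rshift n i) (rshift n j)) p = 0.
Proof. by under eq_fun do rewrite gram_rr; exact: dvl_cst. Qed.
Lemma Dgram_lr v i j p : U p ->
  'DD_v (fun q => gram (metric phi) q (lshift n i) (rshift n j)) p =
  2^-1 * 'DD_v (hess phi i j) p.
Proof.
move=> Up; under eq_fun do rewrite gram_lr.
exact: dvlZ (smooth_dfl (smooth_hess _ _) Up).
Qed.
Lemma Dgram_rl v i j p : U p ->
  'DD_v (fun q => gram (metric phi) q (rshift n j) (lshift n i)) p =
  2^-1 * 'DD_v (hess phi i j) p.
Proof.
move=> Up; under eq_fun do rewrite gram_rl.
exact: dvlZ (smooth_dfl (smooth_hess _ _) Up).
Qed.

Let g := metric phi.

Lemma christoffel_l k a c p : U p -> christoffel g (lshift n k) a c p =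
  \sum_f invmx (hessmx phi p) f k *
    ('DD_(nframe R a) (fun q => gram g q c (rshift n f)) p
     + 'DD_(nframe R c) (fun q => gram g q a (rshift n f)) p
     - 'DD_(Yf R f) (fun q => gram g q a c) p).
Proof.
move=> Up; rewrite /christoffel invgramE ?uh// big_split_ord /=.
rewrite [X in _ * (X + _)]big1 => [|d _]; last by rewrite block_mxEul mxE mul0r.
rewrite add0r mulr_sumr; apply: eq_bigr => f _; rewrite !ddE.
by rewrite block_mxEur !mxE nframe_r !mulrA mulVf// mul1r.
Qed.

Lemma christoffel_r k a c p : U p -> christoffel g (rshift n k) a c p =
  \sum_f invmx (hessmx phi p) k f *
    ('DD_(nframe R a) (fun q => gram g q c (lshift n f)) p
     + 'DD_(nframe R c) (fun q => gram g q a (lshift n f)) p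
     - 'DD_(Xf R f) (fun q => gram g q a c) p).
Proof.
move=> Up; rewrite /christoffel invgramE ?uh// big_split_ord /=.
rewrite [X in _ * (_ + X)]big1 => [|d _]; last by rewrite block_mxEdr mxE mul0r.
rewrite addr0 mulr_sumr; apply: eq_bigr => f _; rewrite !ddE.
by rewrite block_mxEdl !mxE nframe_l !mulrA mulVf// mul1r.
Qed.

Lemma christoffel_lll k a c p : U p ->
  christoffel g (lshift n k) (lshift n a) (lshift n c) p = Gam k a c p.
Proof.
move=> Up; rewrite christoffel_l//; apply: eq_bigr => f _.
rewrite !nframe_l Dgram_ll !Dgram_lr// (DX_hessC c a f Up) subr0 mulrC.
by congr (_ * _); field.
Qed.

Lemma christoffel_rrr k b c p : U p ->
  christoffel g (rshift n k) (rshift n b) (rshift n c) p = Gbar k b c p.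
Proof.
move=> Up; rewrite christoffel_r//; apply: eq_bigr => f _.
rewrite !nframe_r Dgram_rr !Dgram_rl// (DY_hessC c f b Up) subr0.
by congr (_ * _); field.
Qed.

(** The Kähler condition at work: the two terms left by isotropy cancel by the symmetry [DY_hessC].
    With its mirror image this makes both null distributions parallel. *)
Lemma christoffel_lrl k b c p : U p ->
  christoffel g (lshift n k) (rshift n b) (lshift n c) p = 0.
Proof.
move=> Up; rewrite christoffel_l// big1// => f _.
rewrite nframe_r nframe_l Dgram_rr Dgram_lr// Dgram_rl// (DY_hessC f c b Up).
by rewrite addr0 subrr mulr0.
Qed.

Lemma christoffel_rlr k b c p : U p ->
  christoffel g (rshift n k) (lshift n b) (rshift n c) p = 0.
Proof.
move=> Up; rewrite christoffel_r// big1// => f _.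
rewrite nframe_r nframe_l Dgram_ll Dgram_lr// Dgram_rl// (DX_hessC f b c Up).
by rewrite addr0 subrr mulr0.
Qed.

Lemma gram_sym q a b : gram g q a b = gram g q b a.
Proof. by rewrite !mxE /g metricC. Qed.

Lemma christoffelC d a c p : christoffel g d a c p = christoffel g d c a p.
Proof.
rewrite /christoffel; congr (_ * _); apply: eq_bigr => e _; congr (_ * _); rewrite !ddE.
rewrite [X in X - _]addrC; congr (_ - _).
by under [in RHS]eq_fun do rewrite gram_sym.
Qed.

Lemma christoffel_lr k a c p : U p ->
  christoffel g (lshift n k) (rshift n a) c p = 0.
Proof.
move=> Up; rewrite -(splitK c); case: (fintype.split c) => j /=; first exact: christoffel_lrl.
rewrite christoffel_l// big1// => f _.
by rewrite !nframe_r !Dgram_rr subr0 addr0 mulr0.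
Qed.

Lemma christoffel_rl k a c p : U p ->
  christoffel g (rshift n k) (lshift n a) c p = 0.
Proof.
move=> Up; rewrite -(splitK c); case: (fintype.split c) => j /=; last exact: christoffel_rlr.
rewrite christoffel_r// big1// => f _.
by rewrite !nframe_l !Dgram_ll subr0 addr0 mulr0.
Qed.

Lemma D_christoffel_lr v k a c p : U p ->
  'DD_v (christoffel g (lshift n k) (rshift n a) c) p = 0.
Proof.
move=> Up; rewrite (eq_derive_open _ oU Up (fun q Uq => christoffel_lr k a c Uq)).
exact: dvl_cst.
Qed.

Lemma D_christoffel_rl v k a c p : U p ->
  'DD_v (christoffel g (rshift n k) (lshift n a) c) p = 0.
Proof.
move=> Up; rewrite (eq_derive_open _ oU Up (fun q Uq => christoffel_rl k a c Uq)).
exact: dvl_cst.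
Qed.

Lemma riemannN d c a b p : riemann g d c a b p = - riemann g d c b a p.
Proof.
rewrite /riemann !ddE opprD opprB; congr (_ + _); rewrite -sumrN.
by apply: eq_bigr => e _; rewrite opprB.
Qed.

(** The curvature preserves the two null distributions, since each term contains a mixed Christoffel
    symbol or a derivative of one. *)
Lemma riemann_lr d c a b p : U p -> riemann g (lshift n d) (rshift n c) a b p = 0.
Proof.
move=> Up.
have chE e : christoffel g (lshift n d) e (rshift n c)
    = christoffel g (lshift n d) (rshift n c) e.
  by apply/funext => q; exact: christoffelC.
rewrite /riemann !ddE !chE !(D_christoffel_lr _ _ _ _ Up) subr0 add0r.
rewrite big_split_ord /= [X in X + _]big1 ?[X in _ + X]big1 ?addr0 => [//|e _|e _].
- by rewrite ![christoffel g (lshift n d) _ (rshift n e) _]christoffelC !christoffel_lr// !mul0r subr0.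
- by rewrite ![christoffel g (lshift n e) _ (rshift n c) _]christoffelC !christoffel_lr// !mulr0 subr0.
Qed.

Lemma riemann_rl d c a b p : U p -> riemann g (rshift n d) (lshift n c) a b p = 0.
Proof.
move=> Up.
have chE e : christoffel g (rshift n d) e (lshift n c)
    = christoffel g (rshift n d) (lshift n c) e.
  by apply/funext => q; exact: christoffelC.
rewrite /riemann !ddE !chE !(D_christoffel_rl _ _ _ _ Up) subr0 add0r.
rewrite big_split_ord /= [X in X + _]big1 ?[X in _ + X]big1 ?addr0 => [//|e _|e _].
- by rewrite ![christoffel g (rshift n e) _ (lshift n c) _]christoffelC !christoffel_rl// !mulr0 subr0.
- by rewrite ![christoffel g (rshift n d) _ (lshift n e) _]christoffelC !christoffel_rl// !mul0r subr0.
Qed.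

Lemma riemann_lllr d c a b p : U p ->
  riemann g (lshift n d) (lshift n c) (lshift n a) (rshift n b) p
  = - 'DD_(Yf R b) (Gam d a c) p.
Proof.
move=> Up; rewrite /riemann !ddE (D_christoffel_lr _ _ _ _ Up) add0r nframe_r.
rewrite (eq_derive_open _ oU Up (fun q Uq => christoffel_lll d a c Uq)).
rewrite big1 ?addr0// => e _; rewrite christoffel_lr// mul0r subr0.
rewrite -(splitK e); case: (fintype.split e) => i /=.
  by rewrite christoffel_lr// mulr0.
by rewrite [christoffel g (lshift n d) _ _ _]christoffelC christoffel_lr// mul0r.
Qed.

Lemma riemann_rrrl d c a b p : U p ->
  riemann g (rshift n d) (rshift n c) (rshift n b) (lshift n a) p
  = - 'DD_(Xf R a) (Gbar d b c) p.
Proof.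
move=> Up; rewrite /riemann !ddE (D_christoffel_rl _ _ _ _ Up) add0r nframe_l.
rewrite (eq_derive_open _ oU Up (fun q Uq => christoffel_rrr d b c Uq)).
rewrite big1 ?addr0// => e _; rewrite christoffel_rl// mul0r subr0.
rewrite -(splitK e); case: (fintype.split e) => i /=.
  by rewrite [christoffel g (rshift n d) _ _ _]christoffelC christoffel_rl// mul0r.
by rewrite christoffel_rl// mulr0.
Qed.

(** The trace of [Gam] is the logarithmic [xi]-derivative of [det h] (see [DX_det]), so this is the
    Kähler formula for the Ricci tensor as minus the mixed second derivatives of [log det h],
    written without a logarithm. *)
Lemma ricci_rl i j p : U p ->
  ricci g (rshift n j) (lshift n i) p = - 'DD_(Yf R j) (fun q => \sum_k Gam k k i q) p.
Proof.
move=> Up; rewrite /ricci big_split_ord /= [X in _ + X]big1 => [|k _]; last exact: riemann_rl.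
rewrite addr0 dvl_sum => [|k _]; last exact: (smooth_dfl (smooth_Gam _ _ _) Up).
by rewrite -sumrN; apply: eq_bigr => k _; exact: riemann_lllr.
Qed.
End Curvature.
End Metric.

(** * Toric potentials *)

Section Omega.
Variables (R : realType) (n : nat).
Implicit Types (phi : Dn R n -> R) (p q v w : Dn R n) (i j k : 'I_n).

Lemma dvl_pair (f1 f2 : Dn R n -> R) v p :
  differentiable f1 p -> differentiable f2 p ->
  'DD_v (fun q => (f1 q, f2 q) : pc R) p = ('DD_v f1 p, 'DD_v f2 p).
Proof.
move=> d1 d2; rewrite -!ddE !deriveE//; last exact: differentiable_pair.
by rewrite (@diff_pair _ _ _ _ f1 f2).
Qed.

Lemma xi_slot i d k : xi (slot i d) k = (i == k)%:R * (d.1 - d.2) :> R.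
Proof. by rewrite /xi !mxE eq_sym; case: eqP => _ /=; ring. Qed.
Lemma eta_slot i d k : eta (slot i d) k = (i == k)%:R * (d.1 + d.2) :> R.
Proof. by rewrite /eta !mxE eq_sym; case: eqP => _ /=; ring. Qed.

Lemma slot1E i : slot i (1 : pc R) = 1 *: Xf R i + Yf R i.
Proof.
apply: eq_null => k; rewrite ?xiD ?etaD ?xiZ ?etaZ.
  by rewrite xi_X xi_Y xi_slot /=; ring.
by rewrite eta_X eta_Y eta_slot /=; ring.
Qed.

Lemma slot_tauE i : slot i (tau R) = (-1) *: Xf R i + Yf R i.
Proof.
apply: eq_null => k; rewrite ?xiD ?etaD ?xiZ ?etaZ.
  by rewrite xi_X xi_Y xi_slot /=; ring.
by rewrite eta_X eta_Y eta_slot /=; ring.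
Qed.

Section OmegaE.
Variables (U : set (Dn R n)) (phi : Dn R n -> R).
Hypotheses (oU : open U) (sphi : smooth_on U phi).

Lemma dzbarE j q : U q -> dzbar j (fun z => pc_of_real (phi z)) q =
  (2^-1 * ('DD_(Xf R j) phi q + 'DD_(Yf R j) phi q),
   2^-1 * ('DD_(Xf R j) phi q - 'DD_(Yf R j) phi q)).
Proof.
move=> Uq; have dphi := smooth_dfl sphi Uq.
have E v : 'D_v (fun z => pc_of_real (phi z)) q = ('DD_v phi q, 0).
  by rewrite ddE (dvl_pair _ dphi (dfl_cst _ _)) dvl_cst.
rewrite /dzbar !E slot1E slot_tauE !(dvl_lin _ _ _ dphi).
by congr pair; rewrite /= /GRing.scale /=; ring.
Qed.

Lemma dz_dzbarE i j p : U p ->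
  dz i (dzbar j (fun z => pc_of_real (phi z))) p =
  (2^-1 * (hess phi i j p + hess phi j i p),
   2^-1 * (hess phi j i p - hess phi i j p)).
Proof.
move=> Up.
have sX := smooth_drv (Xf R j) sphi; have sY := smooth_drv (Yf R j) sphi.
have s1 : smooth_on U (fun q => 2^-1 * ('DD_(Xf R j) phi q + 'DD_(Yf R j) phi q)).
  by apply: smoothM => //; [exact: smooth_cst|exact: smoothD].
have s2 : smooth_on U (fun q => 2^-1 * ('DD_(Xf R j) phi q - 'DD_(Yf R j) phi q)).
  by apply: smoothM => //; [exact: smooth_cst|exact: smoothB].
have d1 := smooth_dfl s1 Up; have d2 := smooth_dfl s2 Up.
have dX := smooth_dfl sX Up; have dY := smooth_dfl sY Up.
have E v : 'D_v (dzbar j (fun z => pc_of_real (phi z))) p =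
  (2^-1 * ('DD_v ('DD_(Xf R j) phi) p + 'DD_v ('DD_(Yf R j) phi) p),
   2^-1 * ('DD_v ('DD_(Xf R j) phi) p - 'DD_v ('DD_(Yf R j) phi) p)).
  rewrite ddE (eq_derive_open _ oU Up (fun q Uq => dzbarE j Uq)).
  rewrite (dvl_pair _ d1 d2) (dvlZ _ _ (dflD dX dY)) (dvlZ _ _ (dflB dX dY)).
  by rewrite (dvlD _ dX dY) (dvlB _ dX dY).
rewrite /dz !E slot1E slot_tauE !(dvl_lin _ _ _ dX) !(dvl_lin _ _ _ dY).
rewrite (hessC oU sphi j i Up) (hessE phi i j).
by congr pair; rewrite /= /GRing.scale /=; field.
Qed.

Lemma pc_sum (I : finType) (a b : I -> R) :
  \sum_i ((a i, b i) : pc R) = (\sum_i a i, \sum_i b i).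
Proof. by elim/big_ind3: _ => [//|x1 x2 x3 y1 y2 y3 -> ->|//]. Qed.

Definition skew_hess p v w : R := \sum_i \sum_j hess phi i j p *
  (xi v i * eta w j - xi w i * eta v j).

Lemma omegaE p v w : U p -> omega phi p v w = pc_of_real (- 2^-1 * skew_hess p v w).
Proof.
move=> Up; rewrite /omega.
pose A i j := xi v i * eta w j - xi w i * eta v j.
pose h i j := hess phi i j p.
rewrite (eq_bigr (fun i => (\sum_j 2^-1 * (h i j * A i j - h j i * A j i),
   \sum_j - (2^-1 * (h i j * A i j + h j i * A j i))))) => [|i _]; last first.
  rewrite -pc_sum; apply: eq_bigr => j _; rewrite dz_dzbarE//.
  rewrite /A /h /xi /eta /conj_pc /=.
  by congr pair; rewrite /=; field.
have E : \sum_i \sum_j h j i * A j i = skew_hess p v w.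
  by rewrite exchange_big.
(* The first component is antisymmetric under exchanging [i] and [j] and cancels; the factor [tau]
   in [omega] then moves the second component to the real line. *)
have S1 : \sum_i \sum_j 2^-1 * (h i j * A i j - h j i * A j i) = 0.
  under eq_bigr do rewrite -mulr_sumr sumrB.
  by rewrite -mulr_sumr sumrB E subrr mulr0.
have S2 : \sum_i \sum_j - (2^-1 * (h i j * A i j + h j i * A j i)) =
    - skew_hess p v w.
  under eq_bigr do rewrite sumrN -mulr_sumr big_split /=.
  rewrite sumrN -mulr_sumr big_split /= E.
  by rewrite -[X in X + _]/(skew_hess p v w); field.
rewrite pc_sum S1 S2; congr pair; rewrite /= /GRing.scale /=; ring.
Qed.
End OmegaE.

(** A left null vector [x] of [h] would put the vector with [xi = x] and [eta = 0] into the kernel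
    of [omega]. *)
Lemma para_Kahler_unit (U : set (Dn R n)) phi p : para_Kahler U phi -> U p ->
  hessmx phi p \in unitmx.
Proof.
move=> [oU sphi [_ nd]] Up; rewrite unitmxE unitfE; apply/negP => /det0P[x x0 xh].
have v0 : pt x 0 = 0.
  apply: (nd p) => // w; rewrite (omegaE oU sphi)// /skew_hess.
  rewrite exchange_big big1 ?mulr0// => j _ /=.
  have := congr1 (fun M : 'rV[R]_n => M 0 j) xh; rewrite !mxE => E.
  transitivity ((\sum_i x 0 i * hessmx phi p i j) * eta w j); last by rewrite E mul0r.
  rewrite mulr_suml; apply: eq_bigr => i _.
  by rewrite xi_pt eta_pt !mxE mulr0 subr0 mulrA [hess _ _ _ _ * _]mulrC.
move/eqP: x0; apply; apply/rowP => i.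
by rewrite -(xi_pt x 0 i) v0 xi0 mxE.
Qed.
End Omega.

Section Toric.
Variables (R : realType) (n : nat).
Implicit Types (p q v w z : Dn R n) (i j k m : 'I_n).

Definition tz z : 'rV[R]_n := \row_i abs2 (Defs.pcomp z i).
Definition ev k : 'rV[R]_n := delta_mx 0 k.

Lemma tzE z i : tz z 0 i = xi z i * eta z i.
Proof. by rewrite mxE abs2_null. Qed.

Lemma row_sum_ev (x : 'rV[R]_n) : x = \sum_k x 0 k *: ev k.
Proof. by rewrite [LHS]row_sum_delta. Qed.

Lemma dfl_tz z : differentiable tz z.
Proof.
have -> : tz = \sum_k (fun z => (xi z k * eta z k) *: ev k).
  apply/funext => q; rewrite fct_sumE [LHS]row_sum_ev.
  by apply: eq_bigr => k _; rewrite tzE.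
apply: differentiable_sum => k; apply: differentiableZl.
by apply: dflM; [exact: dfl_xi|exact: dfl_eta].
Qed.

Lemma dvl_tz v z k : ('DD_v tz z) 0 k = xi v k * eta z k + xi z k * eta v k.
Proof.
have dc (q : 'rV[R]_n) : differentiable (fun x : 'rV[R]_n => x 0 k : R) q.
  exact: differentiable_coord.
have L : linear (fun x : 'rV[R]_n => x 0 k : R) by move=> a x y; rewrite !mxE.
rewrite -(dvl_linear ('DD_v tz z) (tz z) L).
rewrite -(dvl_chain v (dfl_tz z) (dc (tz z))).
under eq_fun do rewrite tzE.
by rewrite (dvlM _ (dfl_xi _ _) (dfl_eta _ _)) dvl_xi dvl_eta.
Qed.

Lemma dvl_toric (Psi : 'rV[R]_n -> R) v z : differentiable Psi (tz z) ->
  'DD_v (fun z => Psi (tz z)) z =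
  \sum_k (xi v k * eta z k + xi z k * eta v k) * 'DD_(ev k) Psi (tz z).
Proof.
move=> dPsi; rewrite (dvl_chain v (dfl_tz z) dPsi) [X in dd _ X](row_sum_ev).
by rewrite (dvl_sumv _ _ dPsi); apply: eq_bigr => k _; rewrite dvl_tz.
Qed.

Lemma sum_delta_l (f : 'I_n -> R) i : \sum_j (i == j)%:R * f j = f i.
Proof.
by rewrite -[RHS](sum_delta f); apply: eq_bigr => j _; rewrite mulrC eq_sym.
Qed.

Lemma dX_toric (Psi : 'rV[R]_n -> R) i z : differentiable Psi (tz z) ->
  'DD_(Xf R i) (fun z => Psi (tz z)) z = eta z i * 'DD_(ev i) Psi (tz z).
Proof.
move=> dPsi; rewrite (dvl_toric _ dPsi) -(sum_delta_l (fun k => eta z k * 'DD_(ev k) Psi (tz z)) i).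
by apply: eq_bigr => k _; rewrite xi_X eta_X mulr0 addr0 mulrA.
Qed.

Lemma dY_toric (Psi : 'rV[R]_n -> R) i z : differentiable Psi (tz z) ->
  'DD_(Yf R i) (fun z => Psi (tz z)) z = xi z i * 'DD_(ev i) Psi (tz z).
Proof.
move=> dPsi; rewrite (dvl_toric _ dPsi) -(sum_delta_l (fun k => xi z k * 'DD_(ev k) Psi (tz z)) i).
by apply: eq_bigr => k _; rewrite xi_Y eta_Y mul0r add0r mulrCA mulrA.
Qed.

Section ToricPotential.
Variables (U : set (Dn R n)) (phi : Dn R n -> R).
Variables (Omega : set 'rV[R]_n) (Phi : 'rV[R]_n -> R).
Hypotheses (oU : open U) (sphi : smooth_on U phi).
Hypotheses (oOm : open Omega) (sPhi : smooth_on Omega Phi).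
Hypothesis phiE : forall z, U z -> Omega (tz z) /\ phi z = Phi (tz z).

Lemma DX_phi i z : U z -> 'DD_(Xf R i) phi z = eta z i * 'DD_(ev i) Phi (tz z).
Proof.
move=> Uz; rewrite (eq_derive_open _ oU Uz (fun z Uz => (phiE Uz).2)).
exact: dX_toric (smooth_dfl sPhi (phiE Uz).1).
Qed.

Lemma DY_phi i z : U z -> 'DD_(Yf R i) phi z = xi z i * 'DD_(ev i) Phi (tz z).
Proof.
move=> Uz; rewrite (eq_derive_open _ oU Uz (fun z Uz => (phiE Uz).2)).
exact: dY_toric (smooth_dfl sPhi (phiE Uz).1).
Qed.

Lemma hess_toric i j z : U z -> hess phi i j z =
  (i == j)%:R * 'DD_(ev j) Phi (tz z)
  + xi z j * (eta z i * 'DD_(ev i) ('DD_(ev j) Phi) (tz z)).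
Proof.
move=> Uz; rewrite hessE (eq_derive_open _ oU Uz (fun z Uz => DY_phi j Uz)).
have dPj := smooth_dfl (smooth_drv (ev j) sPhi) (phiE Uz).1.
have dc : differentiable (fun z => 'DD_(ev j) Phi (tz z)) z.
  exact: (differentiable_comp (dfl_tz z) dPj).
by rewrite (dvlM _ (dfl_xi j z) dc) dvl_xi xi_X (dX_toric _ dPj).
Qed.

(** On [eta = 0] all the products [xi_k eta_k] vanish, whatever [xi] is. These values of [h], and
    those on [xi = 0], are the initial data for the uniqueness arguments below. *)
Lemma hess_toric_eta0 i j z : U z -> (forall k, eta z k = 0) ->
  hess phi i j z = (i == j)%:R * 'DD_(ev j) Phi 0.
Proof.
move=> Uz z0; rewrite (hess_toric _ _ Uz) z0 mul0r mulr0 addr0.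
by congr (_ * 'DD__ Phi _); apply/rowP => k; rewrite tzE z0 mulr0 mxE.
Qed.

Lemma hess_toric_xi0 i j z : U z -> (forall k, xi z k = 0) ->
  hess phi i j z = (i == j)%:R * 'DD_(ev j) Phi 0.
Proof.
move=> Uz z0; rewrite (hess_toric _ _ Uz) z0 mul0r addr0.
by congr (_ * 'DD__ Phi _); apply/rowP => k; rewrite tzE z0 mul0r mxE.
Qed.

(* [euler m f = (deg f) f] when [f] is homogeneous for the action
   [xi_m -> a xi_m], [eta_m -> a^-1 eta_m] of the torus. *)
Definition euler m (f : Dn R n -> R) z : R :=
  xi z m * 'DD_(Xf R m) f z - eta z m * 'DD_(Yf R m) f z.

Definition weight (c : 'I_n -> R) (f : Dn R n -> R) : Prop :=
  forall m z, U z -> euler m f z = c m * f z.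

Lemma weight_phi : weight (fun _ => 0) phi.
Proof. by move=> m z Uz; rewrite /euler DX_phi// DY_phi//; ring. Qed.

(** Euler's identity is differentiated along [Xf R i]; the derivative of the coefficient [xi z m]
    accounts for the drop of the degree when [i = m]. *)
Lemma weight_DX c f i : smooth_on U f -> weight c f ->
  weight (fun m => c m - (i == m)%:R) ('DD_(Xf R i) f).
Proof.
move=> sf wf m z Uz.
have sX := smooth_drv (Xf R m) sf; have sY := smooth_drv (Yf R m) sf.
have dX := smooth_dfl sX Uz; have dY := smooth_dfl sY Uz.
have := eq_derive_open (Xf R i) oU Uz (wf m).
rewrite (dvlZ _ _ (smooth_dfl sf Uz)).
rewrite (dvlB _ (dflM (dfl_xi m z) dX) (dflM (dfl_eta m z) dY)).
rewrite (dvlM _ (dfl_xi m z) dX) (dvlM _ (dfl_eta m z) dY) dvl_xi dvl_eta.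
rewrite xi_X eta_X (schwarz _ _ oU sf Uz) [X in _ - X](_ : _ =
  eta z m * 'DD_(Yf R m) ('DD_(Xf R i) f) z); last first.
  by rewrite mul0r add0r (schwarz _ _ oU sf Uz).
move=> E; rewrite /= mulrBl -E /euler; case: eqP => [->|_] /=; ring.
Qed.

Lemma weight_DY c f j : smooth_on U f -> weight c f ->
  weight (fun m => c m + (j == m)%:R) ('DD_(Yf R j) f).
Proof.
move=> sf wf m z Uz.
have sX := smooth_drv (Xf R m) sf; have sY := smooth_drv (Yf R m) sf.
have dX := smooth_dfl sX Uz; have dY := smooth_dfl sY Uz.
have := eq_derive_open (Yf R j) oU Uz (wf m).
rewrite (dvlZ _ _ (smooth_dfl sf Uz)).
rewrite (dvlB _ (dflM (dfl_xi m z) dX) (dflM (dfl_eta m z) dY)).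
rewrite (dvlM _ (dfl_xi m z) dX) (dvlM _ (dfl_eta m z) dY) dvl_xi dvl_eta.
rewrite xi_Y eta_Y (schwarz (Yf R j) (Xf R m) oU sf Uz).
rewrite (schwarz (Yf R j) (Yf R m) oU sf Uz).
move=> E; rewrite /= mulrDl -E /euler; case: eqP => [->|_] /=; ring.
Qed.

Lemma weight_hess i j :
  weight (fun m => (j == m)%:R - (i == m)%:R) (hess phi i j).
Proof.
rewrite hessE => m z Uz.
have wY := weight_DY j sphi weight_phi.
by rewrite (weight_DX i (smooth_drv _ sphi) wY m Uz) add0r.
Qed.
End ToricPotential.
End Toric.

(** * Flat toric metrics *)

Lemma poly_eq0_near (R : realFieldType) (p : {poly R}) (e : R) : 0 < e ->
  (forall x, 0 < x < e -> p.[x] = 0) -> p = 0.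
Proof.
move=> e0 p0; pose r k : R := e / (k%:R + 2).
have r_in k : 0 < r k < e.
  have k2 : (1 : R) < k%:R + 2 by rewrite -[ltLHS]add0r ler_ltD ?ltr1n.
  have k0 : 0 < k%:R + 2 :> R by exact: lt_trans k2.
  by apply/andP; split; rewrite /r ?divr_gt0// ltr_pdivrMr// ltr_pMr.
apply: (@roots_geq_poly_eq0 _ p [seq r k | k <- iota 0 (size p)]).
- by apply/allP => _ /mapP[k _ ->]; apply/eqP; exact: p0.
- rewrite map_inj_uniq ?iota_uniq// => k l; rewrite /r => /(mulfI (lt0r_neq0 e0)).
  by move=> /invr_inj /addIr /eqP; rewrite eqr_nat => /eqP.
- by rewrite size_map size_iota.
Qed.

Lemma quadratic_form_eq0 (R : realFieldType) n (M : 'I_n -> 'I_n -> R) :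
  (forall a c, M a c = M c a) ->
  (forall x : 'I_n -> R, \sum_a \sum_c M a c * (x a * x c) = 0) ->
  forall a c, M a c = 0.
Proof.
move=> sM qM a c.
have dl (f : 'I_n -> R) i : \sum_j f j * (j == i)%:R = f i.
  rewrite (bigD1 i)//= eqxx mulr1 big1 ?addr0// => j ji.
  by rewrite (negbTE ji) mulr0.
have bil (b d : 'I_n) : \sum_i \sum_j M i j * ((i == b)%:R * (j == d)%:R) = M b d.
  under eq_bigr do (under eq_bigr do rewrite [X in _ * X]mulrC mulrA; rewrite -mulr_suml dl).
  exact: dl.
have Maa b : M b b = 0 by rewrite -(bil b b); exact: (qM (fun i => (i == b)%:R)).
have := qM (fun i => (i == a)%:R + (i == c)%:R).
have -> : \sum_i \sum_j M i j * (((i == a)%:R + (i == c)%:R) * ((j == a)%:R + (j == c)%:R))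
  = M a a + M a c + (M c a + M c c).
  rewrite -!bil -!big_split; apply: eq_bigr => i _.
  by rewrite -!big_split; apply: eq_bigr => j _ /=; ring.
by rewrite !Maa addr0 add0r (sM c a) => ?; lra.
Qed.

(** * The curvature tensor of a flat metric vanishes *)

Section FlatCurvature.
Variables (R : realType) (n : nat) (U : set (Dn R n)) (phi : Dn R n -> R).
Implicit Types (p q v w : Dn R n) (i j k : 'I_n).
Hypotheses (oU : open U) (sphi : smooth_on U phi).
Hypothesis uh : forall q, U q -> hessmx phi q \in unitmx.

Let sh := smooth_hess (phi := phi) sphi.

(** Up to a constant factor, the curvature with all indices lowered, by the Kähler formula: second
    derivatives of [h] minus [(d_xi h) h^-1 (d_eta h)]. The next two lemmas obtain it from [Gam] and
    from [Gbar]. *)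
Definition Rm a b c f p : R := 'DD_(Yf R b) ('DD_(Xf R a) (hess phi c f)) p
  - \sum_d Gam phi d a c p * 'DD_(Yf R b) (hess phi d f) p.

Lemma DGam_hess a b c f p : U p ->
  \sum_d 'DD_(Yf R b) (Gam phi d a c) p * hess phi d f p = Rm a b c f p.
Proof.
move=> Up; have dG d := smooth_dfl (smooth_Gam oU sphi uh d a c) Up.
have dh d := smooth_dfl (sh d f) Up.
have := eq_derive_open (Yf R b) oU Up (fun q Uq => Gam_hess uh a c f Uq).
rewrite dvl_sum => [|d _]; last exact: dflM (dG d) (dh d).
under eq_bigr => d _ do rewrite (dvlM _ (dG d) (dh d)).
by rewrite big_split /= => E; rewrite /Rm -E addrK.
Qed.

Lemma DGbar_hess a b c f p : U p ->
  \sum_d 'DD_(Xf R a) (Gbar phi d b c) p * hess phi f d p = Rm a b f c p.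
Proof.
move=> Up; have dG d := smooth_dfl (smooth_Gbar oU sphi uh d b c) Up.
have dh d := smooth_dfl (sh f d) Up.
have := eq_derive_open (Xf R a) oU Up (fun q Uq => hess_Gbar uh b c f Uq).
rewrite dvl_sum => [|d _]; last exact: dflM (dh d) (dG d).
under eq_bigr => d _ do rewrite (dvlM _ (dh d) (dG d)).
rewrite big_split /= (schwarz _ _ oU (sh f c) Up) => E.
rewrite /Rm -E [X in X + _ - _](_ : _ =
    \sum_d Gam phi d a f p * 'DD_(Yf R b) (hess phi d c) p).
  by rewrite addrAC subrr add0r; apply: eq_bigr => d _; rewrite mulrC.
rewrite /Gbar /Gam; under eq_bigr do rewrite mulr_sumr.
under [RHS]eq_bigr do rewrite mulr_suml.
rewrite exchange_big; apply: eq_bigr => d _; apply: eq_bigr => e _ /=.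
by rewrite mulrA.
Qed.

Lemma GamC d a c p : U p -> Gam phi d a c p = Gam phi d c a p.
Proof. by move=> Up; apply: eq_bigr => f _; rewrite (DX_hessC oU sphi a c f Up). Qed.

Lemma Rm_sym1 a b c f p : U p -> Rm a b c f p = Rm c b a f p.
Proof.
move=> Up; rewrite /Rm.
rewrite (eq_derive_open _ oU Up (fun q Uq => DX_hessC oU sphi a c f Uq)).
by congr (_ - _); apply: eq_bigr => d _; rewrite GamC.
Qed.

Lemma Rm_sym2 a b c f p : U p -> Rm a b c f p = Rm a f c b p.
Proof.
move=> Up; rewrite /Rm !(schwarz (Yf R _) _ oU (sh c _) Up).
rewrite (eq_derive_open _ oU Up (fun q Uq => DY_hessC oU sphi b c f Uq)).
by congr (_ - _); apply: eq_bigr => d _; rewrite (DY_hessC oU sphi b d f Up).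
Qed.

Lemma xi_J v i : xi (Jmul v) i = - xi v i.
Proof. by rewrite /xi !mxE /=; ring. Qed.
Lemma eta_J v i : eta (Jmul v) i = eta v i.
Proof. by rewrite /eta !mxE /=; ring. Qed.

(** [Jmul] changes the sign of [xi] and keeps [eta], so the bivector of [v] and [Jmul v] has no pure
    components and twice the mixed one. *)
Lemma J_skew_sum (S : 'I_(n + n) -> 'I_(n + n) -> R) v :
  (forall a b, S a b = - S b a) ->
  \sum_a \sum_b ncoord v a * ncoord (Jmul v) b * S a b =
  2 * \sum_a \sum_b xi v a * eta v b * S (lshift n a) (rshift n b).
Proof.
move=> SN.
have skew0 (x : 'I_n -> R) (s : 'I_n -> 'I_(n + n)) :
    \sum_a \sum_b x a * x b * S (s a) (s b) = 0.
  set L := LHS; suff : L = - L by move=> ?; lra.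
  rewrite /L [LHS]exchange_big /= -sumrN; apply: eq_bigr => a _; rewrite -sumrN.
  by apply: eq_bigr => b _; rewrite (SN (s b)); ring.
have E a : \sum_b ncoord v a * ncoord (Jmul v) b * S a b =
  - (\sum_b ncoord v a * xi v b * S a (lshift n b))
  + \sum_b ncoord v a * eta v b * S a (rshift n b).
  rewrite big_split_ord /= -sumrN; congr (_ + _); apply: eq_bigr => b _.
    by rewrite ncoord_l xi_J; ring.
  by rewrite ncoord_r eta_J.
rewrite (eq_bigr _ (fun a _ => E a)) big_split /= sumrN !big_split_ord /=.
rewrite [X in - (X + _)](_ : _ = 0); last first.
  apply: etrans (skew0 (xi v) (lshift n)).
  by apply: eq_bigr => a _; apply: eq_bigr => b _; rewrite ncoord_l.
rewrite [X in _ + (_ + X)](_ : _ = 0); last first.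
  apply: etrans (skew0 (eta v) (@rshift n n)).
  by apply: eq_bigr => a _; apply: eq_bigr => b _; rewrite ncoord_r.
rewrite add0r addr0 mulr_natl mulr2n; congr (_ + _).
  rewrite exchange_big -sumrN; apply: eq_bigr => a _; rewrite -sumrN.
  by apply: eq_bigr => b _; rewrite ncoord_r SN; ring.
by apply: eq_bigr => a _; apply: eq_bigr => b _; rewrite ncoord_l.
Qed.

Lemma J_contraction (r G : 'I_(n + n) -> 'I_(n + n) -> R) v :
  (forall d c, r (lshift n d) (rshift n c) = 0) ->
  (forall d c, r (rshift n d) (lshift n c) = 0) ->
  (forall d f, G (lshift n d) (lshift n f) = 0) ->
  (forall d f, G (rshift n d) (rshift n f) = 0) ->
  \sum_c \sum_d \sum_f ncoord (Jmul v) c * ncoord v f * r d c * G d f =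
  \sum_c \sum_f xi v c * eta v f *
    (\sum_d r (rshift n d) (rshift n f) * G (rshift n d) (lshift n c)
     - \sum_d r (lshift n d) (lshift n c) * G (lshift n d) (rshift n f)).
Proof.
move=> rlr rrl Gll Grr.
have El c : \sum_d \sum_f ncoord (Jmul v) (lshift n c) * ncoord v f * r d (lshift n c) * G d f
  = \sum_f xi v c * eta v f *
     (- \sum_d r (lshift n d) (lshift n c) * G (lshift n d) (rshift n f)).
  rewrite big_split_ord /= [X in _ + X]big1 => [|d _]; last first.
    by rewrite big1// => f _; rewrite rrl mulr0 mul0r.
  rewrite addr0; under eq_bigr do rewrite big_split_ord /=.
  rewrite big_split /= [X in X + _]big1 => [|d _]; last first.
    by rewrite big1// => f _; rewrite Gll mulr0.
  rewrite add0r exchange_big; apply: eq_bigr => f _ /=; rewrite -sumrN mulr_sumr.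
  by apply: eq_bigr => d _; rewrite ncoord_l ncoord_r xi_J; ring.
have Er c : \sum_d \sum_f ncoord (Jmul v) (rshift n c) * ncoord v f * r d (rshift n c) * G d f
  = \sum_f xi v f * eta v c *
     (\sum_d r (rshift n d) (rshift n c) * G (rshift n d) (lshift n f)).
  rewrite big_split_ord /= [X in X + _]big1 => [|d _]; last first.
    by rewrite big1// => f _; rewrite rlr mulr0 mul0r.
  rewrite add0r; under eq_bigr do rewrite big_split_ord /=.
  rewrite big_split /= [X in _ + X]big1 => [|d _]; last first.
    by rewrite big1// => f _; rewrite Grr mulr0.
  rewrite addr0 exchange_big; apply: eq_bigr => f _ /=; rewrite mulr_sumr.
  by apply: eq_bigr => d _; rewrite ncoord_l ncoord_r eta_J; ring.
rewrite big_split_ord /= (eq_bigr _ (fun c _ => El c)) (eq_bigr _ (fun c _ => Er c)).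
rewrite addrC [X in X + _]exchange_big -big_split; apply: eq_bigr => c _ /=.
rewrite -big_split; apply: eq_bigr => f _ /=; ring.
Qed.

Let g := metric phi.

Lemma curvature4_J p v : U p -> curvature4 g p v (Jmul v) (Jmul v) v =
  2 * \sum_a \sum_b \sum_c \sum_f
    xi v a * eta v b * (xi v c * eta v f) * Rm a b c f p.
Proof.
move=> Up; pose S a b := \sum_c \sum_d \sum_f ncoord (Jmul v) c * ncoord v f *
  riemann g d c a b p * gram g p d f.
have -> : curvature4 g p v (Jmul v) (Jmul v) v =
    \sum_a \sum_b ncoord v a * ncoord (Jmul v) b * S a b.
  apply: eq_bigr => a _; apply: eq_bigr => b _; rewrite /S mulr_sumr.
  apply: eq_bigr => c _; rewrite mulr_sumr; apply: eq_bigr => d _; rewrite mulr_sumr.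
  by apply: eq_bigr => f _; rewrite !mulrA.
have SN a b : S a b = - S b a.
  rewrite /S -sumrN; apply: eq_bigr => c _; rewrite -sumrN; apply: eq_bigr => d _.
  by rewrite -sumrN; apply: eq_bigr => f _; rewrite riemannN mulrN mulNr.
have SE a b : S (lshift n a) (rshift n b) =
    \sum_c \sum_f xi v c * eta v f * Rm a b c f p.
  rewrite /S (J_contraction (r := fun d c => riemann g d c (lshift n a) (rshift n b) p)
    (G := fun d f => gram g p d f)); first last.
  - by move=> d f; exact: gram_rr.
  - by move=> d f; exact: gram_ll.
  - by move=> d c; exact: (riemann_rl oU sphi uh).
  - by move=> d c; exact: (riemann_lr oU sphi uh).
  apply: eq_bigr => c _; apply: eq_bigr => f _; congr (_ * _).
  under eq_bigr => d _ do
    rewrite riemannN (riemann_rrrl oU sphi uh d f a b Up) opprK gram_rl mulrCA.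
  under [X in _ - X]eq_bigr => d _ do
    rewrite (riemann_lllr oU sphi uh d c a b Up) gram_lr mulrCA mulNr mulrN.
  rewrite -!mulr_sumr sumrN -mulr_sumr.
  by rewrite (DGam_hess a b c f Up) (DGbar_hess a b f c Up); field.
move: S SE SN => S SE SN; rewrite (J_skew_sum _ SN); congr (_ * _).
apply: eq_bigr => a _; apply: eq_bigr => b _; rewrite SE mulr_sumr.
apply: eq_bigr => c _; rewrite mulr_sumr; apply: eq_bigr => f _; rewrite !mulrA //.
Qed.

Lemma metricJ p v : metric phi p (Jmul v) (Jmul v) = - metric phi p v v.
Proof.
rewrite !metricE -sumrN; apply: eq_bigr => i _; rewrite -sumrN.
by apply: eq_bigr => j _; rewrite !xi_J !eta_J; field.
Qed.

Lemma metric_J p v : metric phi p v (Jmul v) = 0.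
Proof.
rewrite !metricE big1// => i _; rewrite big1// => j _.
by rewrite !xi_J !eta_J; field.
Qed.

Lemma flat_quartic p v : flat U phi -> U p -> metric phi p v v != 0 ->
  \sum_a \sum_b \sum_c \sum_f
    xi v a * eta v b * (xi v c * eta v f) * Rm a b c f p = 0.
Proof.
move=> fl Up g0; have := fl p v Up g0; rewrite /sectional curvature4_J//.
rewrite metricJ metric_J expr0n subr0 => /eqP.
have d0 : metric phi p v v * - metric phi p v v != 0.
  by rewrite mulrN oppr_eq0 mulf_neq0.
by rewrite mulf_eq0 invr_eq0 (negbTE d0) orbF mulf_eq0 pnatr_eq0 /= => /eqP.
Qed.

(** Flatness kills the quartic form [Q] only where [G], the value of [g(v, v)], is nonzero. On a
    line in the direction [(x1, y1)] with [G x1 y1 != 0] both become polynomials whose product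
    vanishes, and [GP] is nonzero because its leading coefficient is [G x1 y1]. Hence [Q] vanishes
    identically. *)
Lemma flat_Rm a b c f p : flat U phi -> U p -> Rm a b c f p = 0.
Proof.
move=> fl Up.
pose Q (x y : 'I_n -> R) := \sum_a \sum_b \sum_c \sum_f
    x a * y b * (x c * y f) * Rm a b c f p.
pose G (x y : 'I_n -> R) := \sum_i \sum_j hess phi i j p * (x i * y j).
have GQ x y : G x y != 0 -> Q x y = 0.
  move=> G0; pose v := pt (\row_i x i) (\row_i y i).
  have := @flat_quartic p v fl Up; rewrite metricE.
  have -> : \sum_i \sum_j hess phi i j p * ((xi v i * eta v j + xi v i * eta v j) / 2)
    = G x y.
    apply: eq_bigr => i _; apply: eq_bigr => j _.
    by rewrite xi_pt eta_pt !mxE; field.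
  move=> /(_ G0) <-; apply: eq_bigr => i _; apply: eq_bigr => j _.
  by apply: eq_bigr => k _; apply: eq_bigr => l _; rewrite !xi_pt !eta_pt !mxE.
have [x1 [y1 G1]] : exists x y, G x y != 0.
  apply: contrapT => G0; have h0 : hessmx phi p = 0.
    apply/matrixP => i j; rewrite !mxE; apply/eqP/negPn/negP => hij; apply: G0.
    exists (fun k => (i == k)%:R), (fun k => (j == k)%:R).
    suff -> : G (fun k => (i == k)%:R) (fun k => (j == k)%:R) = hess phi i j p by [].
    rewrite /G -[RHS](sum_delta_l (fun i => hess phi i j p)); apply: eq_bigr => k _.
    rewrite -[hess phi k j p](sum_delta_l (fun j => hess phi k j p)) mulr_sumr.
    by apply: eq_bigr => l _; ring.
  have := mulmxV (uh Up); rewrite h0 mul0mx => /matrixP/(_ a a)/eqP.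
  by rewrite !mxE eqxx eq_sym oner_eq0.
have Q0 x y : Q x y = 0.
  pose xp i : {poly R} := (x i)%:P + x1 i *: 'X.
  pose yp i : {poly R} := (y i)%:P + y1 i *: 'X.
  pose QP := \sum_a \sum_b \sum_c \sum_f
    xp a * yp b * (xp c * yp f) * (Rm a b c f p)%:P.
  pose GP := \sum_i \sum_j (hess phi i j p)%:P * (xp i * yp j).
  have xpE s i : (xp i).[s] = x i + x1 i * s by rewrite !hornerE.
  have ypE s i : (yp i).[s] = y i + y1 i * s by rewrite !hornerE.
  have QE s : QP.[s] = Q (fun i => x i + x1 i * s) (fun i => y i + y1 i * s).
    rewrite horner_sum; apply: eq_bigr => i _; rewrite horner_sum; apply: eq_bigr => j _.
    rewrite horner_sum; apply: eq_bigr => k _; rewrite horner_sum; apply: eq_bigr => l _.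
    by rewrite !hornerM !xpE !ypE hornerC.
  have GE s : GP.[s] = G (fun i => x i + x1 i * s) (fun i => y i + y1 i * s).
    rewrite horner_sum; apply: eq_bigr => i _; rewrite horner_sum; apply: eq_bigr => j _.
    by rewrite !hornerM !xpE !ypE hornerC.
  have : QP * GP = 0.
    apply: (@poly_eq0_near _ _ 1) => // s _; rewrite hornerM QE GE.
    have [->|/GQ ->] := eqVneq (G (fun i => x i + x1 i * s) (fun i => y i + y1 i * s)) 0.
      by rewrite mulr0.
    by rewrite mul0r.
  move=> /eqP; rewrite mulf_eq0 => /orP[/eqP QP0|/eqP GP0].
    have := QE 0; rewrite QP0 horner0 => ->.
    by congr Q; apply/funext => i; rewrite mulr0 addr0.
  (* the leading coefficient of GP is G x1 y1 *)
  case/eqP: G1; have : GP`_2 = 0 by rewrite GP0 coef0.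
  rewrite coef_sum => <-; apply: eq_bigr => i _; rewrite coef_sum; apply: eq_bigr => j _.
  rewrite coefCM; congr (_ * _).
  have -> : xp i * yp j = (x i * y j)%:P + (x i * y1 j + x1 i * y j)%:P * 'X
      + (x1 i * y1 j)%:P * 'X^2.
    by rewrite /xp /yp -!mul_polyC !polyCD !polyCM; ring.
  by rewrite !coefD !coefCM coefC coefX coefXn /=; ring.
(* Polarization one pair at a time: in [x] for fixed [y] by the symmetry in [a] and [c], then in [y]
   by the symmetry in [b] and [f]. *)
pose M y a c := \sum_b \sum_f Rm a b c f p * (y b * y f).
have M0 y a' c' : M y a' c' = 0.
  apply: quadratic_form_eq0 => [i k|x].
    by apply: eq_bigr => j _; apply: eq_bigr => l _; rewrite Rm_sym1.
  apply: etrans (Q0 x y); apply: eq_bigr => i _; rewrite exchange_big.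
  apply: eq_bigr => k _; rewrite /M mulr_suml; apply: eq_bigr => j _ /=.
  by rewrite mulr_suml; apply: eq_bigr => l _; ring.
apply: (quadratic_form_eq0 (M := fun b f => Rm a b c f p)) => [j l|y].
  exact: Rm_sym2.
exact: (M0 y a c).
Qed.
End FlatCurvature.

(** * Functions homogeneous under the torus action *)

Section HomogeneousFunctions.
Variables (R : realType) (n : nat) (U : set (Dn R n)).
Implicit Types (f : Dn R n -> R) (z : Dn R n) (i j k m : 'I_n).
Hypotheses (oU : open U) (cU : connected U) (U0 : U 0).

(* The zero set of a coordinate has empty interior; differentiating
   [xi_m f = 0] along [X_m] gives [f = 0] there. *)
Lemma xi_mul_eq0 m f : (forall z, U z -> differentiable f z) ->
  (forall z, U z -> xi z m * f z = 0) -> forall z, U z -> f z = 0.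
Proof.
move=> df f0 z Uz; have := eq_derive_open (Xf R m) oU Uz f0.
rewrite dvl_cst (dvlM _ (dfl_xi m z) (df z Uz)) dvl_xi xi_X eqxx mul1r => E.
have /eqP := f0 z Uz; rewrite mulf_eq0 => /orP[/eqP x0|/eqP//].
by move: E; rewrite x0 mul0r addr0.
Qed.

Lemma eta_mul_eq0 m f : (forall z, U z -> differentiable f z) ->
  (forall z, U z -> eta z m * f z = 0) -> forall z, U z -> f z = 0.
Proof.
move=> df f0 z Uz; have := eq_derive_open (Yf R m) oU Uz f0.
rewrite dvl_cst (dvlM _ (dfl_eta m z) (df z Uz)) dvl_eta eta_Y eqxx mul1r => E.
have /eqP := f0 z Uz; rewrite mulf_eq0 => /orP[/eqP x0|/eqP//].
by move: E; rewrite x0 mul0r addr0.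
Qed.

(* [f] depends on [xi] only and is homogeneous of degree 1 in [xi_k] and of
   degree 0 in the other variables, hence is a multiple of [xi_k]. *)
Lemma xi_homogeneous_eq0 k f : smooth_on U f ->
  (forall b z, U z -> 'DD_(Yf R b) f z = 0) ->
  (forall m z, U z -> xi z m * 'DD_(Xf R m) f z = (k == m)%:R * f z) ->
  'DD_(Xf R k) f 0 = 0 -> forall z, U z -> f z = 0.
Proof.
move=> sf fY fX f0.
have sX m := smooth_drv (Xf R m) sf.
have X0 m : m != k -> forall z, U z -> 'DD_(Xf R m) f z = 0.
  move=> mk; apply: (xi_mul_eq0 (m := m)); first by move=> z; exact: smooth_dfl.
  by move=> z Uz; rewrite fX// eq_sym (negbTE mk) mul0r.
have XX0 : forall z, U z -> 'DD_(Xf R k) ('DD_(Xf R k) f) z = 0.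
  apply: (xi_mul_eq0 (m := k)).
    by move=> z; apply: smooth_dfl; exact: smooth_drv.
  move=> z Uz; have := eq_derive_open (Xf R k) oU Uz (fX k).
  rewrite (dvlM _ (dfl_xi k z) (smooth_dfl (sX k) Uz)) (dvlZ _ _ (smooth_dfl sf Uz)).
  by rewrite dvl_xi xi_X eqxx !mul1r => E; lra.
have Xc z : U z -> 'DD_(Xf R k) f z = 0.
  move=> Uz; rewrite -f0; apply: (connected_cst oU cU) => //.
  - by move=> q; exact: smooth_dfl.
  - move=> m q Uq; have [->|mk] := eqVneq m k; first exact: XX0.
    by rewrite (schwarz _ _ oU sf Uq) (eq_derive_open _ oU Uq (X0 m mk)) dvl_cst.
  - move=> b q Uq.
    by rewrite (schwarz _ _ oU sf Uq) (eq_derive_open _ oU Uq (fY b)) dvl_cst.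
by move=> z Uz; have := fX k z Uz; rewrite Xc// mulr0 eqxx mul1r.
Qed.

Lemma eta_homogeneous_eq0 k f : smooth_on U f ->
  (forall b z, U z -> 'DD_(Xf R b) f z = 0) ->
  (forall m z, U z -> eta z m * 'DD_(Yf R m) f z = (k == m)%:R * f z) ->
  'DD_(Yf R k) f 0 = 0 -> forall z, U z -> f z = 0.
Proof.
move=> sf fX fY f0.
have sY m := smooth_drv (Yf R m) sf.
have Y0 m : m != k -> forall z, U z -> 'DD_(Yf R m) f z = 0.
  move=> mk; apply: (eta_mul_eq0 (m := m)); first by move=> z; exact: smooth_dfl.
  by move=> z Uz; rewrite fY// eq_sym (negbTE mk) mul0r.
have YY0 : forall z, U z -> 'DD_(Yf R k) ('DD_(Yf R k) f) z = 0.
  apply: (eta_mul_eq0 (m := k)).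
    by move=> z; apply: smooth_dfl; exact: smooth_drv.
  move=> z Uz; have := eq_derive_open (Yf R k) oU Uz (fY k).
  rewrite (dvlM _ (dfl_eta k z) (smooth_dfl (sY k) Uz)) (dvlZ _ _ (smooth_dfl sf Uz)).
  by rewrite dvl_eta eta_Y eqxx !mul1r => E; lra.
have Yc z : U z -> 'DD_(Yf R k) f z = 0.
  move=> Uz; rewrite -f0; apply: (connected_cst oU cU) => //.
  - by move=> q; exact: smooth_dfl.
  - move=> b q Uq.
    by rewrite (schwarz _ _ oU sf Uq) (eq_derive_open _ oU Uq (fX b)) dvl_cst.
  - move=> m q Uq; have [->|mk] := eqVneq m k; first exact: YY0.
    by rewrite (schwarz _ _ oU sf Uq) (eq_derive_open _ oU Uq (Y0 m mk)) dvl_cst.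
by move=> z Uz; have := fY k z Uz; rewrite Yc// mulr0 eqxx mul1r.
Qed.

Lemma eulerM m f g z : differentiable f z -> differentiable g z ->
  euler m (fun z => f z * g z) z = euler m f z * g z + f z * euler m g z.
Proof. by move=> df dg; rewrite /euler !(dvlM _ df dg); ring. Qed.

Lemma euler_sum (I : finType) (F : I -> Dn R n -> R) m z :
  (forall d, differentiable (F d) z) ->
  euler m (fun z => \sum_d F d z) z = \sum_d euler m (F d) z.
Proof.
move=> dF; rewrite /euler !dvl_sum; try by move=> d _; exact: dF.
by rewrite !mulr_sumr -sumrB.
Qed.

Lemma eq_euler m f g z : U z -> (forall z, U z -> f z = g z) ->
  euler m f z = euler m g z.
Proof.
by move=> Uz fg; rewrite /euler !(eq_derive_open _ oU Uz fg).
Qed.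

Lemma euler_xi m i z : euler m (fun z => xi z i) z = (i == m)%:R * xi z i.
Proof.
by rewrite /euler !dvl_xi xi_X xi_Y eq_sym; case: eqP => [->|_] /=; ring.
Qed.

Lemma euler_eta m i z : euler m (fun z => eta z i) z = - (i == m)%:R * eta z i.
Proof.
by rewrite /euler !dvl_eta eta_X eta_Y eq_sym; case: eqP => [->|_] /=; ring.
Qed.
End HomogeneousFunctions.

Definition constant_hessian (R : realType) (n : nat) (U : set (Dn R n))
    (phi : Dn R n -> R) (a : 'I_n -> R) : Prop :=
  forall z, U z -> forall i j, hess phi i j z = (i == j)%:R * a j.

Section FlatToric.
Variables (R : realType) (n : nat) (U : set (Dn R n)) (phi : Dn R n -> R).
Variables (Omega : set 'rV[R]_n) (Phi : 'rV[R]_n -> R).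
Implicit Types (z : Dn R n) (i j k m : 'I_n).
Hypotheses (oU : open U) (cU : connected U) (U0 : U 0).
Hypotheses (sphi : smooth_on U phi).
Hypothesis uh : forall q, U q -> hessmx phi q \in unitmx.
Hypothesis sPhi : smooth_on Omega Phi.
Hypothesis phiE : forall z, U z -> Omega (tz z) /\ phi z = Phi (tz z).

Lemma hess_row_inj (x : 'I_n -> R) z : U z ->
  (forall f, \sum_d x d * hess phi d f z = 0) -> forall d, x d = 0.
Proof.
move=> Uz x0 d; pose X : 'rV[R]_n := \row_i x i.
have X0 : X *m hessmx phi z = 0.
  by apply/rowP => f; rewrite !mxE -[RHS](x0 f); apply: eq_bigr => e _; rewrite !mxE.
have : X = 0 by rewrite -[X]mulmx1 -(mulmxV (uh Uz)) mulmxA X0 mul0mx.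
by move=> /rowP/(_ d); rewrite !mxE.
Qed.

(** Euler's operator is applied to [Gam h = d h]; the weights of [h] and of [d h] are known, and the
    invertible [h] cancels. *)
Lemma weight_Gam d a c : weight U
  (fun m => (d == m)%:R - (a == m)%:R - (c == m)%:R) (Gam phi d a c).
Proof.
move=> m z Uz.
have sh := smooth_hess (phi := phi) sphi.
have dG e := smooth_dfl (smooth_Gam oU sphi uh e a c) Uz.
have dh e f := smooth_dfl (sh e f) Uz.
have wh := weight_hess oU sphi sPhi phiE.
apply/eqP; rewrite -subr_eq0; apply/eqP.
pose x e := euler m (Gam phi e a c) z -
  ((e == m)%:R - (a == m)%:R - (c == m)%:R) * Gam phi e a c z.
apply: (@hess_row_inj x z Uz) => f.
have E := eq_euler oU m Uz (fun q Uq => Gam_hess uh a c f Uq).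
move: E; rewrite euler_sum => [E|e]; last exact: dflM (dG e) (dh e f).
have E2 := weight_DX oU a (sh c f) (wh c f) m Uz.
rewrite E2 -(Gam_hess uh a c f Uz) mulr_sumr in E.
set E1 := \sum_e _ in E; set E3 := \sum_e _ in E.
transitivity (E1 - E3); last by rewrite E subrr.
rewrite -sumrB; apply: eq_bigr => e _.
rewrite (eulerM m (dG e) (dh e f)) (wh e f m z Uz) /x; ring.
Qed.

Hypothesis fl : flat U phi.

Lemma flat_DGam d a b c z : U z -> 'DD_(Yf R b) (Gam phi d a c) z = 0.
Proof.
move=> Uz; apply: (@hess_row_inj (fun d => 'DD_(Yf R b) (Gam phi d a c) z) z Uz) => f.
by rewrite (DGam_hess oU sphi uh a b c f Uz) (flat_Rm oU sphi uh).
Qed.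

(** The weight of [Gam] can be negative in [a] and [c]. Multiplication by [xi_a xi_c] leaves degree
    1 in [xi_d] and 0 otherwise, so the product is a multiple of [xi_d]; being quadratic in [xi] at
    0 it has derivative 0 there, hence vanishes. *)
Lemma flat_Gam0 d a c z : U z -> Gam phi d a c z = 0.
Proof.
have sG := smooth_Gam oU sphi uh d a c.
have sxi i : smooth_on U (fun z => xi z i).
  by apply: smooth_linear => //; [exact: xiL|move=> p; exact: dfl_xi].
have s1 := smoothM oU (sxi c) sG.
have s2 := smoothM oU (sxi a) s1.
have F0 : forall z, U z -> xi z a * (xi z c * Gam phi d a c z) = 0.
  apply: (xi_homogeneous_eq0 oU cU U0 (k := d) s2).
  - move=> b q Uq.
    rewrite (dvlM _ (dfl_xi a q) (smooth_dfl s1 Uq)).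
    rewrite (dvlM _ (dfl_xi c q) (smooth_dfl sG Uq)) !dvl_xi !xi_Y.
    by rewrite flat_DGam// !(mul0r, mulr0, addr0).
  - move=> m q Uq.
    have := eulerM m (dfl_xi a q) (smooth_dfl s1 Uq).
    rewrite (eulerM m (dfl_xi c q) (smooth_dfl sG Uq)) !euler_xi.
    rewrite (weight_Gam d a c m Uq) /euler.
    rewrite [X in _ - X](_ : _ = 0); first by rewrite subr0 => ->; ring.
    rewrite (dvlM _ (dfl_xi a q) (smooth_dfl s1 Uq)).
    rewrite (dvlM _ (dfl_xi c q) (smooth_dfl sG Uq)) !dvl_xi !xi_Y.
    by rewrite flat_DGam// !(mul0r, mulr0, addr0).
  - rewrite (dvlM _ (dfl_xi a 0) (smooth_dfl s1 U0)).
    by rewrite !xi0 !mul0r mulr0 addr0.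
have F1 := xi_mul_eq0 oU (fun q Uq => smooth_dfl s1 Uq) F0.
exact: (xi_mul_eq0 oU (fun q Uq => smooth_dfl sG Uq) F1).
Qed.

Lemma flat_DX_hess a i j z : U z -> 'DD_(Xf R a) (hess phi i j) z = 0.
Proof.
move=> Uz; rewrite -(Gam_hess uh a i j Uz) big1// => d _.
by rewrite flat_Gam0// mul0r.
Qed.

(** By [flat_DX_hess] the entries depend on [eta] only. A diagonal entry has weight 0, hence is
    constant. For [i != j] the product [eta_j h_ij] has degree 1 in [eta_i] and 0 otherwise, hence
    is a multiple of [eta_i], and its [eta_i]-derivative at 0 vanishes because of the factor
    [eta_j]. *)
Lemma flat_constant_hessian :
  constant_hessian U phi (fun j => 'DD_(ev R j) Phi 0).
Proof.
have sh := smooth_hess (phi := phi) sphi.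
have wh := weight_hess oU sphi sPhi phiE.
move=> z Uz i j.
have E0 : hess phi i j 0 = (i == j)%:R * 'DD_(ev R j) Phi 0.
  by apply: (hess_toric_eta0 oU sPhi phiE) => // k; rewrite eta0.
case: (eqVneq i j) => [ij|ij].
  have := E0; rewrite ij eqxx => <-; apply: (connected_cst oU cU) => //.
  - by move=> q; exact: smooth_dfl.
  - by move=> m q; exact: flat_DX_hess.
  - move=> m; apply: (eta_mul_eq0 oU (m := m)) => [q|q Uq].
      by apply: smooth_dfl; exact: smooth_drv.
    have := wh j j m q Uq; rewrite /euler flat_DX_hess// mulr0 subrr mul0r sub0r.
    by move/eqP; rewrite oppr_eq0 => /eqP.
rewrite mul0r.
have seta k : smooth_on U (fun z => eta z k).
  by apply: smooth_linear => //; [exact: etaL|move=> p; exact: dfl_eta].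
have s1 := smoothM oU (seta j) (sh i j).
have F0 : forall z, U z -> eta z j * hess phi i j z = 0.
  apply: (eta_homogeneous_eq0 oU cU U0 (k := i) s1).
  - move=> b q Uq; rewrite (dvlM _ (dfl_eta j q) (smooth_dfl (sh i j) Uq)).
    by rewrite dvl_eta eta_X flat_DX_hess// mul0r mulr0 addr0.
  - move=> m q Uq; have := eulerM m (dfl_eta j q) (smooth_dfl (sh i j) Uq).
    rewrite euler_eta (wh i j m q Uq) /euler.
    rewrite [X in X - _](_ : _ = 0); first by move=> E; lra.
    rewrite (dvlM _ (dfl_eta j q) (smooth_dfl (sh i j) Uq)).
    by rewrite dvl_eta eta_X flat_DX_hess// mul0r !mulr0 addr0 mulr0.
  - rewrite (dvlM _ (dfl_eta j 0) (smooth_dfl (sh i j) U0)).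
    by rewrite dvl_eta eta_Y (negbTE ij) eta0 !mul0r addr0.
exact: (eta_mul_eq0 oU (fun q Uq => smooth_dfl (sh i j) Uq) F0 Uz).
Qed.
End FlatToric.

Section ConstantHessian.
Variables (R : realType) (n : nat) (U : set (Dn R n)) (phi : Dn R n -> R).
Variable a : 'I_n -> R.
Hypotheses (oU : open U) (ch : constant_hessian U phi a).

Lemma constant_gram b c p q : U p -> U q ->
  gram (metric phi) p b c = gram (metric phi) q b c.
Proof.
move=> Up Uq; rewrite !gramE; have -> // : hessmx phi p = hessmx phi q.
by apply/matrixP => i j; rewrite !mxE !ch.
Qed.

Lemma constant_christoffel d b c p : U p -> christoffel (metric phi) d b c p = 0.
Proof.
move=> Up; rewrite /christoffel big1 ?mulr0// => e _.
have D0 v i j : 'D_v (fun q => gram (metric phi) q i j) p = 0.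
  rewrite ddE (eq_derive_open _ oU Up (fun q Uq => constant_gram i j Uq Up)).
  exact: dvl_cst.
by rewrite !D0 addr0 subr0 mulr0.
Qed.

Lemma constant_riemann d c b e p : U p -> riemann (metric phi) d c b e p = 0.
Proof.
move=> Up; rewrite /riemann !ddE.
have D0 v i j k : 'DD_v (christoffel (metric phi) i j k) p = 0.
  rewrite (eq_derive_open _ oU Up (fun q Uq => constant_christoffel i j k Uq)).
  exact: dvl_cst.
rewrite !D0 subr0 add0r big1// => f _.
by rewrite !constant_christoffel// !mul0r subr0.
Qed.

Lemma constant_flat : flat U phi.
Proof.
move=> p v Up _; rewrite /sectional /curvature4 big1 ?mul0r// => b _.
rewrite big1// => c _; rewrite big1// => d _; rewrite big1// => e _.
by rewrite big1// => f _; rewrite constant_riemann// mulr0 mul0r.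
Qed.

Lemma constant_Ricci_flat : Ricci_flat U phi.
Proof.
move=> p Up b c; rewrite mul0r /ricci big1// => d _.
exact: constant_riemann.
Qed.
End ConstantHessian.

(** * The Einstein equation near the origin *)

Section EinsteinNearOrigin.
Variables (R : realType) (n : nat) (U : set (Dn R n)) (phi : Dn R n -> R).
Variables (Omega : set 'rV[R]_n) (Phi : 'rV[R]_n -> R).
Implicit Types (z q : Dn R n) (i j k m : 'I_n).
Hypotheses (oU : open U) (sphi : smooth_on U phi).
Hypothesis uh : forall q, U q -> hessmx phi q \in unitmx.
Hypothesis sPhi : smooth_on Omega Phi.
Hypothesis phiE : forall z, U z -> Omega (tz z) /\ phi z = Phi (tz z).
Variables (lambda r : R).
Hypotheses (r0 : 0 < r) (rU : box 0 r `<=` U) (ein : Einstein U phi lambda).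

Definition trGam i q : R := \sum_k Gam phi k k i q.

Lemma smooth_trGam i : smooth_on U (trGam i).
Proof. by apply: smooth_sum => // k _; exact: smooth_Gam. Qed.

Lemma DX_hess_eta0 m i j q : U q -> (forall k, eta q k = 0) ->
  'DD_(Xf R m) (hess phi i j) q = 0.
Proof.
move=> Uq q0.
rewrite (eq_derive_open _ oU Uq (fun z Uz => hess_toric oU sPhi phiE i j Uz)).
have sj := smooth_drv (ev R j) sPhi; have sij := smooth_drv (ev R i) sj.
have dj := smooth_dfl sj (phiE Uq).1; have dij := smooth_dfl sij (phiE Uq).1.
have cj : differentiable (fun z => 'DD_(ev R j) Phi (tz z)) q.
  exact: (differentiable_comp (dfl_tz q) dj).
have cij : differentiable (fun z => 'DD_(ev R i) ('DD_(ev R j) Phi) (tz z)) q.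
  exact: (differentiable_comp (dfl_tz q) dij).
have ec := dflM (dfl_eta i q) cij.
rewrite (dvlD _ (dflM (dfl_cst (i == j)%:R q) cj) (dflM (dfl_xi j q) ec)).
rewrite (dvlZ _ _ cj) (dX_toric _ dj) (dvlM _ (dfl_xi j q) ec).
rewrite (dvlM _ (dfl_eta i q) cij) dvl_eta eta_X !q0.
by rewrite !(mul0r, mulr0, addr0).
Qed.

(* The difference of the two sides does not depend on [eta], by the Einstein
   equation, and vanishes at [eta = 0], because [phi] is toric. *)
Lemma trGam_potential i z : box 0 r z ->
  trGam i z = - (lambda / 2) * 'DD_(Xf R i) phi z.
Proof.
move=> bz; have sX := smooth_drv (Xf R i) sphi.
pose V q := trGam i q + lambda / 2 * 'DD_(Xf R i) phi q.
have dT q : U q -> differentiable (trGam i) q by exact: smooth_dfl (smooth_trGam i).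
have dX q : U q -> differentiable ('DD_(Xf R i) phi) q by exact: smooth_dfl.
have dV q : U q -> differentiable V q.
  by move=> Uq; exact: dflD (dT q Uq) (dflM (dfl_cst _ q) (dX q Uq)).
have VY j q : U q -> 'DD_(Yf R j) V q = 0.
  move=> Uq; rewrite (dvlD _ (dT q Uq) (dflM (dfl_cst _ q) (dX q Uq))).
  rewrite (dvlZ _ _ (dX q Uq)) -(hessC oU sphi i j Uq).
  have := ein Uq (rshift n j) (lshift n i).
  rewrite (ricci_rl oU sphi uh i j Uq) gram_rl => E.
  by rewrite -[X in X + _]opprK E; ring.
pose z0 := pt (xiv z) 0.
have bz0 : box 0 r z0.
  move=> k; rewrite xi_pt eta_pt xi0 eta0 !mxE !subr0 normr0; split=> //.
  by have [] := bz k; rewrite xi0 subr0.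
have z00 k : eta z0 k = 0 by rewrite eta_pt mxE.
have Vz : V z = V z0.
  apply: (box_cst_eta (p := 0) (r := r)) => //.
  - by move=> q /rU; exact: dV.
  - by move=> j q /rU; exact: VY.
  - by move=> k; rewrite xi_pt mxE.
have V0 : V z0 = 0.
  rewrite /V /trGam big1 => [|k _]; last first.
    rewrite /Gam big1// => f _; rewrite DX_hess_eta0 ?mul0r//; exact: rU.
  by rewrite (DX_phi oU sPhi phiE i (rU bz0)) z00 mul0r mulr0 addr0.
have : V z = 0 by rewrite Vz V0.
by rewrite /V mulNr => /eqP; rewrite addr_eq0 => /eqP.
Qed.

(** Jacobi's formula, with the cofactors written as [det h] times the entries of [h^-1] and the
    index of differentiation exchanged by [DX_hessC]. *)
Lemma DX_det i q : U q -> 'DD_(Xf R i) (fun q => \det (hessmx phi q)) q =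
  \det (hessmx phi q) * trGam i q.
Proof.
move=> Uq; have dh k l : differentiable (fun q => hessmx phi q k l) q.
  apply: (eq_dfl_open oU Uq _ (smooth_dfl (smooth_hess sphi k l) Uq)).
  by move=> z _; rewrite mxE.
rewrite (dvl_det _ dh) /trGam mulr_sumr; apply: eq_bigr => k _.
rewrite /Gam mulr_sumr; apply: eq_bigr => l _.
rewrite (eq_derive_open (g := hess phi k l) _ oU Uq); last by move=> z _; rewrite mxE.
rewrite (DX_hessC oU sphi k i l Uq) [RHS]mulrCA; congr (_ * _).
have d0 : \det (hessmx phi q) != 0 by move: (uh Uq); rewrite unitmxE unitfE.
by rewrite /invmx ifT ?uh// mxE [\adj _ _ _]mxE mulrA divff// mul1r.
Qed.

(** The product [G] has no [xi]-derivatives, and at [xi = 0] both of its factors take their values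
    at 0. The multiplicative form avoids the logarithm of a determinant of unknown sign. *)
Lemma Einstein_det z : box 0 r z -> \det (hessmx phi z) =
  \det (hessmx phi 0) * expR (- (lambda / 2) * (phi z - phi 0)).
Proof.
move=> bz; have U0 : U 0 by apply: rU; exact: box_center.
pose G q := \det (hessmx phi q) * expR (lambda / 2 * phi q).
have dd q : U q -> differentiable (fun q => \det (hessmx phi q)) q.
  move=> Uq; apply: dfl_det => k l.
  apply: (eq_dfl_open oU Uq _ (smooth_dfl (smooth_hess sphi k l) Uq)).
  by move=> w _; rewrite mxE.
have dp q : U q -> differentiable (fun q => lambda / 2 * phi q) q.
  by move=> Uq; exact: dflM (dfl_cst _ q) (smooth_dfl sphi Uq).
have de q : U q -> differentiable (fun q => expR (lambda / 2 * phi q)) q.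
  by move=> Uq; exact: dfl_comp (dp q Uq) (is_derive_expR _).
have GX i q : box 0 r q -> 'DD_(Xf R i) G q = 0.
  move=> bq; have Uq := rU bq.
  rewrite (dvlM _ (dd q Uq) (de q Uq)) (DX_det i Uq) (trGam_potential i bq).
  rewrite (dvl_comp _ (dp q Uq) (is_derive_expR _)).
  by rewrite (dvlZ _ _ (smooth_dfl sphi Uq)); ring.
pose z0 := pt 0 (etav z).
have bz0 : box 0 r z0.
  move=> k; rewrite xi_pt eta_pt xi0 eta0 !mxE !subr0 normr0; split=> //.
  by have [_] := bz k; rewrite eta0 subr0.
have Uz0 := rU bz0.
have z00 k : xi z0 k = 0 by rewrite xi_pt mxE.
have Gz : G z = G z0.
  apply: (box_cst_xi (p := 0) (r := r)) => //.
  - by move=> q /rU Uq; exact: dflM (dd q Uq) (de q Uq).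
  - by move=> k; rewrite eta_pt mxE.
have hz0 : hessmx phi z0 = hessmx phi 0.
  apply/matrixP => i j; rewrite !mxE (hess_toric_xi0 oU sPhi phiE)//.
  by rewrite (hess_toric_xi0 oU sPhi phiE)// => k; rewrite xi0.
have pz0 : phi z0 = phi 0.
  rewrite (phiE Uz0).2 (phiE U0).2; congr Phi; apply/rowP => k.
  by rewrite !tzE z00 xi0 !mul0r.
move: Gz; rewrite /G hz0 pz0 => E.
have -> : - (lambda / 2) * (phi z - phi 0) = lambda / 2 * phi 0 - lambda / 2 * phi z.
  by ring.
by rewrite expRB mulrA -E mulfK// gt_eqF ?expR_gt0.
Qed.
End EinsteinNearOrigin.

(** * Para-holomorphic maps into the space forms *)

Section HoloImmersion.
Variables (R : realType) (n N : nat) (W : set (Dn R n)) (f : Dn R n -> Dn R N).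
Implicit Types (z q p : Dn R n) (i j : 'I_n) (k l : 'I_N).
Hypotheses (oW : open W) (hf : para_holomorphic_on W f).

Definition zeta k z : R := xi (f z) k.
Definition theta k z : R := eta (f z) k.

Lemma smooth_zeta k : smooth_on W (zeta k).
Proof.
apply: (smooth_lincomp oW (L := fun w => xi w k)); [exact: xiL| |exact: hf.1].
by move=> w; exact: dfl_xi.
Qed.

Lemma smooth_theta k : smooth_on W (theta k).
Proof.
apply: (smooth_lincomp oW (L := fun w => eta w k)); [exact: etaL| |exact: hf.1].
by move=> w; exact: dfl_eta.
Qed.

(** Along the idempotents [dzbar] splits into the [eta]-derivative of [zeta] and the [xi]-derivative
    of [theta]; thus [zeta] is a function of [xi] and [theta] of [eta]. *)
Lemma zeta_theta_holo k i p : W p ->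
  'DD_(Yf R i) (zeta k) p = 0 /\ 'DD_(Xf R i) (theta k) p = 0.
Proof.
move=> Wp; have df := smooth_dfl hf.1 Wp.
have du : differentiable (fun z => (f z).1 0 k : R) p.
  exact: (@differentiable_comp _ _ _ _ f (fun w : Dn R N => w.1 0 k : R) p df (dfl_re k (f p))).
have dv : differentiable (fun z => (f z).2 0 k : R) p.
  exact: (@differentiable_comp _ _ _ _ f (fun w : Dn R N => w.2 0 k : R) p df (dfl_im k (f p))).
have := hf.2 k i p Wp; rewrite /dzbar !ddE !(dvl_pair _ du dv) slot1E slot_tauE.
rewrite !(dvl_lin _ _ _ du) !(dvl_lin _ _ _ dv) => -[].
rewrite /zeta /theta /xi /eta (dvlB _ du dv) (dvlD _ du dv).
move: ('DD__ _ p) ('DD__ _ p) ('DD__ _ p) ('DD__ _ p) => a b c d.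
by rewrite /GRing.scale /= => E1 E2; split; lra.
Qed.

Lemma xi_Df v k p : W p -> xi ('DD_v f p) k = 'DD_v (zeta k) p.
Proof.
move=> Wp; rewrite /zeta.
rewrite (dvl_chain v (smooth_dfl hf.1 Wp) (dfl_xi k (f p))).
by rewrite (dvl_linear _ _ (@xiL _ _ k)).
Qed.

Lemma eta_Df v k p : W p -> eta ('DD_v f p) k = 'DD_v (theta k) p.
Proof.
move=> Wp; rewrite /theta.
rewrite (dvl_chain v (smooth_dfl hf.1 Wp) (dfl_eta k (f p))).
by rewrite (dvl_linear _ _ (@etaL _ _ k)).
Qed.

Lemma pullback_hess (pot : Dn R N -> R) (phi : Dn R n -> R) i j p : W p ->
  metric pot (f p) ('D_(Xf R i) f p) ('D_(Yf R j) f p)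
    = metric phi p (Xf R i) (Yf R j) ->
  hess phi i j p = \sum_k \sum_l hess pot k l (f p) *
    ('DD_(Xf R i) (zeta k) p * 'DD_(Yf R j) (theta l) p).
Proof.
move=> Wp; rewrite metric_XY metricE !ddE => E.
transitivity (2 * (hess phi i j p / 2)); first by field.
rewrite -E mulr_sumr; apply: eq_bigr => k _; rewrite mulr_sumr; apply: eq_bigr => l _.
rewrite !(xi_Df _ _ Wp) !(eta_Df _ _ Wp) (zeta_theta_holo k j Wp).1.
by field.
Qed.

Lemma zeta_box r z z' k : box 0 r `<=` W -> box 0 r z -> box 0 r z' ->
  (forall i, xi z i = xi z' i) -> zeta k z' = zeta k z.
Proof.
move=> rW bz bz' e; apply: (box_cst_eta (p := 0) (r := r)) => //.
  by move=> q /rW; apply: smooth_dfl; exact: smooth_zeta.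
by move=> i q /rW Wq; exact: (zeta_theta_holo k i Wq).1.
Qed.

Lemma theta_box r z z' k : box 0 r `<=` W -> box 0 r z -> box 0 r z' ->
  (forall i, eta z i = eta z' i) -> theta k z' = theta k z.
Proof.
move=> rW bz bz' e; apply: (box_cst_xi (p := 0) (r := r)) => //.
  by move=> q /rW; apply: smooth_dfl; exact: smooth_theta.
by move=> i q /rW Wq; exact: (zeta_theta_holo k i Wq).2.
Qed.

(** This is [norm2 (f z)]: the pullback of the flat potential is twice it, that of the projective
    potential is a multiple of [ln (1 + zt)]. *)
Definition zt z : R := \sum_k zeta k z * theta k z.

Lemma smooth_zt : smooth_on W zt.
Proof.
apply: smooth_sum => // k _; apply: smoothM => //.
  exact: smooth_zeta.
exact: smooth_theta.
Qed.

Lemma DY_zt j p : W p ->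
  'DD_(Yf R j) zt p = \sum_k zeta k p * 'DD_(Yf R j) (theta k) p.
Proof.
move=> Wp; have dz k := smooth_dfl (smooth_zeta k) Wp.
have dt k := smooth_dfl (smooth_theta k) Wp.
rewrite /zt dvl_sum => [|k _]; last exact: dflM (dz k) (dt k).
apply: eq_bigr => k _; rewrite (dvlM _ (dz k) (dt k)).
by rewrite (zeta_theta_holo k j Wp).1 mul0r add0r.
Qed.

Lemma DX_zt i p : W p ->
  'DD_(Xf R i) zt p = \sum_k theta k p * 'DD_(Xf R i) (zeta k) p.
Proof.
move=> Wp; have dz k := smooth_dfl (smooth_zeta k) Wp.
have dt k := smooth_dfl (smooth_theta k) Wp.
rewrite /zt dvl_sum => [|k _]; last exact: dflM (dz k) (dt k).
apply: eq_bigr => k _; rewrite (dvlM _ (dz k) (dt k)).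
by rewrite (zeta_theta_holo k i Wp).2 mulr0 addr0 mulrC.
Qed.

Lemma hess_zt i j p : W p -> hess zt i j p =
  \sum_k 'DD_(Xf R i) (zeta k) p * 'DD_(Yf R j) (theta k) p.
Proof.
move=> Wp; have dz k := smooth_dfl (smooth_zeta k) Wp.
have dt k := smooth_dfl (smooth_drv (Yf R j) (smooth_theta k)) Wp.
rewrite hessE (eq_derive_open _ oW Wp (fun q Wq => DY_zt j Wq)).
rewrite dvl_sum => [|k _]; last exact: dflM (dz k) (dt k).
apply: eq_bigr => k _; rewrite (dvlM _ (dz k) (dt k)).
rewrite (schwarz _ _ oW (smooth_theta k) Wp).
rewrite (eq_derive_open _ oW Wp (fun q Wq => (zeta_theta_holo k i Wq).2)).
by rewrite dvl_cst mulr0 addr0.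
Qed.
End HoloImmersion.

Section Models.
Variables (R : realType) (N : nat).
Implicit Types (z p : Dn R N) (k l : 'I_N).

Lemma norm2E z : norm2 z = \sum_k xi z k * eta z k.
Proof. by apply: eq_bigr => k _; rewrite abs2_null. Qed.

Lemma dfl_norm2 z : differentiable (@norm2 R N) z.
Proof.
have -> : @norm2 R N = fun z => \sum_k xi z k * eta z k.
  by apply/funext => q; rewrite norm2E.
by apply: dfl_sum => k _; exact: dflM (dfl_xi k z) (dfl_eta k z).
Qed.

Lemma dvl_norm2 v z : 'DD_v (@norm2 R N) z =
  \sum_k (xi v k * eta z k + xi z k * eta v k).
Proof.
have -> : @norm2 R N = fun z => \sum_k xi z k * eta z k.
  by apply/funext => q; rewrite norm2E.
rewrite dvl_sum => [|k _]; last exact: dflM (dfl_xi k z) (dfl_eta k z).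
by apply: eq_bigr => k _; rewrite (dvlM _ (dfl_xi k z) (dfl_eta k z)) dvl_xi dvl_eta.
Qed.

Lemma DX_norm2 k z : 'DD_(Xf R k) (@norm2 R N) z = eta z k.
Proof.
rewrite dvl_norm2 -(sum_delta_l (eta z) k); apply: eq_bigr => l _.
by rewrite xi_X eta_X mulr0 addr0.
Qed.

Lemma DY_norm2 l z : 'DD_(Yf R l) (@norm2 R N) z = xi z l.
Proof.
rewrite dvl_norm2 -(sum_delta_l (xi z) l); apply: eq_bigr => k _.
by rewrite xi_Y eta_Y mul0r add0r mulrC.
Qed.

Lemma hess_flat k l z : hess (@flat_potential R N) k l z = 2 * (k == l)%:R.
Proof.
rewrite hessE; have -> : 'DD_(Yf R l) (@flat_potential R N) = fun z => 2 * xi z l.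
  by apply/funext => q; rewrite (dvlZ _ _ (dfl_norm2 q)) DY_norm2.
by rewrite (dvlZ _ _ (dfl_xi l z)) dvl_xi xi_X.
Qed.

Lemma norm2_section (i : 'I_N.+1) z : norm2 (affine_section i z) = 1 + norm2 z.
Proof.
rewrite /norm2 (bigD1_ord i) //= !pcomp_mkDn unlift_none; congr (_ + _).
  by rewrite /abs2 /= expr1n expr0n subr0.
by apply: eq_bigr => k _; rewrite pcomp_mkDn liftK.
Qed.

(** The value is [|Z|^2 / |Z_i|^2], a quotient of positive numbers, so the logarithm in the
    projective potential is taken at positive arguments. *)
Lemma norm2_affine_chart (i : 'I_N.+1) (P : DP R N) : affine_dom i P ->
  0 < 1 + norm2 (affine_chart i P).
Proof.
rewrite /affine_dom /=; set Z := hrep P; set a := abs2 _ => a0.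
have : 0 < norm2 Z by rewrite /Z /hrep; case: (generic_quotient.repr _).
rewrite /norm2 (bigD1_ord i)//= -/a.
have -> : \sum_k abs2 (Defs.pcomp (affine_chart i P) k) =
    (\sum_k abs2 (Defs.pcomp Z (lift i k))) / a.
  rewrite mulr_suml; apply: eq_bigr => k _; rewrite pcomp_mkDn abs2M; congr (_ * _).
  have E : abs2 (inv_pc (Defs.pcomp Z i)) * a = 1.
    by rewrite -abs2M pc_mulVx// /abs2 /= expr1n expr0n subr0.
  by rewrite -[LHS](mulfK (lt0r_neq0 a0)) E mul1r.
move=> S0; have -> : 1 + (\sum_k abs2 (Defs.pcomp Z (lift i k))) / a =
  (a + \sum_k abs2 (Defs.pcomp Z (lift i k))) / a by rewrite mulrDl divff// gt_eqF.
by rewrite divr_gt0.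
Qed.

Lemma hess_projective c (i : 'I_N.+1) k l z : 0 < 1 + norm2 z ->
  hess (fun z => 8 / c * ln (norm2 (affine_section i z))) k l z =
  8 / c * ((k == l)%:R / (1 + norm2 z) - xi z l * eta z k / (1 + norm2 z) ^+ 2).
Proof.
move=> S0; pose S (z : Dn R N) : R := 1 + norm2 z.
have dS q : differentiable S q by exact: dflD (dfl_cst _ q) (dfl_norm2 q).
pose V := [set q : Dn R N | 0 < S q].
have oV : open V.
  rewrite openE => q Vq; have cS := differentiable_continuous (dS q).
  exact: (cvgr_gt _ cS _ Vq).
have DS v q : 'DD_v S q = 'DD_v (@norm2 R N) q.
  by rewrite (dvlD _ (dfl_cst _ q) (dfl_norm2 q)) dvl_cst add0r.
have E q : V q -> 'DD_(Yf R l) (fun z => 8 / c * ln (norm2 (affine_section i z))) q =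
    8 / c * (xi q l * (S q)^-1).
  move=> Vq; under eq_fun do rewrite norm2_section.
  have dl := dfl_comp (dS q) (is_derive1_ln Vq).
  rewrite (dvlZ _ _ dl) (dvl_comp _ (dS q) (is_derive1_ln Vq)) DS DY_norm2.
  by rewrite [_^-1 * _]mulrC.
have S1 : S z != 0 by rewrite gt_eqF.
have dV := dflV (dS z) S1.
rewrite hessE (eq_derive_open _ oV S0 E) (dvlZ _ _ (dflM (dfl_xi l z) dV)).
rewrite (dvlM _ (dfl_xi l z) dV) (dvlV _ (dS z) S1) DS DX_norm2 dvl_xi xi_X.
by rewrite -/(S z); congr (_ * _); field.
Qed.
End Models.

Lemma flat_pullback_hess (R : realType) n N (W : set (Dn R n)) (f : Dn R n -> Dn R N)
    (phi : Dn R n -> R) i j p : para_holomorphic_on W f -> W p ->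
  metric (@flat_potential R N) (f p) ('D_(Xf R i) f p) ('D_(Yf R j) f p)
    = metric phi p (Xf R i) (Yf R j) ->
  hess phi i j p =
    2 * \sum_k 'DD_(Xf R i) (zeta f k) p * 'DD_(Yf R j) (theta f k) p.
Proof.
move=> hf Wp mE; rewrite (pullback_hess hf Wp mE) mulr_sumr; apply: eq_bigr => k _.
rewrite -(sum_delta_l (fun l => 2 * ('DD_(Xf R i) (zeta f k) p * 'DD_(Yf R j) (theta f l) p)) k).
by apply: eq_bigr => l _; rewrite hess_flat; ring.
Qed.

(** [u] and [v] are arbitrary functions: the regularity used later is that of [P], and the rank
    bound is purely algebraic. *)
Definition finite_rank (R : realType) (n : nat) (r : R) (P : 'rV[R]_n -> R) :=
  exists (M : nat) (u v : 'I_M -> 'rV[R]_n -> R), forall x y : 'rV[R]_n,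
    (forall i, `|x 0 i| < r) -> (forall i, `|y 0 i| < r) ->
    P (\row_i (x 0 i * y 0 i)) = \sum_k u k x * v k y.

Section ToricFiniteRank.
Variables (R : realType) (n N : nat) (U W : set (Dn R n)) (phi : Dn R n -> R).
Variables (Omega : set 'rV[R]_n) (Phi : 'rV[R]_n -> R) (f : Dn R n -> Dn R N).
Implicit Types (z q p : Dn R n) (i j : 'I_n) (k l : 'I_N).
Hypothesis sphi : smooth_on U phi.
Hypothesis phiE : forall z, U z -> Omega (tz z) /\ phi z = Phi (tz z).
Hypotheses (oW : open W) (WU : W `<=` U) (hf : para_holomorphic_on W f).
Variable (r : R).
Hypotheses (r0 : 0 < r) (rW : box 0 r `<=` W).

(* A function [phi - F] without mixed derivatives splits as a function of [xi]
   plus a function of [eta]; a toric [phi] is constant where [xi = 0] or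
   [eta = 0]. *)
Lemma toric_separation (F : Dn R n -> R) (x y : 'rV[R]_n) : smooth_on W F ->
  (forall i j q, W q -> hess phi i j q = hess F i j q) ->
  (forall i, `|x 0 i| < r) -> (forall i, `|y 0 i| < r) ->
  Phi (\row_i (x 0 i * y 0 i)) - Phi 0 =
  F (pt x y) - F (pt x 0) - F (pt 0 y) + F (pt 0 0).
Proof.
move=> sF hF xr yr.
have bpt (a b : 'rV[R]_n) : (forall i, `|a 0 i| < r) -> (forall i, `|b 0 i| < r) ->
    box 0 r (pt a b).
  by move=> ar br i; rewrite xi_pt eta_pt xi0 eta0 !subr0.
have zr i : `|(0 : 'rV[R]_n) 0 i| < r by rewrite mxE normr0.
pose D z := phi z - F z.
have sD : smooth_on (box 0 r) D.
  apply: smoothB; first exact: open_box.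
    by apply: smooth_sub sphi => z /rW /WU.
  exact: smooth_sub sF.
have D0 i j q : box 0 r q -> 'DD_(Xf R i) ('DD_(Yf R j) D) q = 0.
  move=> bq; have Wq := rW bq; have Uq := WU Wq.
  have E q' : W q' -> 'DD_(Yf R j) D q' = 'DD_(Yf R j) phi q' - 'DD_(Yf R j) F q'.
    move=> Wq'; rewrite (dvlB _ (smooth_dfl sphi (WU Wq')) (smooth_dfl sF Wq'))//.
  rewrite (eq_derive_open _ oW Wq E).
  rewrite (dvlB _ (smooth_dfl (smooth_drv _ sphi) Uq) (smooth_dfl (smooth_drv _ sF) Wq)).
  by rewrite -!hessE hF// subrr.
have xivE (a b : 'rV[R]_n) : xiv (pt a b) = a by apply/rowP => i; rewrite mxE xi_pt.
have etavE (a b : 'rV[R]_n) : etav (pt a b) = b by apply/rowP => i; rewrite mxE eta_pt.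
have := box_separation sD D0 (bpt x y xr yr) (bpt 0 0 zr zr).
rewrite !xivE !etavE /D.
have phE (a b : 'rV[R]_n) : (forall i, `|a 0 i| < r) -> (forall i, `|b 0 i| < r) ->
    phi (pt a b) = Phi (\row_i (a 0 i * b 0 i)).
  move=> ar br; rewrite (phiE (WU (rW (bpt a b ar br)))).2; congr Phi.
  by apply/rowP => i; rewrite tzE mxE xi_pt eta_pt.
have c1 (a : 'rV[R]_n) : (\row_i (a 0 i * (0 : 'rV[R]_n) 0 i)) = 0.
  by apply/rowP => i; rewrite !mxE mulr0.
have c2 (b : 'rV[R]_n) : (\row_i ((0 : 'rV[R]_n) 0 i * b 0 i)) = 0.
  by apply/rowP => i; rewrite !mxE mul0r.
by rewrite !phE// !c1 !c2; move=> E; lra.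
Qed.

Let zr i : `|(0 : 'rV[R]_n) 0 i| < r. Proof. by rewrite mxE normr0. Qed.
Let bpt (a b : 'rV[R]_n) : (forall i, `|a 0 i| < r) -> (forall i, `|b 0 i| < r) ->
    box 0 r (pt a b).
Proof. by move=> ar br i; rewrite xi_pt eta_pt xi0 eta0 !subr0. Qed.

Lemma zt_pt (x y : 'rV[R]_n) : (forall i, `|x 0 i| < r) -> (forall i, `|y 0 i| < r) ->
  zt f (pt x y) = \sum_k zeta f k (pt x 0) * theta f k (pt 0 y).
Proof.
move=> xr yr; apply: eq_bigr => k _; congr (_ * _).
  by apply: (zeta_box oW hf _ rW (bpt xr zr) (bpt xr yr)) => i; rewrite !xi_pt.
by apply: (theta_box oW hf _ rW (bpt zr yr) (bpt xr yr)) => i; rewrite !eta_pt.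
Qed.

Lemma flat_finite_rank :
  (forall p i j, W p -> metric (@flat_potential R N) (f p) ('D_(Xf R i) f p)
     ('D_(Yf R j) f p) = metric phi p (Xf R i) (Yf R j)) ->
  finite_rank r Phi.
Proof.
move=> mE.
have hE i j p : W p -> hess phi i j p = hess (fun z => 2 * zt f z) i j p.
  move=> Wp; rewrite (flat_pullback_hess hf Wp (mE p i j Wp)).
  have sz := smooth_zt oW hf.
  have E q : W q -> 'DD_(Yf R j) (fun z => 2 * zt f z) q = 2 * 'DD_(Yf R j) (zt f) q.
    by move=> Wq; rewrite (dvlZ _ _ (smooth_dfl sz Wq)).
  rewrite hessE (eq_derive_open _ oW Wp E) (dvlZ _ _ (smooth_dfl (smooth_drv _ sz) Wp)).
  by rewrite -hessE (hess_zt oW hf i j Wp).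
have sF : smooth_on W (fun z => 2 * zt f z).
  by apply: smoothM => //; [exact: smooth_cst|exact: smooth_zt].
(* Index 0 carries the constant [Phi 0]. The four terms of the separation combine into
   [2 (zeta - zeta(0)) (theta - theta(0))], the polarized form of Calabi's diastasis. *)
exists N.+1, (fun a x => if unlift ord0 a is Some k
    then 2 * (zeta f k (pt x 0) - zeta f k (pt 0 0)) else 1),
  (fun a y => if unlift ord0 a is Some k
    then theta f k (pt 0 y) - theta f k (pt 0 0) else Phi 0).
move=> x y xr yr; rewrite big_ord_recl unlift_none mul1r.
have := toric_separation sF hE xr yr.
rewrite (zt_pt xr yr) (zt_pt xr zr) (zt_pt zr yr) (zt_pt zr zr) => E.
rewrite -[LHS](subrK (Phi 0)) E addrC; congr (_ + _).
rewrite -!mulrBr -mulrDr !(mulr_sumr, =^~ sumrB, =^~ big_split) /=.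
by apply: eq_bigr => k _; rewrite liftK; ring.
Qed.

(* Here [phi - 8/c ln S] has no mixed derivatives for [S = 1 + zt f], so
   [expR (c/8 (Phi - Phi 0))] is [S(xi, eta) S(0, 0) / (S(xi, 0) S(0, eta))]. *)
Lemma projective_finite_rank c (i0 : 'I_N.+1) : c != 0 ->
  (forall p, W p -> 0 < 1 + norm2 (f p)) ->
  (forall p i j, W p ->
     metric (fun w : Dn R N => 8 / c * ln (norm2 (affine_section i0 w))) (f p)
       ('D_(Xf R i) f p) ('D_(Yf R j) f p) = metric phi p (Xf R i) (Yf R j)) ->
  finite_rank r (fun t => expR (c / 8 * (Phi t - Phi 0))).
Proof.
move=> c0 pos mE.
pose S z := 1 + zt f z.
have SE z : S z = 1 + norm2 (f z) by rewrite norm2E.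
have sz := smooth_zt oW hf.
have sS : smooth_on W S by apply: smoothD => //; exact: smooth_cst.
have S0 p : W p -> 0 < S p by move=> Wp; rewrite SE; exact: pos.
have S1 p : W p -> S p != 0 by move=> /S0 /gt_eqF ->.
pose L z := 8 / c * ln (S z).
have dS p : W p -> differentiable S p by exact: smooth_dfl.
have DS v p : W p -> 'DD_v S p = 'DD_v (zt f) p.
  by move=> Wp; rewrite (dvlD _ (dfl_cst _ p) (smooth_dfl sz Wp)) dvl_cst add0r.
have DL v p : W p -> 'DD_v L p = 8 / c * ((S p)^-1 * 'DD_v (zt f) p).
  move=> Wp; have dl := is_derive1_ln (S0 p Wp).
  by rewrite (dvlZ _ _ (dfl_comp (dS p Wp) dl)) (dvl_comp _ (dS p Wp) dl) DS.
have sL : smooth_on W L.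
  (* [smooth_closure] has no logarithm, but every derivative of [L] is a quotient of smooth
     functions; so [L] is adjoined to the smooth functions. *)
  apply: (smooth_coind oW (S := fun g => g = L \/ smooth_on W g)); last by left.
    move=> g p [-> Wp|sg Wp]; last exact: smooth_dfl sg Wp.
    exact: dflM (dfl_cst _ p) (dfl_comp (dS p Wp) (is_derive1_ln (S0 p Wp))).
  move=> g v [->|sg]; last by exists ('DD_v g) => //; right; exact: smooth_drv.
  exists (fun p => 8 / c * ((S p)^-1 * 'DD_v (zt f) p)); last exact: DL.
  right; apply: smoothM => //; first exact: smooth_cst.
  by apply: smoothM => //; [exact: smoothV|exact: smooth_drv].
have hE i j p : W p -> hess phi i j p = hess L i j p.
  move=> Wp; rewrite (pullback_hess hf Wp (mE p i j Wp)).
  have dV := dflV (dS p Wp) (S1 p Wp).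
  have dY := smooth_dfl (smooth_drv (Yf R j) sz) Wp.
  rewrite hessE (eq_derive_open _ oW Wp (fun q Wq => DL (Yf R j) q Wq)).
  rewrite (dvlZ _ _ (dflM dV dY)) (dvlM _ dV dY) (dvlV _ (dS p Wp) (S1 p Wp)).
  rewrite (DS _ _ Wp) -hessE (hess_zt oW hf i j Wp).
  rewrite (DX_zt oW hf i Wp) (DY_zt oW hf j Wp).
  under eq_bigr do under eq_bigr do rewrite (hess_projective c i0 _ _ (pos p Wp)).
  rewrite -SE.
  pose a k := 'DD_(Xf R i) (zeta f k) p; pose b l := 'DD_(Yf R j) (theta f l) p.
  transitivity (8 / c * (\sum_k \sum_l ((k == l)%:R * (a k * b l / S p)
    - (theta f k p * a k) * (zeta f l p * b l) / S p ^+ 2))).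
    rewrite mulr_sumr; apply: eq_bigr => k _; rewrite mulr_sumr; apply: eq_bigr => l _.
    by rewrite /a /b /zeta /theta; ring.
  congr (_ * _); under eq_bigr do rewrite sumrB.
  rewrite sumrB; under eq_bigr do rewrite sum_delta_l.
  under [X in _ - X]eq_bigr do rewrite -mulr_suml -mulr_sumr.
  rewrite -!mulr_suml -/(S p) /a /b; field.
  exact: S1.
pose u0 (x : 'rV[R]_n) := S (pt 0 0) / S (pt x 0).
pose v0 (y : 'rV[R]_n) := (S (pt 0 y))^-1.
(* Index 0 carries the summand 1 of [S]; the prefactors [u0] and [v0] involve one of the two
   variables each and do not raise the rank. *)
exists N.+1, (fun a x => u0 x * if unlift ord0 a is Some k
    then zeta f k (pt x 0) else 1),
  (fun a y => v0 y * if unlift ord0 a is Some k then theta f k (pt 0 y) else 1).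
move=> x y xr yr; rewrite (toric_separation sL hE xr yr) /L.
have Wxy := rW (bpt xr yr); have Wx := rW (bpt xr zr).
have Wy := rW (bpt zr yr); have W0 := rW (bpt zr zr).
have -> : c / 8 * (8 / c * ln (S (pt x y)) - 8 / c * ln (S (pt x 0)) -
    8 / c * ln (S (pt 0 y)) + 8 / c * ln (S (pt 0 0))) =
    ln (S (pt x y)) - ln (S (pt x 0)) - ln (S (pt 0 y)) + ln (S (pt 0 0)) by field.
rewrite expRD !expRB !lnK ?posrE ?S0// big_ord_recl unlift_none !mulr1.
transitivity (u0 x * v0 y * S (pt x y)).
  by rewrite /u0 /v0; field; rewrite !S1.
rewrite /S (zt_pt xr yr) mulrDr mulr1; congr (_ + _); rewrite mulr_sumr.
by apply: eq_bigr => k _; rewrite liftK; ring.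
Qed.
End ToricFiniteRank.

(** * Kernels of finite rank *)

(* Choose a nonsingular minor [K (xs i) (ys j)] of
   maximal size. The vanishing of all larger minors expresses [K] through the
   row [K x (ys j)], on which the shift [sX] acts by a constant matrix, and the
   Cayley-Hamilton theorem gives a recurrence. *)
Lemma finite_rank_recurrence (R : fieldType) (X Y : Type) (K : X -> Y -> R)
    (N : nat) (u : 'I_N -> X -> R) (v : 'I_N -> Y -> R) (sX : X -> X) (sY : Y -> Y) :
  (forall x y, K x y = \sum_k u k x * v k y) ->
  (forall x y, K (sX x) y = K x (sY y)) ->
  exists2 chi : {poly R}, chi != 0 &
    forall x y, \sum_(j < size chi) chi`_j * K (iter j sX x) y = 0.
Proof.
move=> KE Ks.
pose minor r (xs : 'I_r -> X) (ys : 'I_r -> Y) : 'M[R]_r := \matrix_(i, j) K (xs i) (ys j).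
pose P r := `[< exists xs ys, \det (@minor r xs ys) != 0 >].
have P0 : P 0%N.
  have e0 (T : Type) (i : 'I_0) : T by case: i.
  apply/asboolP; exists (e0 X), (e0 Y); rewrite (_ : minor _ _ _ = 1%:M) ?det1 ?oner_eq0//.
  by apply/matrixP => - [].
have PN r : P r -> (r <= N)%N.
  move=> /asboolP[xs [ys dm]].
  have E : minor _ xs ys = (\matrix_(i, k) u k (xs i)) *m (\matrix_(k, j) v k (ys j)).
    by apply/matrixP => i j; rewrite !mxE KE; apply: eq_bigr => k _; rewrite !mxE.
  have : minor _ xs ys \in unitmx by rewrite unitmxE unitfE.
  rewrite -row_free_unit /row_free => /eqP <-; rewrite E.
  exact: leq_trans (mxrankM_maxl _ _) (rank_leq_col _).
have [r /asboolP[xs [ys dm]] rmax] := ex_maxnP (ex_intro P 0%N P0) PN.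
set M := minor _ xs ys in dm.
have uM : M \in unitmx by rewrite unitmxE unitfE.
pose b x : 'rV[R]_r := \row_j K x (ys j).
pose c y : 'cV[R]_r := \col_i K (xs i) y.
(* The bordered minor of size [r + 1] vanishes by maximality, and block elimination writes it as
   [det M] times the Schur complement [K x y - b x M^-1 c y]. *)
have KbMc x y : K x y = (b x *m invmx M *m c y) 0 0.
  pose xs' (i : 'I_(r + 1)) := match fintype.split i with inl i => xs i | inr _ => x end.
  pose ys' (i : 'I_(r + 1)) := match fintype.split i with inl i => ys i | inr _ => y end.
  have D0 : \det (minor _ xs' ys') = 0.
    apply/eqP/negPn/negP => D; suff : P (r + 1)%N by move/rmax; rewrite addn1 ltnn.
    by apply/asboolP; exists xs', ys'.
  have E : minor _ xs' ys' = block_mx M (c y) (b x) (K x y)%:M.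
    apply/matrixP => i j; rewrite -(splitK i) -(splitK j).
    case: (fintype.split i) => i'; case: (fintype.split j) => j' /=.
    - by rewrite block_mxEul !mxE /xs' /ys' (unsplitK (inl i')) (unsplitK (inl j')).
    - by rewrite block_mxEur !mxE /xs' /ys' (unsplitK (inl i')) (unsplitK (inr j')).
    - by rewrite block_mxEdl !mxE /xs' /ys' (unsplitK (inr i')) (unsplitK (inl j')).
    - rewrite block_mxEdr !mxE /xs' /ys' (unsplitK (inr i')) (unsplitK (inr j')).
      by rewrite (ord1 i') (ord1 j').
  have F : block_mx M (c y) (b x) (K x y)%:M =
      block_mx 1%:M 0 (b x *m invmx M) 1%:M *m
      block_mx M (c y) 0 ((K x y)%:M - b x *m invmx M *m c y).
    rewrite mulmx_block !mul1mx !mul0mx !addr0 -[_ *m M]mulmxA mulVmx// mulmx1.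
    by rewrite addrC subrK.
  move: D0; rewrite E F det_mulmx det_lblock det_ublock !det1 !mul1r => /eqP.
  rewrite mulf_eq0 (negbTE dm) /= det_mx11 !mxE eqxx mulr1n subr_eq0 => /eqP ->.
  by [].
pose A := invmx M *m \matrix_(i, j) K (xs i) (sY (ys j)).
have bs x : b (sX x) = b x *m A.
  apply/rowP => j; rewrite mxE Ks KbMc /A mulmxA -!mulmxA !mxE.
  apply: eq_bigr => i _; congr (_ * _); rewrite !mxE; apply: eq_bigr => k _.
  by rewrite !mxE.
clearbody A; clear uM dm rmax.
(* An empty maximal minor means [K = 0], and the constant polynomial 1 serves; otherwise [A] has
   positive size and Cayley-Hamilton applies. *)
case: r => [|r] in xs ys M b c KbMc A bs *.
  exists 1; first exact: oner_neq0.
  by move=> x y; rewrite big1// => j _; rewrite KbMc mxE big_ord0 mulr0.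
have bsn j x : b (iter j sX x) = b x *m A ^+ j.
  elim: j => [|j IH]; first by rewrite expr0 mulmx1.
  by rewrite iterS bs IH -mulmxA exprSr.
exists (char_poly A); first by rewrite monic_neq0// char_poly_monic.
move=> x y; set chi := char_poly A.
have CH : \sum_(j < size chi) chi`_j *: A ^+ j = 0.
  have := Cayley_Hamilton A; rewrite -/chi /horner_mx /horner_morph horner_coef.
  rewrite size_map_poly => E; apply: etrans E; apply: eq_bigr => j _.
  by rewrite coef_map /= -mulmxE mul_scalar_mx.
transitivity ((b x *m (\sum_(j < size chi) chi`_j *: A ^+ j) *m invmx M *m c y) 0 0).
  rewrite mulmx_sumr !mulmx_suml summxE; apply: eq_bigr => j _.
  by rewrite KbMc bsn -scalemxAr -!scalemxAl [RHS]mxE.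
by rewrite CH mulmx0 !mul0mx mxE.
Qed.

(** * Dilation recurrences in one variable *)

Section OneVariable.
Variable R : realType.
Implicit Types (p : nat -> R -> R) (rho x : R) (chi : {poly R}).

Lemma dvl_dilation (f : R -> R) (c x : R) : differentiable f (c * x) ->
  differentiable (fun y : R => f (c * y)) x /\
  'DD_1 (fun y : R => f (c * y)) x = c * 'DD_1 f (c * x).
Proof.
move=> df; have dg : differentiable (fun y : R => c * y) x.
  by apply: dflM; [exact: dfl_cst|exact: (@ex_diff _ _ _ _ _ id)].
split; first exact: (differentiable_comp dg df).
rewrite (dvl_chain (g := fun y : R => c * y) 1 dg df).
have -> : 'DD_1 (fun y : R => c * y) x = c *: (1 : R) + 0.
  by rewrite dvl_linear ?addr0// => a y z; rewrite /GRing.scale /=; ring.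
by rewrite (dvl_lin _ _ _ df) dvl0 addr0.
Qed.

Lemma cst_of_derive0 (f : R -> R) rho x : `|x| < rho ->
  (forall y : R, `|y| < rho -> differentiable f y /\ 'DD_1 f y = 0) -> f x = f 0.
Proof.
move=> xr df.
have in_r (s : R) : 0 <= s <= 1 -> `|0 + s *: x| < rho.
  move=> /andP[s0 s1]; rewrite add0r normrZ (ger0_norm s0).
  by apply: le_lt_trans xr; rewrite ler_piMl.
rewrite -[x in LHS]add0r; apply: (line_cst (V := R)) => s s01.
  exact: (df _ (in_r s s01)).1.
have [d1 D1] := df _ (in_r s s01).
have E : x = x *: (1 : R) + 0 by rewrite addr0 /GRing.scale /= mulr1.
by rewrite [X in dd _ X]E (dvl_lin _ _ _ d1) dvl0 addr0 D1 scaler0.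
Qed.

Lemma half_pow_le1 j : (2^-1 : R) ^+ j <= 1.
Proof. by rewrite exprn_ile1 ?invr_ge0// invf_le1// ler1n. Qed.

Lemma half_pow_lt j x rho : `|x| < rho -> `|2^-1 ^+ j * x| < rho.
Proof.
move=> xr; rewrite normrM; apply: le_lt_trans xr; rewrite ler_piMl//.
by rewrite ger0_norm ?half_pow_le1// exprn_ge0// invr_ge0.
Qed.

Lemma open_ball0 rho : open [set x : R | `|x| < rho].
Proof.
rewrite openE => x xr; have cn : {for x, continuous (fun y : R => `|y|)}.
  exact: norm_continuous.
exact: (cvgr_lt _ cn _ xr).
Qed.

(** Each differentiation of [p (2^-1 ^+ j * x)] brings out a factor [2^-1 ^+ j], so high derivatives
    favour the terms with small [j]. *)
Lemma recurrence_derive p rho chi :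
  (forall d x, `|x| < rho -> differentiable (p d) x /\ 'DD_1 (p d) x = p d.+1 x) ->
  (forall x, `|x| < rho ->
     \sum_(j < size chi) chi`_j * p 0%N (2^-1 ^+ j * x) = 0) ->
  forall d x, `|x| < rho ->
     \sum_(j < size chi) chi`_j * 2^-1 ^+ (j * d) * p d (2^-1 ^+ j * x) = 0.
Proof.
move=> dp p0; elim=> [|d IH] x xr.
  by apply: etrans (p0 x xr); apply: eq_bigr => j _; rewrite muln0 expr0 mulr1.
have dj (j : nat) := dp d _ (half_pow_lt j xr).
have := eq_derive_open (1 : R) (@open_ball0 rho) xr IH.
rewrite dvl_cst dvl_sum => [E|j _]; last first.
  by have [dd1 _] := dvl_dilation (dj j).1; exact: dflM (dfl_cst _ x) dd1.
rewrite -[RHS]E; apply: eq_bigr => j _.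
have [dd1 D1] := dvl_dilation (dj j).1.
by rewrite (dvlZ _ _ dd1) D1 (dj j).2 mulnS exprD; ring.
Qed.

(* After sufficiently many derivatives the first nonzero term of the recurrence
   dominates the others. *)
Lemma recurrence_derive_eq0 chi : chi != 0 -> exists d j0 : nat,
  forall p rho, 0 < rho ->
  (forall d x, `|x| < rho -> differentiable (p d) x /\ 'DD_1 (p d) x = p d.+1 x) ->
  (forall x, `|x| < rho ->
     \sum_(j < size chi) chi`_j * p 0%N (2^-1 ^+ j * x) = 0) ->
  forall x, `|x| < 2^-1 ^+ j0 * rho -> p d x = 0.
Proof.
move=> chi0.
have exj : exists j, chi`_j != 0 by exists (size chi).-1; rewrite -lead_coefE lead_coef_eq0.
pose j0 := ex_minn exj.
have [cj0 jmin] : chi`_j0 != 0 /\ forall j, chi`_j != 0 -> (j0 <= j)%N.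
  by rewrite /j0; case: ex_minnP.
have lt0 j : (j < j0)%N -> chi`_j = 0.
  by move=> jj; apply/eqP/negPn/negP => /jmin; rewrite leqNgt jj.
pose S := \sum_(j < size chi) `|chi`_j|.
have S0 : 0 <= S by exact: sumr_ge0.
(* Relative to the term [j0], every later one is damped by at least [2^-1 ^+ d] after [d]
   derivatives; this [d] makes all of them together smaller. *)
have [d dS] : exists d : nat, 2^-1 ^+ d * S < `|chi`_j0|.
  have : (fun d => (2^-1 : R) ^+ d * S) @ \oo --> 0 * S.
    apply: cvgMl; apply: cvg_expr; rewrite ger0_norm ?invr_ge0//.
    by rewrite invf_lt1// ltr1n.
  rewrite mul0r => /cvgr_lt /(_ `|chi`_j0|); rewrite normr_gt0 => /(_ cj0).
  by case=> d _ /(_ d (leqnn d)) dS; exists d.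
exists d, j0 => p rho rho0 dp p0 x xr.
have pd := recurrence_derive dp p0 d.
have h0 k : 0 < (2^-1 : R) ^+ k by rewrite exprn_gt0// invr_gt0.
pose a := `|x|.
have cont y : `|y| < rho -> {for y, continuous (p d)}.
  by move=> yr; apply: differentiable_continuous; exact: (dp d y yr).1.
have ar : a < rho.
  by apply: lt_le_trans xr _; rewrite ler_piMl ?half_pow_le1// ltW//.
have in_rho y : y \in `[- a, a] -> `|y| < rho.
  by rewrite in_itv /= -ler_norml => ya; exact: le_lt_trans ya ar.
have a0 : 0 <= a by exact: normr_ge0.
have le_aa : - a <= a by rewrite ge0_cp.
have [|c cin cmax] := @EVT_max _ (fun y => `|p d y|) (- a) a le_aa.
  move=> y; apply: continuous_in_subspaceT => {}y.
  rewrite inE /= => /in_rho yr; apply: continuous_comp; first exact: cont.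
  exact: norm_continuous.
suff pc0 : p d c = 0.
  apply/eqP; rewrite -normr_eq0 eq_le normr_ge0 andbT.
  have := cmax x; rewrite pc0 normr0; apply.
  by rewrite in_itv /= -ler_norml.
have ca : `|c| <= a by move: cin; rewrite in_itv /= -ler_norml.
(* The recurrence is used at [y] so that the term [j0] is evaluated at the maximum point [c] and all
   later terms at points of [[-a, a]]; the radius [2^-1 ^+ j0 * rho] keeps [y] inside [rho]. *)
pose y := c / 2^-1 ^+ j0.
have yr : `|y| < rho.
  rewrite normrM normfV (gtr0_norm (h0 _)) ltr_pdivrMr// mulrC.
  exact: le_lt_trans ca xr.
have := pd y yr.
have szj : (j0 < size chi)%N.
  by rewrite ltnNge; apply/negP => /(nth_default 0) E; rewrite E eqxx in cj0.
rewrite (bigD1 (Ordinal szj)) //= => /eqP; rewrite addr_eq0 => /eqP E.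
have Ey : 2^-1 ^+ j0 * y = c by rewrite mulrC divfK// gt_eqF.
rewrite Ey in E.
apply/eqP/negPn/negP => pc0.
have : `|chi`_j0| * 2^-1 ^+ (j0 * d) * `|p d c| <=
    \sum_(j < size chi | j != Ordinal szj)
      `|chi`_j| * 2^-1 ^+ (j0 * d) * 2^-1 ^+ d * `|p d c|.
  rewrite -[X in _ * X * _ <= _](gtr0_norm (h0 _)) -!normrM E normrN.
  apply: le_trans (ler_norm_sum _ _ _) _; apply: ler_sum => j jj.
  have [jj0|j0j] := ltnP j j0.
    by rewrite lt0// !mul0r normr0 !mulr_ge0//; exact: ltW.
  have j0lt : (j0 < j)%N.
    by rewrite ltn_neqAle j0j andbT eq_sym; exact: jj.
  rewrite !normrM (gtr0_norm (h0 _)) -!mulrA.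
  apply: ler_wpM2l; first exact: normr_ge0.
  rewrite [leRHS]mulrA -exprD.
  have pj : `|p d (2^-1 ^+ j * y)| <= `|p d c|.
    apply: cmax; rewrite in_itv /= -ler_norml; apply: le_trans ca.
    have -> : 2^-1 ^+ j * y = 2^-1 ^+ (j - j0) * c.
      by rewrite -Ey mulrA -exprD subnK.
    by rewrite normrM (gtr0_norm (h0 _)) ler_piMl// half_pow_le1.
  have le1 : (2^-1 : R) <= 1 by rewrite invf_le1// ler1n.
  have le2 : (2^-1 : R) ^+ (j * d) <= 2^-1 ^+ (j0 * d + d).
    by apply: ler_wiXn2l; rewrite ?invr_ge0// addnC -mulSn leq_mul2r j0lt orbT.
  exact: ler_pM (ltW (h0 _)) (normr_ge0 _) le2 pj.
have c1 : 0 < `|p d c| by rewrite normr_gt0.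
rewrite -mulr_suml ler_pM2r// -!mulr_suml [_ * 2^-1 ^+ d]mulrAC ler_pM2r//.
rewrite leNgt => /negP; apply; apply: le_lt_trans dS; rewrite mulrC; apply: ler_wpM2l; first exact: ltW.
by rewrite /S [leRHS](bigD1 (Ordinal szj))//= lerDr//.
Qed.

(** Induction by integrating once: the shifted sequence gives the derivative as a polynomial [q],
    and [Q] is its primitive with constant term [p 0%N 0]. *)
Lemma derive_eq0_poly d p rho : 0 < rho ->
  (forall d x, `|x| < rho -> differentiable (p d) x /\ 'DD_1 (p d) x = p d.+1 x) ->
  (forall x, `|x| < rho -> p d x = 0) ->
  exists2 q : {poly R}, (size q <= d)%N & forall x, `|x| < rho -> p 0%N x = q.[x].
Proof.
move=> rho0; elim: d p => [|d IH] p dp p0.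
  by exists 0; [rewrite size_poly0|move=> x xr; rewrite horner0 p0].
have [q sq qE] := IH (fun k => p k.+1) (fun d x => @dp d.+1 x) p0.
pose Q := (p 0%N 0)%:P + \poly_(i < d.+1) (if i is k.+1 then q`_k / k.+1%:R else 0).
exists Q => [|x xr].
  rewrite (leq_trans (size_polyD _ _))// geq_max size_poly andbT.
  by rewrite (leq_trans (size_polyC_leq1 _)).
have dQ : Q^`() = q.
  apply/polyP => i; rewrite coef_deriv coefD coefC add0r coef_poly ltnS.
  have [id|di] := ltnP i d; last first.
    by rewrite mul0rn nth_default// (leq_trans sq).
  by rewrite -[LHS]mulr_natr divfK// pnatr_eq0.
have dqx (y : R) : differentiable (horner Q) y /\ 'DD_1 (horner Q) y = q.[y].
  have [h1 h2] := is_derive_poly Q y.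
  by split; [exact/derivable1_diffP|rewrite -ddE h2 dQ].
have : p 0%N x - Q.[x] = p 0%N 0 - Q.[0].
  apply: (@cst_of_derive0 (fun x => p 0%N x - Q.[x]) rho) => // y yr.
  have [d1 D1] := dp 0%N y yr; have [d2 D2] := dqx y.
  by split; [exact: dflB|rewrite (dvlB _ d1 d2) D1 D2 qE// subrr].
have -> : Q.[0] = p 0%N 0.
  by rewrite horner_coef0 coefD coefC eqxx coef_poly /= addr0.
by rewrite subrr => /eqP; rewrite subr_eq0 => /eqP.
Qed.
End OneVariable.

(** * Functions polynomial in each variable separately *)

Section SeparatelyPolynomial.
Variables (R : realType) (n : nat).
Implicit Types (t w : 'rV[R]_n) (i : 'I_n) (x : R).

Definition cube (rho : R) : set 'rV[R]_n := [set t | forall i, `|t 0 i| < rho].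

Definition upd t i x : 'rV[R]_n := \row_k (if k == i then x else t 0 k).

Lemma updE t i x : upd t i x = upd t i 0 + x *: ev R i.
Proof.
apply/rowP => k; rewrite !mxE eqxx /=.
by case: eqP => _ /=; rewrite ?mulr1 ?mulr0 ?add0r ?addr0.
Qed.

Lemma cube_upd rho t i x : cube rho t -> `|x| < rho -> cube rho (upd t i x).
Proof. by move=> ct xr k; rewrite mxE; case: eqP. Qed.

Lemma nbhs_cube (A : set 'rV[R]_n) : nbhs (0 : 'rV[R]_n) A ->
  exists2 rho : R, 0 < rho & cube rho `<=` A.
Proof.
move=> /nbhs_ballP[e /= e0 eA]; exists e => // t ct; apply: eA.
rewrite mx_norm_ball /ball_ /= sub0r normrN [ltLHS]/Num.Def.normr/= mx_normrE.
by apply: bigmax_lt => // -[i j] _; rewrite (ord1 i).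
Qed.

Definition monomial (m : {ffun 'I_n -> nat}) t : R := \prod_k t 0 k ^+ m k.

Definition poly_val (s : seq (R * {ffun 'I_n -> nat})) t : R :=
  \sum_(cm <- s) cm.1 * monomial cm.2 t.

Definition poly_on (A : set 'rV[R]_n) (f : 'rV[R]_n -> R) : Prop :=
  exists s, forall t, A t -> f t = poly_val s t.

Lemma poly_on_eq (A : set 'rV[R]_n) f g : (forall t, A t -> f t = g t) ->
  poly_on A f -> poly_on A g.
Proof. by move=> fg [s fs]; exists s => t At; rewrite -fg// fs. Qed.

Lemma poly_on_cst A (c : R) : poly_on A (fun _ => c).
Proof.
exists [:: (c, [ffun _ => 0%N])] => t _.
rewrite /poly_val big_seq1 /monomial big1 ?mulr1// => k _.
by rewrite ffunE expr0.
Qed.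

Lemma poly_onD A f g : poly_on A f -> poly_on A g -> poly_on A (fun t => f t + g t).
Proof.
move=> [s fs] [s' gs]; exists (s ++ s') => t At.
by rewrite /poly_val big_cat /= fs// gs.
Qed.

Lemma poly_onM_monomial A f (c : R) i l : poly_on A f ->
  poly_on A (fun t => f t * (c * t 0 i ^+ l)).
Proof.
move=> [s fs]; exists [seq (cm.1 * c, [ffun k => (cm.2 k + (k == i) * l)%N]) | cm : R * {ffun 'I_n -> nat} <- s].
move=> t At; rewrite fs// /poly_val big_map mulr_suml; apply: eq_bigr => cm _ /=.
suff -> : monomial [ffun k => (cm.2 k + (k == i) * l)%N] t
    = monomial cm.2 t * t 0 i ^+ l by ring.
rewrite /monomial (bigD1 i)//= [X in _ = X * _](bigD1 i)//= ffunE eqxx mul1n exprD.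
rewrite mulrAC -!mulrA; congr (_ * (_ * _)).
by apply: eq_bigr => k ki; rewrite ffunE (negbTE ki) addn0.
Qed.

Lemma poly_on_sum A (I : finType) (F : I -> 'rV[R]_n -> R) :
  (forall j, poly_on A (F j)) -> poly_on A (fun t => \sum_j F j t).
Proof.
move=> pF; elim: (index_enum I) => [|j s IH].
  by apply: (poly_on_eq _ (poly_on_cst A 0)) => t _; rewrite big_nil.
apply: (poly_on_eq _ (poly_onD (pF j) IH)) => t _.
by rewrite big_cons.
Qed.

(** The Vandermonde matrix of distinct nodes is invertible. Nodes and [B] do not depend on [q], so
    the coefficients of a slice of a function are fixed combinations of its values. *)
Lemma interpolation d (rho : R) : 0 < rho -> exists (a : 'I_d -> R) (B : 'M[R]_d),
  (forall k, `|a k| < rho) /\ forall q : {poly R}, (size q <= d)%N -> forall x,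
    q.[x] = \sum_k \sum_l q.[a k] * (B k l * x ^+ l).
Proof.
move=> rho0; pose a (k : 'I_d) : R := rho / (k%:R + 2).
pose av : 'rV[R]_d := \row_k a k.
have k2 (k : nat) : (1 : R) < k%:R + 2 by rewrite -[ltLHS]add0r ler_ltD ?ltr1n.
have k0 (k : nat) : (0 : R) < k%:R + 2 by apply: lt_trans (k2 k).
have uV : Vandermonde d av \in unitmx.
  rewrite unitmxE unitfE det_Vandermonde; apply/prodf_neq0 => i _.
  apply/prodf_neq0 => j ij; rewrite !mxE subr_eq0 /a.
  apply/eqP => /(mulfI (lt0r_neq0 rho0)) /invr_inj /addIr /eqP.
  by rewrite eqr_nat => /eqP ji; move: ij; rewrite ji ltnn.
exists a, (invmx (Vandermonde d av)); split=> [k|q sq x].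
  by rewrite gtr0_norm ?divr_gt0// ltr_pdivrMr// ltr_pMr.
pose c : 'rV[R]_d := \row_(l < d) q`_l.
have cV : c *m Vandermonde d av = \row_k q.[a k].
  apply/rowP => k; rewrite !mxE (horner_coef_wide _ sq); apply: eq_bigr => l _.
  by rewrite !mxE.
have cE : c = (\row_k q.[a k]) *m invmx (Vandermonde d av).
  by rewrite -cV -mulmxA mulmxV// mulmx1.
rewrite (horner_coef_wide _ sq) exchange_big; apply: eq_bigr => l _ /=.
have := congr1 (fun M : 'rV[R]_d => M 0 l) cE; rewrite !mxE => ->.
rewrite mulr_suml; apply: eq_bigr => k _; rewrite mxE; ring.
Qed.

Lemma separately_polynomial (P : 'rV[R]_n -> R) d rho : 0 < rho ->
  (forall i t, cube rho t -> exists2 q : {poly R}, (size q <= d)%N &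
     forall x, `|x| < rho -> P (upd t i x) = q.[x]) ->
  poly_on (cube rho) P.
Proof.
move=> rho0 sP; have [a [B [ar qE]]] := interpolation d rho0.
pose mix (s : seq 'I_n) t w : 'rV[R]_n := \row_k (if k \in s then t 0 k else w 0 k).
have cmix s t w : cube rho t -> cube rho w -> cube rho (mix s t w).
  by move=> ct cw k; rewrite mxE; case: ifP.
suff H s : uniq s -> forall w, cube rho w -> poly_on (cube rho) (fun t => P (mix s t w)).
  have c0 : cube rho 0 by move=> k; rewrite mxE normr0.
  apply: poly_on_eq (H (enum 'I_n) (enum_uniq _) 0 c0) => t _.
  by congr P; apply/rowP => k; rewrite mxE mem_enum.
elim: s => [_ w cw|i s IH /= /andP[is_ us] w cw].
  apply: poly_on_eq (poly_on_cst _ (P w)) => t _.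
  by congr P; apply/rowP => k; rewrite mxE.
apply: (@poly_on_eq _ (fun t => \sum_k \sum_l
    P (mix s t (upd w i (a k))) * (B k l * t 0 i ^+ l))); last first.
  apply: poly_on_sum => k; apply: poly_on_sum => l; apply: poly_onM_monomial.
  by apply: IH => //; exact: cube_upd.
move=> t ct; have [q sq Pq] := sP i (mix s t w) (cmix s t w ct cw).
have -> : mix (i :: s) t w = upd (mix s t w) i (t 0 i).
  by apply/rowP => k; rewrite !mxE inE; case: eqP => [->|].
rewrite Pq; last exact: ct.
rewrite (qE q sq); apply: eq_bigr => k _; apply: eq_bigr => l _.
rewrite -Pq//; congr (P _ * _); apply/rowP => k'; rewrite !mxE.
by case: eqP => [->|]; rewrite ?(negbTE is_).
Qed.

(** Equal exponents are collected and zero coefficients dropped; the leading-term arguments below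
    rely on [m] being injective and the [c j] nonzero. *)
Lemma poly_on_normal A f : poly_on A f ->
  exists (I : finType) (m : I -> {ffun 'I_n -> nat}) (c : I -> R),
  [/\ injective m, (forall j, c j != 0) &
      forall t, A t -> f t = \sum_j c j * monomial (m j) t].
Proof.
move=> [s fs].
pose C m := \sum_(cm <- s | cm.2 == m) cm.1.
pose r := [seq m <- undup [seq cm.2 | cm <- s] | C m != 0].
have ur : uniq r by rewrite filter_uniq// undup_uniq.
exists 'I_(size r), (tnth (in_tuple r)), (fun j => C (tnth (in_tuple r) j)); split.
- exact/tuple_uniqP.
- move=> j; have := mem_tnth j (in_tuple r).
  by rewrite memtE mem_filter => /andP[].
move=> t At; rewrite fs// -(big_tnth _ _ r xpredT (fun m => C m * monomial m t)).
rewrite /r big_filter big_mkcond /=.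
transitivity (\sum_(m <- undup [seq cm.2 | cm <- s])
    \sum_(cm <- s | cm.2 == m) cm.1 * monomial m t); last first.
  apply: eq_bigr => m _; rewrite -mulr_suml -/(C m).
  by case: ifPn => // /negPn/eqP ->; rewrite mul0r.
rewrite (exchange_big_dep xpredT) //= /poly_val; apply: eq_big_seq => cm cms.
rewrite big_mkcond (bigD1_seq cm.2) ?undup_uniq ?mem_undup ?map_f//=.
by rewrite eqxx big1 ?addr0// => m; rewrite eq_sym => /negbTE ->.
Qed.
End SeparatelyPolynomial.

Section FiniteRankPolynomial.
Variables (R : realType) (n : nat).
Implicit Types (t x y : 'rV[R]_n) (i k : 'I_n).

Lemma iter_half (i : 'I_n) j x :
  iter j (fun x => upd x i (2^-1 * x 0 i)) x = upd x i (2^-1 ^+ j * x 0 i).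
Proof.
elim: j => [|j IH] /=.
  by apply/rowP => k; rewrite !mxE expr0 mul1r; case: eqP => [->|].
rewrite IH; apply/rowP => k; rewrite !mxE eqxx exprS mulrA.
by case: eqP.
Qed.

(** Only the products [x_k y_k] enter the kernel, so halving [x_i] amounts to halving [y_i]: this is
    the shift relation of [finite_rank_recurrence]. The subtype [T] restricts to the cube on which
    the factorization holds. *)
Lemma toric_recurrence (P : 'rV[R]_n -> R) (r : R) i : 0 < r -> finite_rank r P ->
  exists2 chi : {poly R}, chi != 0 & forall t, cube (r * (r / 2)) t ->
    \sum_(j < size chi) chi`_j * P (upd t i (2^-1 ^+ j * t 0 i)) = 0.
Proof.
move=> r0 [N [u [v PE]]].
pose T := {x : 'rV[R]_n | `[< cube r x >]}.
have Tc (x : T) : cube r (sval x) by case: x => x /= /asboolP.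
have sc x : cube r x -> cube r (upd x i (2^-1 * x 0 i)).
  by move=> cx; apply: cube_upd => //; have := half_pow_lt 1 (cx i); rewrite expr1.
have sT (x : T) : `[< cube r (upd (sval x) i (2^-1 * sval x 0 i)) >].
  by apply/asboolP; exact/sc/Tc.
pose mkT x : `[< cube r x >] -> T := exist (fun x => `[< cube r x >]) x.
pose S (x : T) : T := mkT _ (sT x).
pose K (x y : T) := P (\row_k (sval x 0 k * sval y 0 k)).
have [|chi chi0 rec] := @finite_rank_recurrence R T T K N (fun (k : 'I_N) (x : T) => u k (sval x))
    (fun (k : 'I_N) (y : T) => v k (sval y)) S S (fun x y : T => PE _ _ (Tc x) (Tc y)).
  move=> x y; congr P; apply/rowP => k; rewrite !mxE.
  by case: eqP => [->|//]; ring.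
exists chi => // t ct.
have r2 : 0 < r / 2 by rewrite divr_gt0.
(* [t] is factored entrywise with second factor constantly [r / 2], whence the radius
   [r * (r / 2)]. *)
have cx : cube r (\row_k (t 0 k / (r / 2))).
  by move=> k; rewrite mxE normrM normfV (gtr0_norm r2) ltr_pdivrMr//; exact: ct.
have cy : cube r (const_mx (r / 2) : 'rV[R]_n).
  by move=> k; rewrite mxE (gtr0_norm r2) ltr_pdivrMr// ltr_pMr// ltr1n.
pose x0 : T := mkT _ (asboolT cx); pose y0 : T := mkT _ (asboolT cy).
have itS j : sval (iter j S x0) = upd (sval x0) i (2^-1 ^+ j * sval x0 0 i).
  by rewrite -iter_half; elim: j => //= j ->.
apply: etrans (rec x0 y0); apply: eq_bigr => j _; congr (_ * P _).
apply/rowP => k; rewrite mxE itS !mxE.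
have rn : r / 2 != 0 by rewrite gt_eqF.
by case: eqP => _; [rewrite -[RHS]mulrA divfK|rewrite divfK].
Qed.

Lemma toric_separately_poly (P : 'rV[R]_n -> R) (Omega : set 'rV[R]_n) (r : R) i :
  open Omega -> Omega 0 -> smooth_on Omega P -> 0 < r -> finite_rank r P ->
  exists (d : nat) (rho : R), 0 < rho /\ forall t, cube rho t ->
    exists2 q : {poly R}, (size q <= d)%N &
      forall x : R, `|x| < rho -> P (upd t i x) = q.[x].
Proof.
move=> oO O0 sP r0 fr.
have [chi chi0 rec] := toric_recurrence i r0 fr.
have [r1 r10 r1O] := nbhs_cube (open_nbhs_nbhs (conj oO O0)).
have [d [j0 dE]] := recurrence_derive_eq0 chi0.
have rr0 : 0 < r * (r / 2) by rewrite mulr_gt0// divr_gt0.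
pose rho := Num.min r1 (r * (r / 2)).
have rho0 : 0 < rho by rewrite lt_min r10.
have h0 : 0 < (2^-1 : R) ^+ j0 by rewrite exprn_gt0// invr_gt0.
exists d, (2^-1 ^+ j0 * rho); split=> [|t ct]; first exact: mulr_gt0.
have lerho : 2^-1 ^+ j0 * rho <= rho by rewrite ler_piMl ?half_pow_le1// ltW.
have ctr : cube rho t by move=> k; apply: lt_le_trans lerho.
have cO w : cube rho w -> Omega w.
  by move=> cw; apply: r1O => k; apply: lt_le_trans (cw k) _; rewrite ge_min lexx.
have cr (w : 'rV[R]_n) : cube rho w -> cube (r * (r / 2)) w.
  by move=> cw k; apply: lt_le_trans (cw k) _; rewrite ge_min lexx orbT.
pose p e (x : R) := iter_derive P (nseq e (ev R i)) (upd t i x).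
have dp e (x : R) : `|x| < rho -> differentiable (p e) x /\ 'DD_1 (p e) x = p e.+1 x.
  move=> xr; have Ox : Omega (upd t i 0 + x *: ev R i).
    by rewrite -updE; apply: cO; exact: cube_upd.
  have dP := sP (nseq e (ev R i)) _ Ox.
  have [h1 h2] := line_derive dP.
  have pE : p e = fun x : R => iter_derive P (nseq e (ev R i)) (upd t i 0 + x *: ev R i).
    by apply/funext => x'; rewrite /p updE.
  split; first by rewrite pE; exact/derivable1_diffP.
  by rewrite /p -ddE -/(p e) pE h2 /= ddE -updE.
have p0 (x : R) : `|x| < rho -> \sum_(j < size chi) chi`_j * p 0%N (2^-1 ^+ j * x) = 0.
  move=> xr; have E := rec (upd t i x) (cr _ (cube_upd i ctr xr)).
  apply: etrans E.
  apply: eq_bigr => j _; congr (_ * P _); apply/rowP => k; rewrite !mxE eqxx.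
  by case: eqP.
have dp' e (x : R) : `|x| < 2^-1 ^+ j0 * rho ->
    differentiable (p e) x /\ 'DD_1 (p e) x = p e.+1 x.
  by move=> xr; apply: dp; exact: lt_le_trans lerho.
exact: (derive_eq0_poly (mulr_gt0 h0 rho0) dp' (dE p rho rho0 dp p0)).
Qed.

Lemma finite_rank_polynomial (P : 'rV[R]_n -> R) (Omega : set 'rV[R]_n) (r : R) :
  open Omega -> Omega 0 -> smooth_on Omega P -> 0 < r -> finite_rank r P ->
  exists rho : R, 0 < rho /\
  exists (I : finType) (m : I -> {ffun 'I_n -> nat}) (c : I -> R),
  [/\ injective m, (forall j, c j != 0) &
      forall t, cube rho t -> P t = \sum_j c j * monomial (m j) t].
Proof.
move=> oO O0 sP r0 fr.
have /choice[d] := fun i => toric_separately_poly i oO O0 sP r0 fr.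
move=> /choice[s sE].
(* [S^-1] is a positive radius below every [s i]; likewise the sum of the [d i] bounds each of
   them. *)
pose S := 1 + \sum_i (s i)^-1.
have sV i : 0 <= (s i)^-1 by rewrite invr_ge0 ltW// (sE i).1.
have S0 : 0 < S by rewrite ltr_pwDl// sumr_ge0.
have Ss i : S^-1 <= s i.
  have s0 := (sE i).1; rewrite -[leRHS]invrK lef_pV2 ?posrE ?invr_gt0//.
  rewrite /S (bigD1 i)//= addrCA lerDl addr_ge0// sumr_ge0//.
have SV : 0 < S^-1 by rewrite invr_gt0.
exists S^-1; split=> //; apply: poly_on_normal.
apply: (@separately_polynomial _ _ P (\sum_i d i)) => // i t ct.
have [q sq qE] := (sE i).2 t (fun k => lt_le_trans (ct k) (Ss i)).
exists q; first by rewrite (leq_trans sq)// (bigD1 i)//= leq_addr.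
by move=> x xr; apply: qE; exact: lt_le_trans (Ss i).
Qed.
End FiniteRankPolynomial.

(** * Determinants of exponential sums *)

Lemma base_expansion_inj K n (m m' : 'I_n -> nat) :
  (forall k, (m k < K)%N) -> (forall k, (m' k < K)%N) ->
  (\sum_k m k * K ^ k = \sum_k m' k * K ^ k)%N -> m =1 m'.
Proof.
elim: n m m' => [m m' _ _ _ [[]]//|n IH] m m' mK m'K.
rewrite !big_ord_recl /= !expn0 !muln1.
have E (f : 'I_n.+1 -> nat) : (\sum_(i < n) f (lift ord0 i) * K ^ bump 0 i
    = K * \sum_(i < n) f (lift ord0 i) * K ^ i)%N.
  rewrite big_distrr; apply: eq_bigr => i _ /=.
  by rewrite /bump /= add1n expnS mulnCA.
rewrite !E => Em.
have m0 : m ord0 = m' ord0.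
  have := congr1 (modn^~ K) Em.
  by rewrite /= ![(_ ord0 + K * _)%N]addnC ![(K * _)%N]mulnC !modnMDl !modn_small.
have K0 : (0 < K)%N by exact: leq_ltn_trans (mK ord0).
move: Em; rewrite m0 => /addnI /eqP; rewrite eqn_pmul2l// => /eqP /IH mm.
have {}mm := mm (fun k => mK _) (fun k => m'K _).
by move=> k; case: (unliftP ord0 k) => [j|] ->.
Qed.

Section PolyDegrees.
Variable R : idomainType.

(** Upper bounds [d] take the place of degrees, so that factors may vanish or have lower degree; the
    top coefficient stays multiplicative. *)
Lemma coef_prod_top (n : nat) (F : 'I_n -> {poly R}) (d : 'I_n -> nat) :
  (forall a, size (F a) <= (d a).+1)%N ->
  (\prod_a F a)`_(\sum_a d a) = \prod_a (F a)`_(d a) /\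
  (size (\prod_a F a)%R <= (\sum_a d a).+1)%N.
Proof.
move=> sF; elim/big_rec3: _ => [|a x s p _ [IH1 IH2]].
  by rewrite coef1 size_poly1.
split; last first.
  rewrite (leq_trans (size_polyMleq _ _))// -subn1 leq_subLR.
  by rewrite (leq_trans (leq_add (sF a) IH2))// addSn addnS add1n.
rewrite coefM (bigD1 (inord (d a))) //=.
rewrite inordK ?ltnS ?leq_addr// addKn IH1 big1 ?addr0// => i ia.
have [id|di] := ltnP i (d a); last first.
  have {}di : (d a < i)%N.
    rewrite ltn_neqAle di andbT; apply: contraNneq ia => E.
    by apply/eqP/val_inj; rewrite /= inordK ?E ?ltn_ord// ltnS leq_addr.
  by rewrite (nth_default _ (leq_trans (sF a) di)) mul0r.
rewrite [X in _ * X]nth_default ?mulr0// (leq_trans IH2)//.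
by lia.
Qed.

Lemma size_det_le n (A : 'M[{poly R}]_n) s :
  (forall i j, (size (A i j) <= s.+1)%N) -> (size (\det A) <= (n * s).+1)%N.
Proof.
move=> sA; rewrite /determinant (leq_trans (size_sum _ _ _))//.
apply/bigmax_leqP => sg _; rewrite size_Msign.
have [_] := @coef_prod_top n (fun a => A a (sg a)) (fun _ => s) (fun a => sA _ _).
by rewrite sum_nat_const card_ord.
Qed.

Lemma coef_det_top n (A : 'M[{poly R}]_n) (d : 'I_n -> nat) (a : 'I_n -> R) :
  (forall i j, (size (A i j) <= (d i).+1)%N) ->
  (forall i j, (A i j)`_(d i) = (i == j)%:R * a i) ->
  (\det A)`_(\sum_i d i) = \prod_i a i.
Proof.
move=> sA cA.
transitivity (\det (diag_mx (\row_i a i))); last first.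
  by rewrite det_diag; apply: eq_bigr => i _; rewrite mxE.
rewrite /determinant coef_sum; apply: eq_bigr => sg _.
have -> : (-1) ^+ sg = ((-1) ^+ sg)%:P :> {poly R} by rewrite rmorphXn /= polyCN.
rewrite coefCM; congr (_ * _).
rewrite (@coef_prod_top n (fun a => A a (sg a)) d (fun a => sA _ _)).1.
apply: eq_bigr => i _; rewrite cA !mxE -mulr_natl.
by case: eqP => //; rewrite ?mul0r ?mul1r.
Qed.
End PolyDegrees.

Section ExponentialSums.
Variables (R : realFieldType) (n : nat) (I : finType).
Variables (m : I -> {ffun 'I_n -> nat}) (c : I -> R) (w : 'I_n -> nat).
Hypotheses (c0 : forall j, c j != 0) (w0 : forall k, (0 < w k)%N).

Definition wdeg j := (\sum_k m j k * w k)%N.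
Hypothesis winj : injective wdeg.

(** The image of [sum_j b_j t^(m_j)] under [t_k = X^(w_k)]. With [winj] no two monomials merge, and
    [t_i d/dt_i] acts by multiplying [b j] by [m j i]. *)
Definition expsum (b : I -> R) : {poly R} := \sum_j b j *: 'X^(wdeg j).

Lemma coef_expsum b j : (expsum b)`_(wdeg j) = b j.
Proof.
rewrite coef_sum (bigD1 j)//= coefZ coefXn eqxx mulr1 big1 ?addr0// => l lj.
rewrite coefZ coefXn; case: eqP => [/winj jl|_]; last by rewrite mulr0.
by move: lj; rewrite jl eqxx.
Qed.

Lemma size_expsum b d : (forall j, b j != 0 -> (wdeg j <= d)%N) ->
  (size (expsum b) <= d.+1)%N.
Proof.
move=> bd; rewrite (leq_trans (size_sum _ _ _))//; apply/bigmax_leqP => j _.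
have [->|/bd jd] := eqVneq (b j) 0; first by rewrite scale0r size_poly0.
by rewrite (leq_trans (size_scale_leq _ _))// size_polyXn.
Qed.

Lemma size_expsum_sub (b : I -> R) : (size (expsum (fun j => (c j * b j)%R)) <= size (expsum c))%N.
Proof.
have le j : (wdeg j <= (size (expsum c)).-1)%N.
  have : (wdeg j < size (expsum c))%N.
    rewrite ltnNge; apply/negP => /(nth_default 0); rewrite coef_expsum => cj.
    by have := c0 j; rewrite cj eqxx.
  by case: (size _).
have [I0|/card_gt0P[j _]] := posnP #|I|.
  rewrite /expsum !big1 // => j _; by have := card0_eq I0 j; rewrite inE.
have s0 : (0 < size (expsum c))%N.
  rewrite lt0n size_poly_eq0; apply: contra (c0 j) => /eqP e0.
  by rewrite -(coef_expsum c j) e0 coef0.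
by rewrite -[leqRHS]prednK//; apply: size_expsum => l _; exact: le.
Qed.

(* Every entry has degree at most [2 deg Q], so the left-hand side has degree at
   most [2 n deg Q]. *)
Lemma hessian_det_ratio_neq (C : R) : (0 < n)%N -> C != 0 -> expsum c != 0 ->
  let Q := expsum c in
  let Q1 i := expsum (fun j => c j * (m j i)%:R) in
  let Q2 i k := expsum (fun j => c j * ((m j i)%:R * (m j k)%:R)) in
  \det (\matrix_(i < n, k < n) (Q * Q2 i k - Q1 i * Q1 k)) <>
    C *: (Q ^+ (2 * n) * 'X^(\sum_k w k)).
Proof.
move=> n0 C0 Q0 Q Q1 Q2 E.
have [D sQ] : exists D, size Q = D.+1.
  by exists (size Q).-1; rewrite prednK// lt0n size_poly_eq0.
have s1 i : (size (Q1 i) <= D.+1)%N by rewrite -sQ; exact: size_expsum_sub.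
have s2 i k : (size (Q2 i k) <= D.+1)%N by rewrite -sQ; exact: size_expsum_sub.
have sM (p q : {poly R}) : (size p <= D.+1)%N -> (size q <= D.+1)%N ->
    (size (p * q)%R <= (D + D).+1)%N.
  by move=> sp sq; rewrite (leq_trans (size_polyMleq _ _))//; lia.
have : (size (C *: (Q ^+ (2 * n) * 'X^(\sum_k w k))) <= (n * (D + D)).+1)%N.
  rewrite -E; apply: size_det_le => i k; rewrite mxE.
  rewrite (leq_trans (size_polyD _ _))// geq_max size_polyN !sM ?sQ//.
rewrite size_scale// size_mulXn ?expf_neq0//.
have := size_exp Q (2 * n); rewrite sQ /= => sE.
have sQn : (0 < size (Q ^+ (2 * n)))%N by rewrite lt0n size_poly_eq0 expf_neq0.
have W0 : (0 < \sum_k w k)%N.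
  by rewrite (bigD1 (Ordinal n0))//= addn_gt0 w0.
move: sQn sE; case: (size (Q ^+ (2 * n))) => // e _ /= ->.
have -> : (n * (D + D) = D * (2 * n))%N by lia.
by rewrite addnS ltnS -[leqRHS]add0n leq_add2r leqNgt W0.
Qed.

Definition mrow j : 'rV[R]_n := \row_k (m j k)%:R.
Definition mbasis (b : {ffun 'I_n -> I}) : 'M[R]_n := \matrix_(a, k) (m (b a) k)%:R.

Definition exchange (b : {ffun 'I_n -> I}) a j : {ffun 'I_n -> I} :=
  [ffun i => if i == a then j else b i].

(** Steinitz exchange: a null vector of the new matrix, rewritten through the expansion of [mrow j],
    becomes a null vector [y] of the old one. *)
Lemma exchange_unit b a j : mbasis b \in unitmx ->
  (mrow j *m invmx (mbasis b)) 0 a != 0 -> mbasis (exchange b a j) \in unitmx.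
Proof.
move=> ub ca; rewrite unitmxE unitfE; apply/negP => /det0P[x x0 xB].
set cf := mrow j *m invmx (mbasis b) in ca.
pose y : 'rV[R]_n := (\row_i (if i == a then 0 else x 0 i)) + x 0 a *: cf.
have yB : y *m mbasis b = 0.
  rewrite -xB /y mulmxDl -scalemxAl /cf mulmxKV//; apply/rowP => k.
  rewrite !mxE (bigD1 a)//= !mxE eqxx mul0r add0r [RHS](bigD1 a)//= !mxE ffunE eqxx.
  rewrite addrC; congr (_ + _); apply: eq_bigr => i ia.
  by rewrite !mxE ffunE (negbTE ia).
have y0 : y = 0 by rewrite -[y](mulmxK ub) yB mul0mx.
have xa : x 0 a = 0.
  have := congr1 (fun M : 'rV[R]_n => M 0 a) y0; rewrite !mxE eqxx add0r => /eqP.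
  by rewrite mulf_eq0 => /orP[/eqP//|]; rewrite mxE in ca; rewrite (negbTE ca).
move/eqP: x0; apply; apply/rowP => i; rewrite mxE.
have := congr1 (fun M : 'rV[R]_n => M 0 i) y0; rewrite !mxE xa mul0r addr0.
by case: eqP => [->|].
Qed.

Lemma expsum_congruence (B : 'M[R]_n) (cf : I -> 'rV[R]_n) :
  (forall j, mrow j = cf j *m B) ->
  \matrix_(i < n, k < n) expsum (fun j => c j * ((m j i)%:R * (m j k)%:R)) =
  (map_mx polyC B)^T *m
    (\matrix_(a, a') expsum (fun j => c j * (cf j 0 a * cf j 0 a'))) *m
  map_mx polyC B.
Proof.
move=> cfB; apply/matrixP => i k; rewrite !mxE.
have mE j l : (m j l)%:R = \sum_a cf j 0 a * B a l.
  by have := congr1 (fun M : 'rV[R]_n => M 0 l) (cfB j); rewrite !mxE.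
transitivity (\sum_a' \sum_a \sum_j
    (c j * (cf j 0 a * B a i) * (cf j 0 a' * B a' k)) *: 'X^(wdeg j)).
  rewrite exchange_big /=; under [RHS]eq_bigr do rewrite exchange_big /=.
  rewrite exchange_big /=; apply: eq_bigr => j _.
  rewrite !mE; under [RHS]eq_bigr do rewrite -scaler_suml.
  rewrite -scaler_suml; congr (_ *: _); rewrite big_distrlr /= mulr_sumr.
  apply: eq_bigr => a _; rewrite mulr_sumr; apply: eq_bigr => a' _.
  by rewrite !mulrA.
apply: eq_bigr => a' _; rewrite !mxE mulr_suml; apply: eq_bigr => a _.
rewrite !mxE /expsum mulr_sumr mulr_suml; apply: eq_bigr => j _.
by rewrite -!mul_polyC !polyCM; ring.
Qed.

Definition bweight (b : {ffun 'I_n -> I}) := (\sum_a wdeg (b a))%N.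

Lemma bweight_exchange b a j :
  (bweight (exchange b a j) + wdeg (b a) = bweight b + wdeg j)%N.
Proof.
rewrite /bweight (bigD1 a)//= [in RHS](bigD1 a)//= ffunE eqxx.
rewrite (eq_bigr (fun i => wdeg (b i))) => [|i ia]; last by rewrite ffunE (negbTE ia).
by rewrite [LHS]addnC addnCA [RHS]addnC.
Qed.

Definition unit_vec (i : 'I_n) : {ffun 'I_n -> nat} := [ffun k => nat_of_bool (k == i)].

(* Among the bases formed by exponent vectors take one of maximal weight. Its
   product of monomials is the leading term of the determinant; the given value
   of the determinant then shows that the basis of unit vectors has maximal
   weight too, and an exchange argument leaves no room for other exponents. *)
Lemma hessian_det_monomial_linear (C : R) (iu : 'I_n -> I) :
  (forall i, m (iu i) = unit_vec i) ->
  \det (\matrix_(i < n, k < n) expsum (fun j => c j * ((m j i)%:R * (m j k)%:R)))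
    = C *: 'X^(\sum_k w k) ->
  forall j, (forall k, m j k = 0%N) \/ exists i, m j = unit_vec i.
Proof.
move=> iuE detE.
pose b0 : {ffun 'I_n -> I} := [ffun i => iu i].
have b01 : mbasis b0 = 1%:M.
  by apply/matrixP => i k; rewrite !mxE ffunE iuE ffunE eq_sym.
have P0 : mbasis b0 \in unitmx by rewrite b01 unitmx1.
have [b ub bmax] := @arg_maxnP _ b0 (fun b => mbasis b \in unitmx) bweight P0.
have exch b' a j : mbasis b' \in unitmx -> bweight b' = bweight b ->
    (mrow j *m invmx (mbasis b')) 0 a != 0 -> (wdeg j <= wdeg (b' a))%N.
  move=> ub' Wb' cf; have := bmax _ (exchange_unit ub' cf).
  by have := bweight_exchange b' a j; lia.
have W0 : bweight b0 = (\sum_k w k)%N.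
  apply: eq_bigr => i _; rewrite /wdeg ffunE iuE (bigD1 i)//= ffunE eqxx mul1n.
  by rewrite big1 ?addn0// => k ki; rewrite ffunE (negbTE ki).
(* In coordinates relative to the maximal basis, row [a] has degree at most [wdeg (b a)] with
   diagonal top coefficients, so the determinant has coefficient [det B ^+ 2] times a product of
   [c]'s, nonzero, at [bweight b]. A single monomial then forces the weight. *)
have Wb : bweight b = bweight b0.
  rewrite W0; pose B := mbasis b.
  pose cf j := mrow j *m invmx B.
  have cfB j : mrow j = cf j *m B by rewrite /cf mulmxKV.
  pose Ht : 'M[{poly R}]_n := \matrix_(a, a')
    expsum (fun j => c j * (cf j 0 a * cf j 0 a')).
  have HE := expsum_congruence cfB; rewrite -/Ht in HE.
  have sHt a a' : (size (Ht a a') <= (wdeg (b a)).+1)%N.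
    rewrite mxE; apply: size_expsum => j cj; apply: exch => //.
    by apply: contraNneq cj => cf0; rewrite /cf cf0 mul0r mulr0.
  have cfb a a' : cf (b a) 0 a' = (a == a')%:R.
    have -> : cf (b a) = row a (B *m invmx B).
      by rewrite row_mul; congr (_ *m _); apply/rowP => k; rewrite !mxE.
    by rewrite mulmxV// !mxE.
  have cHt a a' : (Ht a a')`_(wdeg (b a)) = (a == a')%:R * c (b a).
    by rewrite mxE coef_expsum !cfb eqxx mul1r mulrC.
  have := coef_det_top sHt cHt; rewrite -/(bweight b) => detHt.
  have dB : \det B != 0 by rewrite -unitfE -unitmxE.
  have : (C *: 'X^(\sum_k w k))`_(bweight b) = \det B ^+ 2 * \prod_a c (b a).
    rewrite -detE HE !det_mulmx det_tr det_map_mx -detHt /=.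
    rewrite (_ : _ * _ * _ = (\det B ^+ 2)%:P * \det Ht); first by rewrite coefCM.
    by rewrite expr2 polyCM; ring.
  rewrite coefZ coefXn; case: eqP => // _; rewrite mulr0 => /esym/eqP.
  rewrite mulf_eq0 expf_eq0 (negbTE dB) /= => /prodf_eq0[a _].
  by rewrite (negbTE (c0 _)).
move=> j.
case: (pickP (fun k => m j k != 0%N)) => [i mi|m0]; [right|left]; last first.
  by move=> k; apply/eqP; move/negbFE: (m0 k).
(* As [m j i != 0], the exponent of [j] can replace the [i]-th unit vector in a basis of maximal
   weight, so it weighs at most [w i]; positive weights leave only the unit vector itself. *)
exists i; have : (wdeg j <= wdeg (b0 i))%N.
  apply: exch => //.
  by rewrite b01 invmx1 mulmx1 mxE pnatr_eq0.
have -> : wdeg (b0 i) = w i.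
  rewrite /wdeg ffunE iuE (bigD1 i)//= ffunE eqxx mul1n.
  by rewrite big1 ?addn0// => k ki; rewrite ffunE (negbTE ki).
rewrite /wdeg (bigD1 i)//= => le.
have mi1 : m j i = 1%N.
  have := w0 i; have : (m j i * w i <= w i)%N by exact: leq_trans (leq_addr _ _) le.
  by move: mi; case: (m j i) => [|[|k]]// _; nia.
move: le; rewrite mi1 mul1n -[leqRHS]addn0 leq_add2l leqn0 sum_nat_eq0.
move=> /forallP z; apply/ffunP => k; rewrite ffunE; case: (eqVneq k i) => [->|ki].
  by rewrite mi1.
have := z k; rewrite ki /= muln_eq0 => /orP[/eqP//|].
by have := w0 k; lia.
Qed.
End ExponentialSums.

(** The logarithmic derivative removes the exponential: [X Q' = Q (k + mu X q')]. If [q] is not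
    constant, the right side has larger degree than [Q], the left side does not. *)
Lemma det_exp_poly_cst (R : realType) (Q q : {poly R}) (C mu d : R) (k : nat) :
  C != 0 -> 0 < d ->
  (forall x, 0 < x < d -> Q.[x] = C * x ^+ k * expR (mu * q.[x])) ->
  mu != 0 -> (size q <= 1)%N.
Proof.
move=> C0 d0 QE mu0; rewrite leqNgt; apply/negP => sq.
pose V := [set x : R | 0 < x < d].
have oV : open V.
  rewrite openE => x /andP[x0 xd]; near=> y; apply/andP; split; near: y.
    exact: lt_nbhsr.
  exact: lt_nbhsl.
have dh (p : {poly R}) (y : R) : differentiable (horner p) y /\ 'DD_1 (horner p) y = p^`().[y].
  have [h1 h2] := is_derive_poly p y.
  by split; [exact/derivable1_diffP|rewrite -ddE h2].
have key x : V x -> x * Q^`().[x] = Q.[x] * (k%:R + mu * (x * q^`().[x])).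
  move=> Vx; have x0 : 0 < x by case/andP: Vx.
  have [dq Dq] := dh q x; have [dX DX] := dh ('X^k) x.
  have E : forall y, V y -> Q.[y] = C * ('X^k).[y] * expR (mu * q.[y]).
    by move=> y Vy; rewrite QE// hornerXn.
  have := eq_derive_open (1 : R) oV Vx E.
  have dm := dflM (dfl_cst mu x) dq.
  have de := dfl_comp dm (is_derive_expR (mu * q.[x])).
  rewrite (dh Q x).2 (dvlM _ (dflM (dfl_cst C x) dX) de) (dvlZ _ _ dX) DX.
  rewrite (dvl_comp _ dm (is_derive_expR (mu * q.[x]))) (dvlZ _ _ dq) Dq => ->.
  rewrite QE// derivXn hornerMn !hornerXn.
  case: (k) => [|k']; first by rewrite mulr0n expr0; ring.
  by rewrite /= -mulr_natr exprS; ring.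
have poly_key : 'X * Q^`() = Q * (k%:R%:P + mu *: ('X * q^`())).
  apply/eqP; rewrite -subr_eq0; apply/eqP/(poly_eq0_near d0) => x xd.
  by rewrite hornerD hornerN !hornerM hornerX hornerD hornerC hornerZ hornerM hornerX key ?subrr.
have Q0 : Q != 0.
  apply/eqP => Q0; have hd : 0 < d / 2 < d by rewrite divr_gt0//= ltr_pdivrMr// ltr_pMr// ltr1n.
  have := QE _ hd; rewrite Q0 horner0 => /esym/eqP.
  rewrite !mulf_eq0 (negbTE C0) expf_eq0 (gt_eqF (expR_gt0 _)) orbF /=.
  by case/andP: hd => h _; rewrite (gt_eqF h) andbF.
have qd0 : q^`() != 0.
  have q0 : q != 0 by rewrite -size_poly_gt0; exact: ltnW.
  apply/eqP => /(congr1 (fun p : {poly R} => p`_(size q).-2)) /eqP.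
  rewrite coef_deriv coef0 mulrn_eq0 /= -[(size q).-2.+1](_ : (size q).-1 = _).
    by rewrite -lead_coefE lead_coef_eq0 (negbTE q0).
  by move: sq; case: (size q) => [|[]].
have sX : (1 < size ('X * q^`())%R)%N.
  by rewrite mulrC size_mulX// ltnS size_poly_gt0.
have sK : (1 < size (k%:R%:P + mu *: ('X * q^`()))%R)%N.
  rewrite addrC size_polyDl size_scale//.
  exact: leq_ltn_trans (size_polyC_leq1 _) sX.
have K0 : k%:R%:P + mu *: ('X * q^`()) != 0.
  by rewrite -size_poly_gt0; exact: ltnW.
have sQ : (0 < size Q)%N by rewrite size_poly_gt0.
move: poly_key sK K0; set K := k%:R%:P + _ => poly_key sK K0.
have := congr1 (fun p : {poly R} => size p) poly_key.
rewrite (size_mul Q0 K0); have [->|Qd0] := eqVneq Q^`() 0.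
  rewrite mulr0 size_poly0; move: sQ sK; move: (size Q) (size K) => a b; lia.
rewrite mulrC size_mulX//; have := lt_size_deriv Q0.
by move: sQ sK; move: (size Q) (size K) (size Q^`()) => a b e; lia.
Unshelve. all: by end_near. Qed.

(** * Local rigidity *)

Section ToricExpansion.
Variables (R : realType) (n : nat).
Implicit Types (t : 'rV[R]_n) (z q : Dn R n) (i k l : 'I_n).

Lemma dfl_power l e t : differentiable (fun t : 'rV[R]_n => t 0 l ^+ e) t /\
  t 0 l * 'DD_(ev R l) (fun t : 'rV[R]_n => t 0 l ^+ e) t = e%:R * t 0 l ^+ e /\
  forall k, k != l -> 'DD_(ev R k) (fun t : 'rV[R]_n => t 0 l ^+ e) t = 0.
Proof.
have dc : differentiable (fun t : 'rV[R]_n => t 0 l : R) t by exact: differentiable_coord.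
have cL : linear (fun x : 'rV[R]_n => x 0 l : R) by move=> a x y; rewrite !mxE.
have dp := is_derive_poly ('X^e) (t 0 l).
have E : (fun t : 'rV[R]_n => t 0 l ^+ e) = fun t => ('X^e).[t 0 l].
  by apply/funext => u; rewrite hornerXn.
rewrite E; split; first exact: dfl_comp dc dp.
split=> [|k kl]; rewrite (dvl_comp _ dc dp) (dvl_linear _ _ cL) mxE eqxx /=.
  rewrite derivXn hornerMn !hornerXn eqxx mulr1; case: e {dp E} => [|e].
    by rewrite mulr0n mulr0 mul0r.
  by rewrite /= -mulr_natr exprS; ring.
by rewrite eq_sym (negbTE kl) mulr0.
Qed.

Lemma dfl_monomial m t : differentiable (@monomial R n m) t.
Proof. by apply: dfl_prod => k; have [] := dfl_power k (m k) t. Qed.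

Lemma dvl_monomial m t l :
  t 0 l * 'DD_(ev R l) (@monomial R n m) t = (m l)%:R * monomial m t.
Proof.
rewrite /monomial (dvl_prod _ (index_enum_uniq _)) => [|k]; last first.
  by have [] := dfl_power k (m k) t.
rewrite (bigD1 l)//= [X in _ + X]big1 ?addr0 => [|i il]; last first.
  rewrite (bigD1 i)//= eqxx; have [_ [_ ->]] := dfl_power i (m i) t; first by rewrite mul0r.
  by rewrite eq_sym.
rewrite (bigD1 l)//= eqxx mulrA; have [_ [-> _]] := dfl_power l (m l) t.
rewrite [in RHS](bigD1 l)//= mulrA; congr (_ * _).
by apply: eq_bigr => k kl; rewrite (negbTE kl).
Qed.

Variables (V : set (Dn R n)) (G : Dn R n -> R) (I : finType).
Variables (m : I -> {ffun 'I_n -> nat}) (c : I -> R).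
Hypotheses (oV : open V) (sG : smooth_on V G).

Lemma xi_DX_expansion (c' : I -> R) (F : Dn R n -> R) i z : V z ->
  (forall q, V q -> F q = \sum_j c' j * monomial (m j) (tz q)) ->
  xi z i * 'DD_(Xf R i) F z = \sum_j c' j * (m j i)%:R * monomial (m j) (tz z).
Proof.
move=> Vz FE; rewrite (eq_derive_open _ oV Vz FE).
have dm j : differentiable (fun q => monomial (m j) (tz q)) z.
  exact: (differentiable_comp (dfl_tz z) (dfl_monomial _ _)).
rewrite dvl_sum => [|j _]; last exact: dflM (dfl_cst _ z) (dm j).
rewrite mulr_sumr; apply: eq_bigr => j _.
rewrite (dvlZ _ _ (dm j)) (dX_toric i (dfl_monomial (m j) (tz z))).
by rewrite mulrCA -!mulrA; congr (_ * _); rewrite mulrA -tzE dvl_monomial.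
Qed.

Lemma eta_DY_expansion (c' : I -> R) (F : Dn R n -> R) i z : V z ->
  (forall q, V q -> F q = \sum_j c' j * monomial (m j) (tz q)) ->
  eta z i * 'DD_(Yf R i) F z = \sum_j c' j * (m j i)%:R * monomial (m j) (tz z).
Proof.
move=> Vz FE; rewrite (eq_derive_open _ oV Vz FE).
have dm j : differentiable (fun q => monomial (m j) (tz q)) z.
  exact: (differentiable_comp (dfl_tz z) (dfl_monomial _ _)).
rewrite dvl_sum => [|j _]; last exact: dflM (dfl_cst _ z) (dm j).
rewrite mulr_sumr; apply: eq_bigr => j _.
rewrite (dvlZ _ _ (dm j)) (dY_toric i (dfl_monomial (m j) (tz z))).
rewrite mulrCA -!mulrA; congr (_ * _).
by rewrite mulrA [eta z i * _]mulrC -tzE dvl_monomial.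
Qed.

Hypothesis GE : forall q, V q -> G q = \sum_j c j * monomial (m j) (tz q).

(** With the factors [xi_i] and [eta_k] the derivatives become logarithmic ones, which act
    diagonally on monomials and need no subtraction of exponents. *)
Lemma hess_expansion i k z : V z -> xi z i * eta z k * hess G i k z =
  \sum_j c j * (m j k)%:R * (m j i)%:R * monomial (m j) (tz z).
Proof.
move=> Vz; have dY := smooth_dfl (smooth_drv (Yf R k) sG) Vz.
have := xi_DX_expansion i Vz (fun q Vq => eta_DY_expansion k Vq GE).
rewrite (dvlM _ (dfl_eta k z) dY) dvl_eta eta_X mul0r add0r -hessE => <-.
by rewrite mulrA.
Qed.
End ToricExpansion.

Section Curve.
Variables (R : realType) (n : nat) (I : finType).
Variables (m : I -> {ffun 'I_n -> nat}) (kap : 'I_n -> nat).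
Hypothesis kap0 : forall k, (0 < kap k)%N.

Let w k := (2 * kap k)%N.

Definition crow (x : R) : 'rV[R]_n := \row_k x ^+ kap k.
Definition curve (x : R) : Dn R n := pt (crow x) (crow x).

Lemma tz_curve x k : tz (curve x) 0 k = x ^+ w k.
Proof. by rewrite tzE xi_pt eta_pt !mxE -exprD addnn -mul2n. Qed.

Lemma monomial_curve x j : monomial (m j) (tz (curve x)) = x ^+ wdeg m w j.
Proof.
rewrite /monomial /wdeg expr_sum; apply: eq_bigr => k _.
by rewrite tz_curve -exprM mulnC.
Qed.

Lemma expsum_curve b x :
  (expsum m w b).[x] = \sum_j b j * monomial (m j) (tz (curve x)).
Proof.
rewrite horner_sum; apply: eq_bigr => j _.
by rewrite hornerZ hornerXn monomial_curve.
Qed.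

Lemma curve_small (x : R) e : 0 < x < 1 -> (0 < e)%N -> `|x ^+ e| <= x.
Proof.
move=> /andP[/ltW x0 /ltW x1] e0; rewrite ger0_norm ?exprn_ge0//.
by rewrite -(prednK e0) exprS ler_piMr ?exprn_ile1.
Qed.

Lemma box_curve (x r : R) : 0 < x < 1 -> x < r -> box 0 r (curve x).
Proof.
move=> x01 xr k; rewrite xi_pt eta_pt xi0 eta0 !mxE !subr0.
by split; exact: le_lt_trans (curve_small x01 (kap0 k)) xr.
Qed.

Lemma det_scaled (h : 'M[R]_n) x :
  \det (\matrix_(i, k) (xi (curve x) i * eta (curve x) k * h i k)) =
  x ^+ (\sum_k w k) * \det h.
Proof.
have -> : \matrix_(i, k) (xi (curve x) i * eta (curve x) k * h i k) =
    diag_mx (crow x) *m h *m diag_mx (crow x).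
  apply/matrixP => i k; rewrite mul_mx_diag mul_diag_mx !mxE xi_pt eta_pt !mxE.
  by ring.
rewrite !det_mulmx det_diag mulrAC; congr (_ * _).
rewrite (eq_bigr (fun k => x ^+ kap k)) => [|k _]; last by rewrite mxE.
rewrite -big_split expr_sum; apply: eq_bigr => k _ /=.
by rewrite -exprD addnn -mul2n.
Qed.
End Curve.

(** The weights are powers of a base [K] exceeding all exponents, whose digits are thus recovered.
    The factor 2 reflects [t_k = xi_k eta_k = x ^ (2 kap_k)] on the curve. *)
Lemma digit_weights n (I : finType) (m : I -> {ffun 'I_n -> nat}) :
  injective m -> exists kap : 'I_n -> nat,
  (forall k, (0 < kap k)%N) /\ injective (wdeg m (fun k => (2 * kap k)%N)).
Proof.
move=> minj; pose K := (\max_j \max_k m j k).+1.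
exists (fun k => K ^ k)%N; split=> [k|j j' E]; first by rewrite expn_gt0.
apply: minj; apply/ffunP; apply: (@base_expansion_inj K).
- move=> k; rewrite ltnS; exact: leq_trans (leq_bigmax k) (leq_bigmax j).
- move=> k; rewrite ltnS; exact: leq_trans (leq_bigmax k) (leq_bigmax j').
have E2 (i : I) : wdeg m (fun k => 2 * K ^ k)%N i = (2 * \sum_k m i k * K ^ k)%N.
  by rewrite big_distrr; apply: eq_bigr => k _; rewrite mulnCA.
by move/eqP: E; rewrite !E2 eqn_pmul2l// => /eqP.
Qed.

Section LocalRigidity.
Variables (R : realType) (n : nat) (U : set (Dn R n)) (phi : Dn R n -> R).
Variables (Omega : set 'rV[R]_n) (Phi : 'rV[R]_n -> R).
Implicit Types (z q : Dn R n) (i k : 'I_n).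
Hypotheses (n0 : (0 < n)%N) (oU : open U) (U0 : U 0) (sphi : smooth_on U phi).
Hypothesis uh : forall q, U q -> hessmx phi q \in unitmx.
Hypotheses (oOm : open Omega) (sPhi : smooth_on Omega Phi).
Hypothesis phiE : forall z, U z -> Omega (tz z) /\ phi z = Phi (tz z).

Let tz0 : tz (0 : Dn R n) = 0.
Proof. by apply/rowP => k; rewrite tzE xi0 mul0r mxE. Qed.

Let Om0 : Omega 0. Proof. by rewrite -tz0; exact: (phiE U0).1. Qed.

Let phi0 : phi 0 = Phi 0. Proof. by rewrite (phiE U0).2 tz0. Qed.

Lemma open_tz_cube (rho : R) : open [set z : Dn R n | cube rho (tz z)].
Proof.
rewrite openE => z cz.
suff H i : nbhs z [set q : Dn R n | `|tz q 0 i| < rho].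
  exact: (@filter_forall _ _ (fun i q => `|tz q 0 i| < rho) (nbhs z) _ H).
have ct : {for z, continuous (fun q : Dn R n => tz q 0 i)}.
  apply: differentiable_continuous.
  exact: (differentiable_comp (dfl_tz z) (differentiable_coord (tz z) 0 i)).
have cg : (fun q : Dn R n => `|tz q 0 i|) @ z --> `|tz z 0 i| by exact: cvg_norm.
exact: (cvgr_lt _ cg _ (cz i)).
Qed.

Lemma Phi_D_neq0 i : 'DD_(ev R i) Phi 0 != 0.
Proof.
have h0 i' k' : hess phi i' k' 0 = (i' == k')%:R * 'DD_(ev R k') Phi 0.
  by apply: (hess_toric_xi0 oU sPhi phiE) => // k; rewrite xi0.
have := uh U0; rewrite unitmxE unitfE.
have -> : hessmx phi 0 = diag_mx (\row_k 'DD_(ev R k) Phi 0).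
  apply/matrixP => a b; rewrite !mxE h0.
  by case: eqP => [->|_]; rewrite ?mul1r ?mulr1n ?mul0r ?mulr0n.
by rewrite det_diag => /prodf_neq0/(_ i isT); rewrite mxE.
Qed.

(** On the [i]-th axis only the monomials in [t_i] alone survive (the predicate [Z]); without the
    exponent [unit_vec i] the derivative of [Phi] at 0 along the axis would vanish, contrary to
    [Phi_D_neq0]. *)
Lemma exists_unit_exponent (I : finType) (m : I -> {ffun 'I_n -> nat}) (c : I -> R)
    (rho : R) i : 0 < rho ->
  (forall t, cube rho t -> Phi t = \sum_j c j * monomial (m j) t) ->
  exists j, m j = unit_vec i.
Proof.
move=> rho0 PE; apply: contrapT => nj.
pose Z j := [forall k, (k != i) ==> (m j k == 0%N)].
pose q : {poly R} := \sum_(j | Z j) c j *: 'X^(m j i).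
have qE s : `|s| < rho -> Phi (s *: ev R i) = q.[s].
  move=> sr; have cs : cube rho (s *: ev R i).
    move=> k; rewrite !mxE /=; case: eqP => _; rewrite ?mulr1//.
    by rewrite mulr0 normr0.
  rewrite PE// horner_sum (bigID Z) /= [X in _ + X]big1 ?addr0 => [|j].
    apply: eq_bigr => j Zj; rewrite hornerZ hornerXn; congr (_ * _).
    rewrite /monomial (bigD1 i)//= !mxE !eqxx mulr1 big1 ?mulr1// => k ki.
    by move/forallP/(_ k): Zj; rewrite ki => /eqP ->; rewrite expr0.
  rewrite negb_forall => /existsP[k]; rewrite negb_imply => /andP[ki mk].
  rewrite /monomial (bigD1 k)//= !mxE (negbTE ki) mulr0 expr0n (negbTE mk).
  by rewrite mul0r mulr0.
have dP : differentiable Phi (0 + (0 : R) *: ev R i).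
  by rewrite scale0r addr0; exact: smooth_dfl sPhi Om0.
have [_ h2] := line_derive dP; rewrite scale0r addr0 ddE in h2.
have q1 : q`_1 = 0.
  rewrite coef_sum big1// => j Zj; rewrite coefZ coefXn; case: eqP => [e|_]; last by rewrite mulr0.
  case: nj; exists j; apply/ffunP => k; rewrite ffunE; case: (eqVneq k i) => [->|ki].
    by rewrite -e.
  by move/forallP/(_ k): Zj; rewrite ki => /eqP ->.
have D0 : 'DD_(1 : R) (fun s : R => Phi (0 + s *: ev R i)) 0 = 0.
  have r0 : `|(0 : R)| < rho by rewrite normr0.
  rewrite (eq_derive_open (1 : R) (@open_ball0 R rho) r0
    (fun s sr => etrans (congr1 Phi (add0r _)) (qE s sr))).
  have [_ hq] := is_derive_poly q (0 : R).
  rewrite ddE in hq; apply: etrans hq _.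
  by rewrite horner_coef0 coef_deriv q1 mul0rn.
by have := Phi_D_neq0 i; rewrite -h2 D0 eqxx.
Qed.

(* Along the curve [xi_k = eta_k = x ^ kap_k] all quantities become
   polynomials in [x]. *)
Section Expansion.
Variables (r rho : R) (P : 'rV[R]_n -> R).
Variables (I : finType) (m : I -> {ffun 'I_n -> nat}) (c : I -> R).
Hypotheses (r0 : 0 < r) (rU : box 0 r `<=` U) (rho0 : 0 < rho).
Hypothesis PE : forall t, cube rho t -> P t = \sum_j c j * monomial (m j) t.
Variable G : Dn R n -> R.
Hypotheses (sG : smooth_on U G) (GP : forall z, U z -> G z = P (tz z)).

Let V := U `&` [set z | cube rho (tz z)].
Let oV : open V. Proof. exact: openI oU (@open_tz_cube rho). Qed.
Let VU : V `<=` U. Proof. by move=> z []. Qed.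
Let GE q : V q -> G q = \sum_j c j * monomial (m j) (tz q).
Proof. by case=> Uq cq; rewrite GP// PE. Qed.

Variable kap : 'I_n -> nat.
Hypothesis kap0 : forall k, (0 < kap k)%N.
Let w k := (2 * kap k)%N.
(** The bound 1 gives [x ^+ k <= x] for [k > 0]; then [r] and [rho] keep the curve in the box and
    its image under [tz] in the cube. *)
Let d := Num.min 1 (Num.min r rho).

Lemma expansion_radius_gt0 : 0 < d.
Proof. by rewrite !lt_min ltr01 r0. Qed.

Lemma curve_in (x : R) : 0 < x < d -> box 0 r (curve kap x) /\ V (curve kap x).
Proof.
move=> /andP[x0]; rewrite !lt_min => /and3P[x1 xr xrho].
have bx : box 0 r (curve kap x) by apply: box_curve; rewrite ?x0.
split=> //; split; first exact: rU.
move=> k; rewrite tz_curve; apply: le_lt_trans xrho; apply: curve_small; first by rewrite x0.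
by rewrite muln_gt0 kap0.
Qed.

Lemma expsum_val (x : R) : 0 < x < d -> (expsum m w c).[x] = G (curve kap x).
Proof. by move=> /curve_in[_ Vx]; rewrite expsum_curve GE. Qed.

Lemma expsum_val1 i (x : R) : 0 < x < d -> (expsum m w (fun j => c j * (m j i)%:R)).[x] =
  xi (curve kap x) i * 'DD_(Xf R i) G (curve kap x).
Proof.
by move=> /curve_in[_ Vx]; rewrite expsum_curve (xi_DX_expansion oV i Vx GE).
Qed.

Lemma expsum_val1' i (x : R) : 0 < x < d -> (expsum m w (fun j => c j * (m j i)%:R)).[x] =
  eta (curve kap x) i * 'DD_(Yf R i) G (curve kap x).
Proof.
by move=> /curve_in[_ Vx]; rewrite expsum_curve (eta_DY_expansion oV i Vx GE).
Qed.

Lemma expsum_val2 i k (x : R) : 0 < x < d ->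
  (expsum m w (fun j => c j * ((m j i)%:R * (m j k)%:R))).[x] =
  xi (curve kap x) i * eta (curve kap x) k * hess G i k (curve kap x).
Proof.
move=> /curve_in[_ Vx]; rewrite expsum_curve.
rewrite (hess_expansion oV (smooth_sub VU sG) GE i k Vx).
by apply: eq_bigr => j _; ring.
Qed.

(** Expansions are compared after multiplication by [xi_i eta_k]; both factors are then removed by
    the cancellation lemmas, which also reach the coordinate hyperplanes. *)
Lemma linear_constant_hessian : (forall z, U z -> G z = phi z) ->
  (forall j, (forall k, m j k = 0%N) \/ exists i, m j = unit_vec i) ->
  exists a, constant_hessian V phi a.
Proof.
move=> Gphi lin; exists (fun k => \sum_(j | m j == unit_vec k) c j).
move=> z Vz i k; set a := \sum_(j | _) _.
have sV : smooth_on V phi by exact: smooth_sub VU sphi.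
have phiV q : V q -> phi q = \sum_j c j * monomial (m j) (tz q).
  by move=> Vq; rewrite -Gphi ?GE//; exact: VU.
have dh q : V q -> differentiable (fun q => hess phi i k q - (i == k)%:R * a) q.
  by move=> Vq; exact: dflB (smooth_dfl (smooth_hess sV i k) Vq) (dfl_cst _ q).
suff E : forall q, V q -> hess phi i k q - (i == k)%:R * a = 0.
  by apply/eqP; rewrite -subr_eq0 E.
apply: (eta_mul_eq0 oV (m := k) dh).
apply: (xi_mul_eq0 oV (m := i)) => [q Vq|q Vq].
  exact: dflM (dfl_eta k q) (dh q Vq).
rewrite mulrA mulrBr (hess_expansion oV sV phiV i k Vq).
apply/eqP; rewrite subr_eq0; apply/eqP.
have mon_unit l : monomial (unit_vec l) (tz q) = xi q l * eta q l.
  rewrite /monomial (bigD1 l)//= ffunE eqxx expr1 tzE big1 ?mulr1// => l' ll.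
  by rewrite ffunE (negbTE ll) expr0.
transitivity (\sum_(j | m j == unit_vec k) (i == k)%:R * (xi q i * eta q k * c j)).
  rewrite [LHS](bigID (fun j => m j == unit_vec k)) /= [X in _ + X]big1 ?addr0 => [|j mj].
    apply: eq_bigr => j /eqP mj; rewrite mj !ffunE eqxx mon_unit.
    by case: (eqVneq i k) => [->|_] /=; ring.
  have [->|[l ml]] := lin j; first by rewrite mulr0 !mul0r.
  rewrite ml ffunE; case: (eqVneq k l) => [kl|_]; last by rewrite mulr0 !mul0r.
  by move: mj; rewrite ml kl eqxx.
by rewrite -mulr_sumr -mulr_sumr -/a mulrCA.
Qed.
End Expansion.

Variables (r lambda : R).
Hypotheses (r0 : 0 < r) (rU : box 0 r `<=` U) (ein : Einstein U phi lambda).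

Let detE := Einstein_det oU sphi uh sPhi phiE r0 rU ein.

Let det0 : \det (hessmx phi 0) != 0.
Proof. by have := uh U0; rewrite unitmxE unitfE. Qed.

Lemma flat_target_rigidity : finite_rank r Phi ->
  lambda = 0 /\ exists (V : set (Dn R n)) (a : 'I_n -> R),
    [/\ open V, V 0 & constant_hessian V phi a].
Proof.
move=> fr; have [rho [rho0 [I [m [c [minj c0 PE]]]]]] :=
  finite_rank_polynomial oOm Om0 sPhi r0 fr.
have [kap [kap0 winj]] := digit_weights minj.
set w := fun k => (2 * kap k)%N in winj.
have w0 k : (0 < w k)%N by rewrite muln_gt0 kap0.
have phiP z : U z -> phi z = Phi (tz z) by move=> Uz; exact: (phiE Uz).2.
have /choice[iu iuE] := fun i => exists_unit_exponent i rho0 PE.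
pose d := Num.min 1 (Num.min r rho).
have d0 : 0 < d by exact: expansion_radius_gt0.
pose Hp := \matrix_(i < n, k < n)
  expsum m w (fun j => c j * ((m j i)%:R * (m j k)%:R)).
have HpE (x : R) : 0 < x < d -> (\det Hp).[x] =
    x ^+ (\sum_k w k) * \det (hessmx phi (curve kap x)).
  move=> xd; rewrite -[LHS]/(horner_eval x (\det Hp)) -det_map_mx -det_scaled.
  congr (\det _); apply/matrixP => i k; rewrite !mxE /horner_eval.
  exact: (expsum_val2 rU PE sphi phiP kap0).
(* Otherwise [det_exp_poly_cst] makes the expansion [q] of [phi] along the curve constant, although
   it contains the positive power of [x] given by a unit exponent; [n0] supplies the index. *)
have lam0 : lambda = 0.
  apply/eqP/negPn/negP => lam0.
  pose q := expsum m w c.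
  have mu0 : - (lambda / 2) != 0 by rewrite oppr_eq0 mulf_neq0// invr_eq0.
  pose C := \det (hessmx phi 0) * expR (lambda / 2 * phi 0).
  have C0 : C != 0 by rewrite mulf_neq0// gt_eqF// expR_gt0.
  have QE (x : R) : 0 < x < d -> (\det Hp).[x] =
      C * x ^+ (\sum_k w k) * expR (- (lambda / 2) * q.[x]).
    move=> xd; rewrite HpE// detE; last exact: (curve_in rU kap0 xd).1.
    have -> : q.[x] = phi (curve kap x) by exact: (expsum_val rU PE phiP kap0 xd).
    rewrite /C mulrBr.
    rewrite -[X in expR (_ + X)]mulNr opprK expRD; ring.
  have := det_exp_poly_cst C0 d0 QE mu0; rewrite leqNgt => /negP; apply.
  pose j := iu (Ordinal n0).
  have jw : (0 < wdeg m w j)%N.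
    by rewrite /wdeg iuE (bigD1 (Ordinal n0))//= ffunE eqxx addn_gt0 mul1n w0.
  apply: (leq_ltn_trans jw); rewrite ltnNge; apply/negP => /(nth_default 0).
  by rewrite coef_expsum// => cj; have := c0 j; rewrite cj eqxx.
split=> //.
have detHp : \det Hp = \det (hessmx phi 0) *: 'X^(\sum_k w k).
  apply/eqP; rewrite -subr_eq0; apply/eqP/(poly_eq0_near d0) => x xd.
  rewrite hornerD hornerN hornerZ hornerXn HpE// detE; last first.
    exact: (curve_in rU kap0 xd).1.
  by rewrite lam0 mul0r oppr0 mul0r expR0 mulr1 mulrC subrr.
have lin := hessian_det_monomial_linear c0 w0 winj iuE detHp.
have [a ha] := linear_constant_hessian PE phiP (fun z _ => erefl) lin.
exists (U `&` [set z | cube rho (tz z)]), a; split=> //.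
  exact: openI oU (@open_tz_cube rho).
by split=> // k; rewrite tz0 mxE normr0.
Qed.

Lemma projective_target_impossible (kc : R) : kc != 0 -> lambda = 0 ->
  finite_rank r (fun t => expR (kc * (Phi t - Phi 0))) -> False.
Proof.
move=> kc0 lam0 fr.
pose P t := expR (kc * (Phi t - Phi 0)).
have sP : smooth_on Omega P.
  apply: smooth_exp => //; apply: smoothM => //; first exact: smooth_cst.
  by apply: smoothB => //; exact: smooth_cst.
have [rho [rho0 [I [m [c [minj c0 PE]]]]]] :=
  finite_rank_polynomial oOm Om0 sP r0 fr.
have [kap [kap0 winj]] := digit_weights minj.
set w := fun k => (2 * kap k)%N in winj.
have w0 k : (0 < w k)%N by rewrite muln_gt0 kap0.
pose G z := expR (kc * (phi z - phi 0)).
have GP z : U z -> G z = P (tz z) by move=> Uz; rewrite /G /P (phiE Uz).2 phi0.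
have sG : smooth_on U G.
  apply: smooth_exp => //; apply: smoothM => //; first exact: smooth_cst.
  by apply: smoothB => //; exact: smooth_cst.
have DG v z : U z -> 'DD_v G z = kc * (G z * 'DD_v phi z).
  move=> Uz; have dp := smooth_dfl sphi Uz.
  have de := dflM (dfl_cst kc z) (dflB dp (dfl_cst (phi 0) z)).
  rewrite (dvl_comp _ de (is_derive_expR _)) (dvlZ _ _ (dflB dp (dfl_cst (phi 0) z))).
  by rewrite (dvlB _ dp (dfl_cst (phi 0) z)) dvl_cst subr0 mulrCA.
(* The mixed second derivatives of [ln G = kc (phi - phi 0)], multiplied by [G ^+ 2]: this makes
   both sides polynomial along the curve. *)
have hG i k z : U z -> G z * hess G i k z - 'DD_(Xf R i) G z * 'DD_(Yf R k) G z =
    kc * G z ^+ 2 * hess phi i k z.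
  move=> Uz; have dG := smooth_dfl sG Uz.
  have dY := smooth_dfl (smooth_drv (Yf R k) sphi) Uz.
  rewrite hessE (eq_derive_open _ oU Uz (fun q Uq => DG (Yf R k) q Uq)).
  rewrite (dvlZ _ _ (dflM dG dY)) (dvlM _ dG dY) -hessE !DG//; ring.
pose d := Num.min 1 (Num.min r rho).
have d0 : 0 < d by exact: expansion_radius_gt0.
pose Q := expsum m w c.
pose Q1 i := expsum m w (fun j => c j * (m j i)%:R).
pose Q2 i k := expsum m w (fun j => c j * ((m j i)%:R * (m j k)%:R)).
have QG (x : R) : 0 < x < d -> Q.[x] = G (curve kap x).
  by move=> xd; apply: (expsum_val (P := P) rU PE GP kap0 xd).
have Q0 : Q != 0.
  apply/eqP => Q0; have xd : 0 < d / 2 < d.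
    by rewrite divr_gt0//= ltr_pdivrMr// ltr_pMr// ltr1n.
  by have /eqP := QG _ xd; rewrite Q0 horner0 eq_sym (gt_eqF (expR_gt0 _)).
pose C := kc ^+ n * \det (hessmx phi 0).
have C0 : C != 0 by rewrite mulf_neq0// expf_neq0.
(* It remains to check the excluded identity along the curve: the entries are
   [kc G^2 xi_i eta_k h_ik] by [hG], and [det h] is constant since [lambda = 0]. *)
apply: (hessian_det_ratio_neq c0 w0 winj n0 C0 Q0).
apply/eqP; rewrite -subr_eq0; apply/eqP/(poly_eq0_near d0) => x xd.
have [bx Vx] := curve_in rU kap0 xd.
have Ux := rU bx.
rewrite hornerD hornerN hornerZ hornerM horner_exp hornerXn.
apply/eqP; rewrite subr_eq0; apply/eqP.
set M := \matrix_(i, k) _.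
rewrite -[LHS]/(horner_eval x (\det M)) -det_map_mx.
have -> : map_mx (horner_eval x) M = (kc * G (curve kap x) ^+ 2) *:
    \matrix_(i, k) (xi (curve kap x) i * eta (curve kap x) k * hessmx phi (curve kap x) i k).
  apply/matrixP => i k; rewrite !mxE /horner_eval hornerD hornerN !hornerM.
  have -> := expsum_val2 rU PE sG GP kap0 i k xd.
  have -> := expsum_val1 rU PE GP kap0 i xd.
  have -> := expsum_val1' rU PE GP kap0 k xd.
  rewrite -/Q QG//.
  by rewrite [RHS]mulrCA -hG//; ring.
rewrite detZ det_scaled detE// lam0 mul0r oppr0 mul0r expR0 mulr1 -/Q QG//.
by rewrite exprMn -exprM /C; ring.
Qed.
End LocalRigidity.

(** * Analytic continuation *)

Section Taylor.
Variable R : realType.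
Implicit Types (F G : R -> R) (s : R).

(** Analyticity in one variable as a geometric error bound for all truncations on one radius. This
    form is stable under linear combinations and gives unique continuation without derivatives of
    series. *)
Definition taylor_at F s0 := exists (A : nat -> R) (M rho : R), 0 < rho /\
  forall D s, `|s| < rho ->
    `|F (s0 + s) - \sum_(d < D) A d * s ^+ d| <= M * (`|s| / rho) ^+ D.

Lemma taylor_bound_ge0 F s0 (A : nat -> R) (M rho : R) : 0 < rho ->
  (forall D s, `|s| < rho ->
    `|F (s0 + s) - \sum_(d < D) A d * s ^+ d| <= M * (`|s| / rho) ^+ D) -> 0 <= M.
Proof.
move=> r0 /(_ 0%N 0); rewrite normr0 => /(_ r0); rewrite big_ord0 expr0 mulr1.
exact: le_trans (normr_ge0 _).
Qed.

Lemma taylor_lin F G (c s0 : R) :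
  taylor_at F s0 -> taylor_at G s0 -> taylor_at (fun x => c * F x + G x) s0.
Proof.
move=> [A [M [r [r0 H]]]] [A' [M' [r' [r'0 H']]]].
have M0 := taylor_bound_ge0 r0 H; have M'0 := taylor_bound_ge0 r'0 H'.
pose q := Num.min r r'; have q0 : 0 < q by rewrite lt_min r0.
exists (fun d => c * A d + A' d), (`|c| * M + M'), q; split=> // D s.
rewrite lt_min => /andP[sr sr'].
have mono (x : R) : 0 < x -> q <= x -> (`|s| / x) ^+ D <= (`|s| / q) ^+ D.
  move=> x0 qx; apply: lerXn2r; rewrite ?nnegrE ?divr_ge0 ?normr_ge0 ?(ltW q0) ?(ltW x0)//.
  by apply: ler_wpM2l; rewrite ?normr_ge0// lef_pV2.
have -> : c * F (s0 + s) + G (s0 + s) - \sum_(d < D) (c * A d + A' d) * s ^+ d =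
    c * (F (s0 + s) - \sum_(d < D) A d * s ^+ d) +
    (G (s0 + s) - \sum_(d < D) A' d * s ^+ d).
  under eq_bigr => d _ do rewrite mulrDl -mulrA.
  by rewrite big_split -mulr_sumr /=; ring.
apply: le_trans (ler_normD _ _) _; rewrite mulrDl normrM -mulrA lerD//.
  apply: ler_wpM2l => //; apply: le_trans (H _ _ sr) _; apply: ler_wpM2l => //.
  by apply: mono => //; rewrite ge_min lexx.
apply: le_trans (H' _ _ sr') _; apply: ler_wpM2l => //.
by apply: mono => //; rewrite ge_min lexx orbT.
Qed.

Lemma taylor_affine (a b s0 : R) : taylor_at (fun x => a + b * x) s0.
Proof.
pose A d : R := if d is d'.+1 then (if d' is 0%N then b else 0) else a + b * s0.
exists A, (`|a + b * s0| + `|b|), 1; split=> // D s s1; rewrite divr1.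
case: D => [|[|D]].
- rewrite big_ord0 subr0 expr0 mulr1 mulrDr addrA.
  apply: le_trans (ler_normD _ _) _; rewrite lerD2l normrM.
  by rewrite ler_piMr// ltW.
- have -> : a + b * (s0 + s) - \sum_(d < 1) A d * s ^+ d = b * s.
    by rewrite big_ord1 /=; ring.
  rewrite normrM expr1.
  by apply: ler_wpM2r => //; rewrite lerDr.
- rewrite big_ord_recl big_ord_recl /= big1 ?addr0 => [|i _]; last by rewrite mul0r.
  have -> : a + b * (s0 + s) - ((a + b * s0) * s ^+ 0 + b * s ^+ 1) = 0 by ring.
  by rewrite normr0 mulr_ge0 ?exprn_ge0// addr_ge0.
Qed.

Lemma taylor_sum (I : Type) (r : seq I) (c : I -> R) (F : I -> R -> R) G s0 :
  (forall i, taylor_at (F i) s0) -> taylor_at G s0 ->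
  taylor_at (fun x => \sum_(i <- r) c i * F i x + G x) s0.
Proof.
move=> TF TG; elim: r => [|i r IH].
  by under eq_fun => x do rewrite big_nil add0r.
under eq_fun => x do rewrite big_cons -addrA.
exact: taylor_lin.
Qed.

Lemma taylor_shift F s0 : taylor_at (fun s => F (s0 + s)) 0 -> taylor_at F s0.
Proof.
move=> [A [M [r [r0 H]]]]; exists A, M, r; split=> // D s sr.
by have := H D s sr; rewrite add0r.
Qed.

(** Zeros to the left of [s0] force all coefficients to vanish, the first nonzero one being dominant
    near [s0]; the error bound then tends to 0 on both sides of [s0]. *)
Lemma taylor_eq0_right F s0 (del : R) : taylor_at F s0 -> 0 < del ->
  (forall s, s0 - del < s < s0 -> F s = 0) ->
  exists2 e : R, 0 < e & forall s, `|s| < e -> F (s0 + s) = 0.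
Proof.
move=> [A [M [r [r0 H]]]] del0 F0; exists r => //.
have M0 := taylor_bound_ge0 r0 H.
have A0 d : A d = 0.
  elim/ltn_ind: d => d IH; apply/eqP/negPn/negP => Ad.
  pose C := `|A d| * r ^+ d.+1; have C0 : 0 < C by rewrite mulr_gt0 ?exprn_gt0 ?normr_gt0.
  (* The last bound gives [M * x < C], contradicting the estimate at order [d.+1], which says
     [C <= M * x]; the others keep [- x] in the zero interval and in the radius. *)
  pose x := Num.min (Num.min (del / 2) (r / 2)) (C / (2 * (M + 1))).
  have M1 : 0 < M + 1 by rewrite ltr_wpDl.
  have x0 : 0 < x by rewrite !lt_min !divr_gt0//= mulr_gt0.
  have xd : x < del.
    have h : del / 2 < del by rewrite ltr_pdivrMr// ltr_pMr ?ltr1n.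
    by apply: le_lt_trans h; rewrite !ge_min lexx.
  have xr : x < r.
    have h : r / 2 < r by rewrite ltr_pdivrMr// ltr_pMr ?ltr1n.
    by apply: le_lt_trans h; rewrite !ge_min lexx orbT.
  have xC : M * x < C.
    have : x <= C / (2 * (M + 1)) by rewrite ge_min lexx orbT.
    rewrite ler_pdivlMr ?mulr_gt0// => xC.
    have Mx : 0 <= M * x by rewrite mulr_ge0// ltW.
    nra.
  have nx : `|- x| = x by rewrite normrN gtr0_norm.
  have := H d.+1 (- x); rewrite nx => /(_ xr).
  rewrite F0 ?add0r; last by rewrite ltrD2l ltrN2 xd gtrDl oppr_lt0 x0.
  rewrite normrN big_ord_recr big1 /=; last first.
    by move=> i _; rewrite IH ?mul0r.
  rewrite add0r normrM normrX nx exprMn exprVn mulrA ler_pdivlMr ?exprn_gt0//.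
  rewrite [x ^+ d.+1]exprSr mulrA -mulrA [_ ^+ d * _]mulrC mulrA -/C.
  rewrite mulrAC ler_pM2r ?exprn_gt0// => CM.
  by have := le_lt_trans CM xC; rewrite ltxx.
move=> s sr; apply/eqP; rewrite -normr_eq0 eq_le normr_ge0 andbT.
apply/ler_addgt0Pr => e e0; rewrite add0r.
have [->|s0n] := eqVneq s 0.
  have := H 1%N 0; rewrite normr0 => /(_ r0); rewrite big_ord1 A0 mul0r subr0.
  by rewrite mul0r expr1 mulr0 => h; apply: le_trans h (ltW e0).
have x1 : `| `|s| / r| < 1.
  by rewrite ger0_norm ?divr_ge0 ?(ltW r0)// ltr_pdivrMr ?mul1r.
have cx : (fun D => M * (`|s| / r) ^+ D) @ \oo --> (0 : R).
  rewrite -[X in _ --> X](mulr0 M); apply: cvgMr; exact: cvg_expr.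
near \oo => D.
apply: (@le_trans _ _ (M * (`|s| / r) ^+ D)).
  have := H D s sr; rewrite big1 ?subr0// => i _; by rewrite A0 mul0r.
apply: ltW; near: D; exact: (cvgr_lt _ cx _ e0).
Unshelve. all: by end_near. Qed.

(** At the supremum [m] of the zero intervals starting at 0, the expansion vanishes on the left,
    hence also on the right; this pushes [m] up to 1. *)
Lemma taylor_continuation F (e : R) : 0 < e ->
  (forall s, 0 <= s <= 1 -> taylor_at F s) ->
  (forall s, 0 <= s < e -> F s = 0) -> F 1 = 0.
Proof.
move=> e0 TF Fe.
pose E := [set t : R | 0 <= t <= 1 /\ forall s, 0 <= s <= t -> F s = 0].
have E0 : E 0.
  split; rewrite ?lexx ?ler01// => s /andP[s0 s0']; apply: Fe.
  by rewrite s0 (le_lt_trans s0').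
have hE : has_sup E by split; [exists 0 | exists 1 => t [/andP[]]].
pose m := sup E.
have m1 : m <= 1 by apply: ge_sup => [|t [/andP[]]]; first exists 0.
have Fm s : 0 <= s < m -> F s = 0.
  move=> /andP[s0 sm]; have [t [_ Et] st] := sup_gt (ex_intro _ 0 E0) sm.
  by apply: Et; rewrite s0 ltW.
have m0 : 0 < m.
  pose t := Num.min (e / 2) 1.
  have t0 : 0 < t by rewrite lt_min divr_gt0//=.
  apply: (lt_le_trans t0); apply: sup_upper_bound => //; split.
    by rewrite ltW//= ge_min lexx orbT.
  move=> s /andP[s0 st]; apply: Fe; rewrite s0; apply: (le_lt_trans st).
  by rewrite gt_min ltr_pdivrMr// ltr_pMr ?ltr1n.
have [r r0 Fr] : exists2 r : R, 0 < r & forall s, `|s| < r -> F (m + s) = 0.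
  apply: (taylor_eq0_right _ m0); first by apply: TF; rewrite ltW.
  by move=> s; rewrite subrr => /andP[s0 sm]; apply: Fm; rewrite ltW.
have FmE : F m = 0 by have := Fr 0; rewrite normr0 addr0; apply.
have [mlt|] := ltP m 1; last by move=> m1'; have /eqP <- : m == 1 by rewrite eq_le m1.
pose t := Num.min (m + r / 2) 1.
have tm : m < t by rewrite lt_min mlt ltrDl divr_gt0.
suff : t <= m by rewrite leNgt tm.
apply: sup_upper_bound => //; split.
  by rewrite (le_trans (ltW m0) (ltW tm)) ge_min lexx orbT.
move=> s /andP[s0 st]; have [sm|ms] := ltP s m; first by apply: Fm; rewrite s0.
have -> : s = m + (s - m) by ring.
apply: Fr; rewrite ger0_norm ?subr_ge0// ltrBlDl.
apply: (le_lt_trans st); rewrite gt_min ltrD2l ltr_pdivrMr// ltr_pMr ?ltr1n//.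
Qed.
End Taylor.

Lemma sum_bounded_exponents (R : realType) (m K K' : nat) (T : ('I_m -> nat) -> R) :
  (K < K')%N -> (forall al, T al != 0 -> forall b, (al b <= K)%N) ->
  \sum_(al : {ffun 'I_m -> 'I_K'}) T (fun b => al b) =
  \sum_(al : {ffun 'I_m -> 'I_K.+1}) T (fun b => al b).
Proof.
move=> KK T0.
pose h (al : {ffun 'I_m -> 'I_K.+1}) : {ffun 'I_m -> 'I_K'} :=
  [ffun b => widen_ord KK (al b)].
pose h' (al : {ffun 'I_m -> 'I_K'}) : {ffun 'I_m -> 'I_K.+1} :=
  [ffun b => inord (al b)].
rewrite (bigID (fun al : {ffun 'I_m -> 'I_K'} => T (fun b => nat_of_ord (al b)) != 0)) /=.
rewrite [X in _ + X]big1 ?addr0 => [|al]; last by move/negPn/eqP.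
rewrite (reindex_onto h h') /= => [|al /T0 alK]; last first.
  by apply/ffunP => b; apply: val_inj; rewrite !ffunE /= inordK// ltnS alK.
rewrite [RHS](bigID (fun al : {ffun 'I_m -> 'I_K.+1} => T (fun b => nat_of_ord (al b)) != 0)) /=.
rewrite [X in _ = _ + X]big1 ?addr0 => [|al]; last by move/negPn/eqP.
have hE (al : {ffun 'I_m -> 'I_K.+1}) : T (fun b => nat_of_ord (h al b)) = T (fun b => nat_of_ord (al b)).
  by congr T; apply/funext => b; rewrite ffunE.
apply: eq_big => [al|al _]; last exact: hE.
rewrite hE andb_idr// => _; apply/eqP/ffunP => b; apply: val_inj.
by rewrite !ffunE /= inordK.
Qed.

Lemma ncoordD (R : realType) n (z w : Dn R n) b : ncoord (z + w) b = ncoord z b + ncoord w b.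
Proof. by rewrite /ncoord; case: fintype.split => i; [exact: xiD | exact: etaD]. Qed.

Lemma ncoordZ (R : realType) n (x : R) (z : Dn R n) b : ncoord (x *: z) b = x * ncoord z b.
Proof. by rewrite /ncoord; case: fintype.split => i; [exact: xiZ | exact: etaZ]. Qed.

Section AnalyticContinuation.
Variables (R : realType) (n : nat).
Implicit Types (f : Dn R n -> R) (p q v z : Dn R n).

(** Terms are regrouped by total degree: [rho] is small enough that [rho *: v] lies in the domain of
    convergence, and [B d] is the homogeneous part of degree [d] there. *)
Lemma analytic_taylor f p v : real_analytic_at f p ->
  taylor_at (fun s => f (p + s *: v)) 0.
Proof.
move=> [a [r [r0 H]]].
pose S := 1 + \sum_b `|ncoord v b|.
have S0 : 0 < S by rewrite ltr_pwDl// sumr_ge0.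
pose rho := r / S; have rho0 : 0 < rho by rewrite divr_gt0.
have vS (c : 'I_(n + n)) : `|ncoord v c| < S.
  rewrite /S (bigD1 c)//= addrCA ltrDl ltr_pwDl// sumr_ge0//.
pose h := rho *: v.
have hr (x : R) (c : 'I_(n + n)) : `|x| <= 1 -> `|ncoord (x *: h) c| < r.
  move=> x1; rewrite ncoordZ normrM; apply: (@le_lt_trans _ _ `|ncoord h c|).
    by rewrite ler_piMl.
  rewrite ncoordZ normrM gtr0_norm// /rho mulrAC.
  by rewrite ltr_pdivrMr// ltr_pM2l.
clearbody rho.
pose T (al : 'I_(n + n) -> nat) : R := a al * \prod_b ncoord h b ^+ al b.
pose deg (al : 'I_(n + n) -> nat) := (\sum_b al b)%N.
have [M HM] : exists M : R, forall K : nat,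
    \sum_(al : {ffun 'I_(n + n) -> 'I_K}) `|T (fun b => al b)| <= M.
  have hh (c : 'I_(n + n)) : `|ncoord h c| < r.
    by rewrite -[h]scale1r; apply: hr; rewrite normr1.
  exact: (H h hh).1.
pose T' d al : R := if deg al == d then T al else 0.
pose B d := \sum_(al : {ffun 'I_(n + n) -> 'I_d.+1}) T' d (fun b => al b).
exists (fun d => B d / rho ^+ d), M, rho; split=> // D s srho; rewrite add0r.
pose x := s / rho.
have nx : `|x| = `|s| / rho by rewrite normrM normfV (gtr0_norm rho0).
have x1 : `|x| <= 1 by rewrite nx ler_pdivrMr// mul1r ltW.
have -> : s *: v = x *: h by rewrite scalerA /x divfK// gt_eqF.
rewrite -nx.
have -> : \sum_(d < D) B d / rho ^+ d * s ^+ d = \sum_(d < D) B d * x ^+ d.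
  by apply: eq_bigr => d _; rewrite /x expr_div_n mulrA mulrAC.
have [_ cv] := H (x *: h) (fun b => hr x b x1).
set u := (X in X @ \oo) in cv.
have uE K : u K = \sum_(al : {ffun 'I_(n + n) -> 'I_K})
    T (fun b => al b) * x ^+ deg (fun b => al b).
  apply: eq_bigr => al _; rewrite /T -mulrA; congr (_ * _).
  rewrite /deg -[in RHS](prodrXr x) -big_split /=; apply: eq_bigr => b _.
  by rewrite ncoordZ exprMn mulrC.
(* Once [K >= D] the box contains all multi-indices of degree below [D], which cancel; each
   remaining term carries a factor of size at most [|x| ^+ D]. *)
have uB K : (D <= K)%N -> `|u K - \sum_(d < D) B d * x ^+ d| <= M * `|x| ^+ D.
  move=> DK.
  have -> : \sum_(d < D) B d * x ^+ d =
      \sum_(al : {ffun 'I_(n + n) -> 'I_K}) \sum_(d < D) T' d (fun b => al b) * x ^+ d.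
    rewrite exchange_big /=; apply: eq_bigr => d _.
    rewrite -mulr_suml; congr (_ * _); apply/esym/sum_bounded_exponents.
      exact: leq_trans (ltn_ord d) DK.
    move=> al; rewrite /T'; case: (@eqP _ (deg al) d) => [e _ b|_]; last by rewrite eqxx.
    by rewrite -e /deg (bigD1 b) //= leq_addr.
  rewrite uE -sumrB; apply: le_trans (ler_norm_sum _ _ _) _.
  apply: (@le_trans _ _ (\sum_(al : {ffun 'I_(n + n) -> 'I_K})
    `|T (fun b => al b)| * `|x| ^+ D)); last by rewrite -mulr_suml ler_wpM2r// exprn_ge0.
  apply: ler_sum => al _; set be := fun b => _.
  have [dD|Dd] := ltnP (deg be) D.
    rewrite (bigD1 (Ordinal dD))//= big1 => [|d dn]; last first.
      rewrite /T' ifF ?mul0r//; apply/negP => /eqP e; move/negP: dn; apply.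
      by apply/eqP/val_inj.
    by rewrite /T' eqxx addr0 subrr normr0 mulr_ge0// exprn_ge0.
  rewrite big1 ?subr0 => [|d _]; last first.
    rewrite /T' ifF ?mul0r//; apply/negP => /eqP e.
    by have := ltn_ord d; rewrite -e ltnNge Dd.
  rewrite normrM normrX ler_wpM2l//; apply: ler_wiXn2l => //.
have cn : (fun K => `|u K - \sum_(d < D) B d * x ^+ d|) @ \oo -->
    `|f (p + x *: h) - \sum_(d < D) B d * x ^+ d|.
  by apply: cvg_norm; apply: cvgB => //; exact: cvg_cst.
rewrite -(cvg_lim _ cn)//; apply: limr_le; first by apply/cvg_ex; eexists; exact: cn.
by exists D => // K /= DK; exact: uB.
Qed.
End AnalyticContinuation.

(** * Unique continuation for the Hessian *)

Section UniqueContinuation.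
Variables (R : realType) (n : nat) (U : set (Dn R n)).
Implicit Types (p q v w z : Dn R n).

Section Combination.
Variables (I : finType) (F : I -> Dn R n -> R) (c : I -> R) (L : Dn R n -> R).
Hypotheses (sF : forall k, smooth_on U (F k)).
Hypothesis aF : forall k z, U z -> real_analytic_at (F k) z.
Hypotheses (linL : linear L) (dL : forall z, differentiable L z).

Let g z := \sum_k c k * F k z + L z.

Let L_line q v (s : R) : L (q + s *: v) = L q + L v * s.
Proof. by rewrite addrC linL addrC mulrC. Qed.

Lemma analytic_combination_cst p q (r e : R) : 0 < r -> box p r `<=` U ->
  box p r q -> 0 < e -> (forall z, box q e z -> g z = g q) ->
  forall z, box p r z -> g z = g q.
Proof.
move=> r0 rU bq e0 gq z bz; pose v := z - q.
suff : g (q + (1 : R) *: v) - g q = 0.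
  by rewrite scale1r [q + _]addrC subrK => /eqP; rewrite subr_eq0 => /eqP.
(* Null coordinates of two points of the box differ by less than [2 r], so for [s < e / (2 r)] the
   segment stays in the small box, where [g] is constant. *)
apply: (taylor_continuation (F := fun s => g (q + s *: v) - g q)
  (e := e / (2 * r))); first by rewrite divr_gt0 ?mulr_gt0.
  move=> s s01.
  have -> : (fun s => g (q + s *: v) - g q) = fun s =>
      \sum_k c k * F k (q + s *: v) + ((L q - g q) + L v * s).
    by apply/funext => x; rewrite /g L_line addrA addrAC addrA; ring.
  apply: taylor_sum => [k|]; last exact: taylor_affine.
  apply: taylor_shift.
  have -> : (fun x => F k (q + (s + x) *: v)) =
      fun x => F k ((q + s *: v) + x *: v).
    by apply/funext => x; rewrite scalerDl addrA.
  by apply: analytic_taylor; apply: aF; apply: rU; exact: box_convex.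
move=> s /andP[s0]; rewrite ltr_pdivlMr ?mulr_gt0// => se.
rewrite gq ?subrr// => i.
have sub (a b x : R) : `|a - x| < r -> `|b - x| < r -> `|s * (a - b)| < e.
  move=> ax bx; rewrite normrM (ger0_norm s0); apply: (le_lt_trans _ se).
  apply: ler_wpM2l => //; have -> : a - b = (a - x) - (b - x) by ring.
  apply: le_trans (ler_normB _ _) _; rewrite mulrDl mul1r; exact: lerD (ltW _) (ltW _).
have [bzx bze] := bz i; have [bqx bqe] := bq i.
have -> : xi (q + s *: v) i - xi q i = s * (xi z i - xi q i).
  by rewrite xiD xiZ xiD xiN; ring.
have -> : eta (q + s *: v) i - eta q i = s * (eta z i - eta q i).
  by rewrite etaD etaZ etaD etaN; ring.
split; [exact: sub bzx bqx | exact: sub bze bqe].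
Qed.

Lemma dfl_combination z : U z -> differentiable g z.
Proof.
move=> Uz; apply: (dflD _ (dL z)); apply: dfl_sum => k _.
exact: dflM (dfl_cst _ z) (smooth_dfl (sF k) Uz).
Qed.

Lemma dvl_combination v z : U z ->
  'DD_v g z = \sum_k c k * 'DD_v (F k) z + L v.
Proof.
move=> Uz; have dF k := smooth_dfl (sF k) Uz.
have dcF k := dflM (dfl_cst (c k) z) (dF k).
have ds : differentiable (fun w => \sum_k c k * F k w) z by apply: dfl_sum => k _; exact: dcF.
rewrite (dvlD _ ds (dL z)) (dvl_linear _ _ linL).
rewrite dvl_sum => [|k _]; last exact: dcF.
by congr (_ + _); apply: eq_bigr => k _; rewrite (dvlZ _ _ (dF k)).
Qed.

Lemma analytic_gradient_eq0 p q (r e : R) : 0 < r -> box p r `<=` U ->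
  0 < e -> box q e `<=` box p r ->
  (forall i z, box q e z -> 'DD_(Xf R i) g z = 0 /\ 'DD_(Yf R i) g z = 0) ->
  forall v z, box p r z -> 'DD_v g z = 0.
Proof.
move=> r0 rU e0 er D0 v z bz.
have bqq := box_center q e0.
have dg w : box q e w -> differentiable g w.
  by move=> bw; exact: dfl_combination (rU _ (er _ bw)).
have gq w : box q e w -> g w = g q.
  move=> bw; apply: (box_cst dg bqq bw) => u bu.
  by apply: dvl_null0 (dg _ bu) _ _ => i; right; have [] := D0 i u bu.
have cst := analytic_combination_cst r0 rU (er _ bqq) e0 gq.
by rewrite (eq_derive_open v (@open_box _ _ p r) bz cst) dvl_cst.
Qed.
End Combination.

Variables (N : nat) (f : Dn R n -> Dn R N) (phi : Dn R n -> R) (a : 'I_n -> R).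
Hypotheses (oU : open U) (hf : para_holomorphic_on U f).
Hypothesis mE : forall p i j, U p ->
  metric (@flat_potential R N) (f p) ('D_(Xf R i) f p) ('D_(Yf R j) f p)
  = metric phi p (Xf R i) (Yf R j).
Hypothesis af : forall b p, U p -> real_analytic_at (fun z => ncoord (f z) b) p.

Let sz k : smooth_on U (zeta f k) := smooth_zeta oU hf k.
Let st k : smooth_on U (theta f k) := smooth_theta oU hf k.

Let az k z : U z -> real_analytic_at (zeta f k) z.
Proof.
by move=> Uz; have := af (lshift N k) Uz; under eq_fun do rewrite ncoord_l.
Qed.

Let at_ k z : U z -> real_analytic_at (theta f k) z.
Proof.
by move=> Uz; have := af (rshift N k) Uz; under eq_fun do rewrite ncoord_r.
Qed.

Lemma DX_zeta_box p (r : R) z w k i : box p r `<=` U -> box p r z -> box p r w ->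
  (forall l, xi z l = xi w l) ->
  'DD_(Xf R i) (zeta f k) w = 'DD_(Xf R i) (zeta f k) z.
Proof.
move=> rU bz bw e; apply: (box_cst_eta _ _ bz bw e) => [q /rU Uq|l q /rU Uq].
  exact: smooth_dfl (smooth_drv _ (sz k)) Uq.
rewrite (schwarz _ _ oU (sz k) Uq).
rewrite (eq_derive_open _ oU Uq (fun q Uq => (zeta_theta_holo hf k l Uq).1)).
exact: dvl_cst.
Qed.

Lemma DY_theta_box p (r : R) z w k i : box p r `<=` U -> box p r z -> box p r w ->
  (forall l, eta z l = eta w l) ->
  'DD_(Yf R i) (theta f k) w = 'DD_(Yf R i) (theta f k) z.
Proof.
move=> rU bz bw e; apply: (box_cst_xi _ _ bz bw e) => [q /rU Uq|l q /rU Uq].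
  exact: smooth_dfl (smooth_drv _ (st k)) Uq.
rewrite (schwarz _ _ oU (st k) Uq).
rewrite (eq_derive_open _ oU Uq (fun q Uq => (zeta_theta_holo hf k l Uq).2)).
exact: dvl_cst.
Qed.

(* In a box the Hessian is the polarized sum
   [2 sum_k (d_xi zeta_k)(xi) (d_eta theta_k)(eta)]: it is continued in [xi] first
   with [eta] frozen, then in [eta]. *)
Lemma constant_hessian_box p q (r e : R) : 0 < r -> box p r `<=` U ->
  0 < e -> box q e `<=` box p r ->
  constant_hessian (box q e) phi a -> constant_hessian (box p r) phi a.
Proof.
move=> r0 rU e0 er ch z bz i j.
pose H i j z w := \sum_k (2 * 'DD_(Yf R j) (theta f k) w) * 'DD_(Xf R i) (zeta f k) z.
have hessH i' j' w : U w -> hess phi i' j' w = H i' j' w w.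
  move=> Uw; rewrite (flat_pullback_hess hf Uw (mE i' j' Uw)) mulr_sumr.
  by apply: eq_bigr => k _; rewrite mulrCA mulrC.
have Hbox i' j' x y : box p r x -> box p r y -> H i' j' x y =
    H i' j' (pt (xiv x) (etav y)) (pt (xiv x) (etav y)).
  move=> bx byy; have bxy := box_pt bx byy; apply: eq_bigr => k _.
  rewrite (DX_zeta_box k i' rU bx bxy) => [|l]; last by rewrite xi_pt mxE.
  by rewrite (DY_theta_box k j' rU byy bxy) => // l; rewrite eta_pt mxE.
have step1 w i' j' x : box q e w -> box p r x -> H i' j' x w = (i' == j')%:R * a j'.
  move=> bw bx; pose L z := - a j' * xi z j'.
  have linL : linear L by move=> s u v; rewrite /L xiD xiZ /GRing.scale /=; ring.
  have dL u : differentiable L u by exact: dflM (dfl_cst _ u) (dfl_xi j' u).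
  pose c k := 2 * 'DD_(Yf R j') (theta f k) w.
  have Ubw : U w by exact: rU (er _ bw).
  have D0 l u : box q e u -> 'DD_(Xf R l) (fun z => \sum_k c k * zeta f k z + L z) u = 0 /\
      'DD_(Yf R l) (fun z => \sum_k c k * zeta f k z + L z) u = 0.
    move=> bu; have Uu := rU _ (er _ bu).
    rewrite !(dvl_combination c sz linL dL _ Uu) /L xi_X xi_Y; split.
      rewrite -/(H l j' u w) (Hbox _ _ _ _ (er _ bu) (er _ bw)).
      rewrite -hessH ?ch; first by rewrite eq_sym; case: eqP => _ /=; ring.
        exact: box_pt.
      by apply: rU; apply: er; exact: box_pt.
    rewrite big1 ?mulr0 ?addr0// => k _.
    by rewrite (zeta_theta_holo hf k l Uu).1 mulr0.
  have := analytic_gradient_eq0 sz az linL dL r0 rU e0 er D0 (Xf R i') bx.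
  rewrite (dvl_combination c sz linL dL _ (rU _ bx)) /L xi_X => E.
  have {}E : H i' j' x w = a j' * (i' == j')%:R by apply/eqP; rewrite -subr_eq0 -mulNr; apply/eqP; exact: E.
  by rewrite E mulrC.
rewrite hessH; last exact: rU.
pose L w := - a i * eta w i.
have linL : linear L by move=> s u v; rewrite /L etaD etaZ /GRing.scale /=; ring.
have dL u : differentiable L u by exact: dflM (dfl_cst _ u) (dfl_eta i u).
pose c k := 2 * 'DD_(Xf R i) (zeta f k) z.
have HE l u : \sum_k c k * 'DD_(Yf R l) (theta f k) u = H i l z u.
  by apply: eq_bigr => k _; rewrite /c; ring.
have D0 l u : box q e u -> 'DD_(Xf R l) (fun z => \sum_k c k * theta f k z + L z) u = 0 /\
    'DD_(Yf R l) (fun z => \sum_k c k * theta f k z + L z) u = 0.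
  move=> bu; have Uu := rU _ (er _ bu).
  rewrite !(dvl_combination c st linL dL _ Uu) /L eta_X eta_Y; split.
    rewrite big1 ?mulr0 ?addr0// => k _.
    by rewrite (zeta_theta_holo hf k l Uu).2 mulr0.
  rewrite HE step1// [l == i]eq_sym; case: eqP => [->|_] /=; ring.
have := analytic_gradient_eq0 st at_ linL dL r0 rU e0 er D0 (Yf R j) bz.
rewrite (dvl_combination c st linL dL _ (rU _ bz)) HE /L eta_Y => E.
have {}E : H i j z z = a i * (j == i)%:R by apply/eqP; rewrite -subr_eq0 -mulNr; apply/eqP; exact: E.
by rewrite E eq_sym; case: eqP => [->|_] /=; ring.
Qed.

Lemma constant_hessian_continuation (V : set (Dn R n)) p0 : connected U -> U p0 ->
  open V -> V p0 -> constant_hessian V phi a -> constant_hessian U phi a.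
Proof.
move=> cU Up0 oV Vp0 ch.
(* Constancy on a whole box around [q], not only at [q]: it provides the open set from which
   [constant_hessian_box] continues. *)
pose P q := exists2 e : R, 0 < e & constant_hessian (box q e) phi a.
have PU : forall p, U p -> P p.
  apply: (connected_box_ind cU Up0).
    by have [e e0 eV] := open_box_sub oV Vp0; exists e => // z /eV; exact: ch.
  move=> p Up; have [r r0 rU] := open_box_sub oU Up; exists r; split=> // -[q bq [e e0 che]].
  have [e1 e10 er] := open_box_sub (@open_box _ _ p r) bq.
  have m0 : 0 < Num.min e e1 by rewrite lt_min e0.
  have mr : box q (Num.min e e1) `<=` box p r.
    by apply: subset_trans er; apply: sub_box; rewrite ge_min lexx orbT.
  have chp : constant_hessian (box p r) phi a.
    apply: (constant_hessian_box r0 rU m0 mr) => z bz; apply: che.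
    by apply: sub_box bz; rewrite ge_min lexx.
  move=> w bw; have [e2 e20 e2r] := open_box_sub (@open_box _ _ p r) bw.
  by exists e2 => // z /e2r; exact: chp.
by move=> z /PU [e e0 che]; apply: che; exact: box_center.
Qed.
End UniqueContinuation.

(** * The flat model *)

Section AffineAnalytic.
Variables (R : realType) (n : nat).
Implicit Types (p z : Dn R n).

Lemma analytic_ncoord (c : R) b p :
  real_analytic_at (fun z : Dn R n => c * ncoord z b) p.
Proof.
pose deg (al : 'I_(n + n) -> nat) := (\sum_x al x)%N.
pose a (al : 'I_(n + n) -> nat) : R := if deg al == 0%N then c * ncoord p b
  else if (deg al == 1%N) && (al b == 1%N) then c else 0.
exists a, 1; split=> // h _ /=.
pose T (al : 'I_(n + n) -> nat) : R := a al * \prod_x ncoord h x ^+ al x.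
have le_deg (al : 'I_(n + n) -> nat) x : (al x <= deg al)%N.
  by rewrite /deg (bigD1 x) //= leq_addr.
have T1 (al : 'I_(n + n) -> nat) : T al != 0 -> forall x, (al x <= 1)%N.
  rewrite /T /a => + x; have := le_deg al x.
  case: (deg al) => [|[|d]] /=; rewrite ?mul0r ?eqxx//.
  by rewrite leqn0 => /eqP ->.
have nT1 (al : 'I_(n + n) -> nat) : `|T al| != 0 -> forall x, (al x <= 1)%N.
  by rewrite normr_eq0; exact: T1.
pose N K := \sum_(al : {ffun 'I_(n + n) -> 'I_K}) `|T (fun x => al x)|.
have N0 K : 0 <= N K by apply: sumr_ge0.
split.
  (* From [K = 2] on, the box contains all nonzero terms, so the sum is that for 2; the two smaller
     boxes contribute their own sums. *)
  exists (N 0%N + N 1%N + N 2%N) => -[|[|K]].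
  - by rewrite -/(N 0%N) -addrA lerDl addr_ge0.
  - by rewrite -/(N 1%N) addrAC lerDr addr_ge0.
  - rewrite [leLHS](sum_bounded_exponents (T := fun al => `|T al|) (isT : (1 < K.+2)%N) nT1).
    by rewrite -/(N 2%N) lerDr addr_ge0.
have S2 : \sum_(al : {ffun 'I_(n + n) -> 'I_2}) T (fun x => al x) =
    c * ncoord (p + h) b.
  pose al0 : {ffun 'I_(n + n) -> 'I_2} := [ffun=> ord0].
  pose al1 : {ffun 'I_(n + n) -> 'I_2} := [ffun x => inord (x == b)].
  have e0 x : al0 x = 0%N :> nat by rewrite ffunE.
  have e1 x : al1 x = (x == b) :> nat by rewrite ffunE inordK//; case: (x == b).
  have d0 : deg (fun x => al0 x) = 0%N by apply: big1 => x _; rewrite e0.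
  have d1 : deg (fun x => al1 x) = 1%N.
    by rewrite /deg (bigD1 b)//= e1 eqxx big1// => x /negbTE xb; rewrite e1 xb.
  have al10 : al1 != al0.
    by apply/eqP => /ffunP /(_ b) /(congr1 val) /=; rewrite e1 e0 eqxx.
  rewrite (bigD1 al0)//= (bigD1 al1)//= big1 ?addr0 => [|al /andP[n0 n1]].
    rewrite /T /a d0 d1 e1 !eqxx /= ncoordD mulrDr; congr (_ + _).
      by rewrite big1 ?mulr1// => x _; rewrite e0 expr0.
    rewrite (bigD1 b)//= e1 eqxx expr1 big1 ?mulr1// => x /negbTE xb.
    by rewrite e1 xb expr0.
  rewrite /T /a; case: eqP => [d|_].
    case/eqP: n0; apply/ffunP => x; apply: val_inj; rewrite /= e0; apply/eqP.
    by have := le_deg (fun x => al x) x; rewrite d leqn0.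
  case: andP => [[/eqP d /eqP alb]|_]; last by rewrite mul0r.
  case/eqP: n1; apply/ffunP => x; apply: val_inj; rewrite /= e1.
  case: (eqVneq x b) => [->//|xb]; apply/eqP; rewrite -leqn0.
  have := d; rewrite /deg (bigD1 b)//= alb => /eqP; rewrite add1n eqSS.
  by rewrite (bigD1 x)//= addn_eq0 => /andP[/eqP ->].
rewrite -S2; apply/cvg_ballP => e e0; exists 2%N => // K /= K2.
rewrite (sum_bounded_exponents (T := T) K2 T1); exact: ballxx.
Qed.
End AffineAnalytic.

Section FlatModel.
Variables (R : realType) (n : nat).
Implicit Types (p v w z : Dn R n) (i j k : 'I_n).

Lemma constant_hessian_flat_potential :
  constant_hessian setT (@flat_potential R n) (fun _ => 2).
Proof. by move=> z _ i j; rewrite hess_flat mulrC. Qed.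

Lemma smooth_flat_potential : smooth_on setT (@flat_potential R n).
Proof.
have -> : @flat_potential R n = fun z => 2 * \sum_k xi z k * eta z k.
  by apply/funext => z; rewrite /flat_potential norm2E.
have oT : open [set: Dn R n] by exact: openT.
apply: smoothM => //; first exact: smooth_cst.
apply: smooth_sum => // k _; apply: smoothM => //; apply: (smooth_linear oT).
- exact: xiL.
- by move=> p; exact: dfl_xi.
- exact: etaL.
- by move=> p; exact: dfl_eta.
Qed.

Lemma skew_hess_flat p v w : skew_hess (@flat_potential R n) p v w =
  \sum_i 2 * (xi v i * eta w i - xi w i * eta v i).
Proof.
apply: eq_bigr => i _.
rewrite -(sum_delta_l (fun j => 2 * (xi v i * eta w j - xi w i * eta v j)) i).
by apply: eq_bigr => j _; rewrite hess_flat; ring.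
Qed.

Lemma para_Kahler_flat : para_Kahler setT (@flat_potential R n).
Proof.
have oT : open [set: Dn R n] by exact: openT.
have sf := smooth_flat_potential.
split=> //; split=> [p u v w _|p v _ o0].
  have c0 a b d : 'D_a (fun q => omega (@flat_potential R n) q b d) p = 0.
    have -> : (fun q => omega (@flat_potential R n) q b d) =
        cst (omega (@flat_potential R n) p b d).
      by apply/funext => q; rewrite !(omegaE oT sf)//= !skew_hess_flat.
    exact: derive_cst.
  by rewrite !c0 !addr0.
have s0 w : skew_hess (@flat_potential R n) p v w = 0.
  have := o0 w; rewrite (omegaE oT sf)// => -[] /eqP.
  by rewrite mulf_eq0 oppr_eq0 invr_eq0 pnatr_eq0 /= => /eqP.
apply: eq_null => k; rewrite ?xi0 ?eta0.
  have := s0 (Yf R k); rewrite skew_hess_flat (bigD1 k)//= big1 => [|i ik].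
    rewrite xi_Y eta_Y eqxx addr0 mulr1 mul0r subr0 => /eqP.
    by rewrite mulf_eq0 pnatr_eq0 /= => /eqP.
  by rewrite xi_Y eta_Y eq_sym (negbTE ik) mulr0 mul0r subrr mulr0.
have := s0 (Xf R k); rewrite skew_hess_flat (bigD1 k)//= big1 => [|i ik].
  rewrite xi_X eta_X eqxx addr0 mulr0 mul1r sub0r => /eqP.
  by rewrite mulf_eq0 pnatr_eq0 /= oppr_eq0 => /eqP.
by rewrite xi_X eta_X eq_sym (negbTE ik) mulr0 mul0r subrr mulr0.
Qed.

Lemma toric_flat : toric_para_Kahler setT (@flat_potential R n).
Proof.
split=> //; first exact: para_Kahler_flat.
  exact: connected_Dn.
exists setT, (fun t : 'rV[R]_n => 2 * \sum_k t 0 k).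
have oT : open [set: 'rV[R]_n] by exact: openT.
split=> //.
  apply: smoothM => //; first exact: smooth_cst.
  apply: smooth_sum => // k _; apply: (smooth_linear oT).
    by move=> a x y; rewrite !mxE.
  by move=> t; exact: differentiable_coord.
by move=> z _; split=> //; congr (_ * _); apply: eq_bigr => k _; rewrite mxE.
Qed.
End FlatModel.

Section FlatImmersion.
Variables (R : realType) (n : nat) (U : set (Dn R n)) (phi : Dn R n -> R).
Variable a : 'I_n -> R.
Implicit Types (p v w z : Dn R n) (i j k : 'I_n).
Hypotheses (oU : open U) (a0 : forall i, a i != 0).
Hypothesis ch : constant_hessian U phi a.

(** It pulls [2 xi_i eta_i], a summand of the flat potential, back to [a i xi_i eta_i]. Scaling
    [eta] alone is para-holomorphic, so [a i] may have either sign. *)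
Definition null_scale z : Dn R n := pt (xiv z) (\row_i (a i / 2 * eta z i)).

Let xiN z k : xi (null_scale z) k = xi z k.
Proof. by rewrite xi_pt mxE. Qed.

Let etaN z k : eta (null_scale z) k = a k / 2 * eta z k.
Proof. by rewrite eta_pt mxE. Qed.

Let linN : linear null_scale.
Proof.
move=> s u v; apply: eq_null => k; rewrite ?xiD ?etaD ?xiZ ?etaZ ?xiN ?etaN.
  by rewrite xiD xiZ.
by rewrite etaD etaZ; ring.
Qed.

Let dflN z : differentiable null_scale z.
Proof.
have -> : null_scale = \sum_i (fun z => xi z i *: Xf R i) +
    \sum_i (fun z => (a i / 2 * eta z i) *: Yf R i).
  apply/funext => q; rewrite [RHS]/GRing.add /= !fct_sumE [LHS]null_decomp.
  by congr (_ + _); apply: eq_bigr => i _; rewrite ?xiN ?etaN.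
apply: differentiableD; apply: differentiable_sum => i.
  exact: differentiableZl (dfl_xi i z).
exact: differentiableZl (dflM (dfl_cst _ z) (dfl_eta i z)).
Qed.

Let dN v p : 'D_v null_scale p = null_scale v.
Proof. by rewrite ddE (dvl_linear _ _ linN). Qed.

Lemma holomorphic_null_scale : para_holomorphic_on U null_scale.
Proof.
split=> [|k i p _]; first exact: smooth_linear.
pose A z : R := 2^-1 * (xi z k + a k / 2 * eta z k).
pose B z : R := 2^-1 * (a k / 2 * eta z k - xi z k).
have linA : linear A by move=> s u v; rewrite /A xiD etaD xiZ etaZ /GRing.scale /=; ring.
have linB : linear B by move=> s u v; rewrite /B xiD etaD xiZ etaZ /GRing.scale /=; ring.
have dA : differentiable A p.
  apply: dflM (dfl_cst _ p) (dflD (dfl_xi k p) (dflM (dfl_cst _ p) (dfl_eta k p))).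
have dB : differentiable B p.
  apply: dflM (dfl_cst _ p) (dflB (dflM (dfl_cst _ p) (dfl_eta k p)) (dfl_xi k p)).
have -> : (fun z => Defs.pcomp (null_scale z) k) = fun z => (A z, B z) : pc R.
  apply/funext => z; rewrite /Defs.pcomp /A /B -(etaN z k) -(xiN z k) /xi /eta.
  by congr pair; field.
rewrite /dzbar !ddE !(dvl_pair _ dA dB) !(dvl_linear _ _ linA) !(dvl_linear _ _ linB).
rewrite /A /B !xi_slot !eta_slot.
by congr pair; rewrite /= /GRing.scale /=; ring.
Qed.

Lemma immersion_null_scale :
  para_Kahler_immersion U phi (S := flat_model R n) null_scale.
Proof.
move=> t /=; have -> : U `&` null_scale @^-1` setT = U by apply/seteqP; split=> [z []|z].
split=> //; first exact: holomorphic_null_scale.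
  move=> p v _; rewrite dN => v0; apply: eq_null => k.
    by rewrite -xiN v0.
  have ck : a k / 2 != 0 by rewrite mulf_neq0// invr_eq0 pnatr_eq0.
  by have /esym/eqP := etaN v k; rewrite v0 !eta0 mulf_eq0 (negbTE ck) => /eqP.
move=> p v w [Up _]; rewrite !dN !metricE.
apply: eq_bigr => i _; apply: eq_bigr => j _.
rewrite hess_flat (ch Up) !xiN !etaN; case: eqP => [->|_] /=; last by ring.
by field.
Qed.

Lemma analytic_null_scale : analytic_map U (S := flat_model R n) null_scale.
Proof.
move=> t b p _ _ /=.
pose c := if fintype.split b is inr i then a i / 2 else 1.
have -> : (fun z => ncoord (null_scale z) b) = fun z => c * ncoord z b.
  apply/funext => z; rewrite /ncoord /c; case: fintype.split => i.
    by rewrite xiN mul1r.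
  by rewrite etaN.
exact: analytic_ncoord.
Qed.
End FlatImmersion.

(** * Consequences for immersions into the space forms *)

Section Immersions.
Variables (R : realType) (n : nat).
Implicit Types (U : set (Dn R n)) (phi : Dn R n -> R).

Lemma flat_immersion_rigidity U phi (lambda : R) N (F : Dn R n -> flat_model R N) :
  (0 < n)%N -> toric_para_Kahler U phi -> Einstein U phi lambda ->
  para_Kahler_immersion U phi F ->
  lambda = 0 /\ (analytic_map U F -> flat U phi).
Proof.
move=> n0 [kU cU U0 [Om [Phi [oOm sPhi phiE]]]] ein imm.
have uh q : U q -> hessmx phi q \in unitmx by exact: para_Kahler_unit.
have [oU sphi _] := kU.
have [_ hol _ met] := imm tt.
have UW : U `<=` U `&` F @^-1` setT by [].
have hf : para_holomorphic_on U (F : Dn R n -> Dn R N).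
  by split=> [|k i p /UW]; [exact: smooth_sub UW hol.1 | exact: hol.2].
have mE p i j : U p -> metric (@flat_potential R N) (F p) ('D_(Xf R i) F p)
    ('D_(Yf R j) (F : Dn R n -> Dn R N) p) = metric phi p (Xf R i) (Yf R j).
  by move=> Up; exact: (met p _ _ (UW p Up)).
have [r r0 rU] := open_box_sub oU U0.
have fr : finite_rank r Phi.
  by apply: (flat_finite_rank sphi phiE oU _ hf r0 rU) => // p i j; exact: mE.
have [lam0 [V [a [oV V0 ch]]]] :=
  flat_target_rigidity n0 oU U0 sphi uh oOm sPhi phiE r0 rU ein fr.
split=> // an; apply: (constant_flat oU (a := a)).
apply: (constant_hessian_continuation oU hf mE _ cU U0 oV V0 ch) => b p Up.
exact: (an tt b p Up I).
Qed.

Lemma projective_immersion_impossible U phi c N (F : Dn R n -> projective_model c N) :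
  (0 < n)%N -> toric_para_Kahler U phi -> Ricci_flat U phi -> c != 0 ->
  ~ para_Kahler_immersion U phi F.
Proof.
move=> n0 [kU cU U0 [Om [Phi [oOm sPhi phiE]]]] ein c0 imm.
have uh q : U q -> hessmx phi q \in unitmx by exact: para_Kahler_unit.
have [oU sphi _] := kU.
(* Since the [|Z_i|^2] have positive sum, one is positive; the argument is local at 0, so this
   single chart is enough. *)
have [i0 i0P] : exists i0 : 'I_N.+1, affine_dom i0 (F 0).
  apply: contrapT => nF.
  have : 0 < norm2 (hrep (F 0)) by rewrite /hrep; case: (repr _).
  rewrite ltNge => /negP; apply; apply: sumr_le0 => i _.
  by rewrite leNgt; apply/negP => Fi; apply: nF; exists i.
have [oW hol _ met] := imm i0.
set W := U `&` _ in oW hol met.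
have W0 : W 0 by [].
have [r r0 rW] := open_box_sub oW W0.
have WU : W `<=` U by move=> z [].
have fr := projective_finite_rank sphi phiE oW WU hol r0 rW c0
  (fun p Wp => norm2_affine_chart Wp.2) (fun p i j Wp => met p _ _ Wp).
apply: (projective_target_impossible n0 oU U0 sphi uh oOm sPhi phiE r0 _ ein _ erefl fr).
  exact: subset_trans WU.
by rewrite mulf_neq0// invr_eq0 pnatr_eq0.
Qed.
End Immersions.

Theorem theorem1p1 (R : realType) (n : nat) (n_ge1 : (1 <= n)%N) :
  ((forall (U : set (Dn R n)) (phi : Dn R n -> R),
      toric_para_Kahler U phi -> Ricci_flat U phi ->
      (exists (c : R) (N : nat), (1 <= N)%N /\
         analytically_immersible U phi (space_form c N)) ->
      flat U phi)
   /\
   [/\ toric_para_Kahler setT (@flat_potential R n),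
       Ricci_flat setT (@flat_potential R n) &
       exists (c : R) (N : nat), (1 <= N)%N /\
         analytically_immersible setT (@flat_potential R n)
           (space_form c N)])
  /\
  (forall (U : set (Dn R n)) (phi : Dn R n -> R),
     toric_para_Kahler U phi -> flat U phi ->
     (exists N : nat, (1 <= N)%N /\ immersible U phi (space_form (0 : R) N)) /\
     (forall (c : R) (N : nat), c != 0 -> (1 <= N)%N ->
        ~ immersible U phi (space_form c N)))
  /\
  (forall (U : set (Dn R n)) (phi : Dn R n -> R) (lambda : R),
     toric_para_Kahler U phi -> Einstein U phi lambda ->
     (exists N : nat, (1 <= N)%N /\
        analytically_immersible U phi (space_form (0 : R) N)) ->
     lambda = 0).
Proof.
have sf0 N : space_form (0 : R) N = flat_model R N by rewrite /space_form eqxx.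
have sfc c N : c != 0 -> space_form c N = projective_model c N.
  by rewrite /space_form => /negbTE ->.
have oT : open [set: Dn R n] by exact: openT.
have ch0 := @constant_hessian_flat_potential R n.
split; [split|split].
- move=> U phi tU rf [c [N [_]]].
  have [->|c0] := eqVneq c 0.
    by rewrite sf0 => -[F [imm]]; exact: (flat_immersion_rigidity n_ge1 tU rf imm).2.
  by rewrite sfc// => -[F [/(projective_immersion_impossible n_ge1 tU rf c0)]].
- split; [exact: toric_flat|exact: constant_Ricci_flat oT ch0|].
  exists 0, n; split=> //; rewrite sf0.
  exists (null_scale (fun _ => 2)); split.
    by apply: immersion_null_scale => // i; rewrite pnatr_eq0.
  exact: analytic_null_scale.
- move=> U phi tU fl.
  have [kU cU U0 [Om [Phi [oOm sPhi phiE]]]] := tU.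
  have uh q : U q -> hessmx phi q \in unitmx by exact: para_Kahler_unit.
  have [oU sphi _] := kU.
  (* A constant diagonal [h] serves both halves: [null_scale] immerses it into the flat model, and
     it is Ricci-flat, as the projective obstruction requires. *)
  have ch := flat_constant_hessian oU cU U0 sphi uh sPhi phiE fl.
  split.
    exists n; split=> //; rewrite sf0.
    exists (null_scale (fun j => 'DD_(ev R j) Phi 0)).
    by apply: immersion_null_scale => // i; exact: Phi_D_neq0 phiE i.
  move=> c N c0 _; rewrite sfc// => -[F].
  exact: (projective_immersion_impossible n_ge1 tU (constant_Ricci_flat oU ch) c0).
- move=> U phi lambda tU ein [N [_]]; rewrite sf0 => -[F [imm _]].
  exact: (flat_immersion_rigidity n_ge1 tU ein imm).1.
Qed.
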